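(* For the cyclic adjacent transposition (CAT) shuffle of $n$ cards, with mixing time $t_{mix}$, we have that for any $\varepsilon>0$: (a) There is a universal constant $c$ such that $$t_{mix}(1-\varepsilon)\ \ge\ \frac{n^3}{2\pi^2}\log n-\frac{n^3}{2\pi^2}\log\left(\frac{c\log n}{\varepsilon}\right).$$ (b) $$t_{mix}(\varepsilon)\ \le\ (1+o(1))\,\frac{n^3}{2\pi^2}\log n \qquad (n\to\infty).$$
   Context: The CAT shuffle is the following process on the symmetric group $S_n$. The $n$ cards are placed on the vertices (positions) $1,\dots,n$ of a path of length $n-1$; the edges are $(x,x+1)$, $x=1,\dots,n-1$. Time is divided into consecutive rounds of $n-1$ steps. At the beginning of each round (i.e. just before each time $t\equiv 1 \bmod (n-1)$) an independent fair coin is flipped to choose a direction. If the direction is left to right, then at the $j$-th step of the round ($j=1,\dots,n-1$), with probability $1/2$ the cards at the ends of the edge $(j,j+1)$ are transposed, and otherwise nothing is done; if the direction is right to left, the same is done with the edge $(n-j,n-j+1)$. All coin tosses are independent. Let $P_x^t(y)$ be the probability of moving from $x$ to $y$ in $t$ steps, $\mu$ the uniform measure on $S_n$, and $d_x(t)=\|P_x^t-\mu\|_{T.V.}=\frac12\sum_{y\in S_n}|P_x^t(y)-\mu(y)|$. The mixing time is $t_{mix}(\varepsilon)=\min\{t\in\mathbb N:\max_{x\in S_n} d_x(t)\le\varepsilon\}$. ''Universal'' means independent of $n$ and $\varepsilon$. In (b), $\varepsilon$ is fixed and $o(1)$ is as $n\to\infty$. *)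

(* Defs.v *)
From mathcomp Require Import all_boot all_order all_fingroup all_algebra.
From mathcomp Require Import all_classical all_reals all_analysis.

Set Implicit Arguments.
Unset Strict Implicit.
Unset Printing Implicit Defensive.

Import Order.TTheory GRing.Theory Num.Theory.
Local Open Scope ring_scope.

(** Positions and times are 0-based. An arrangement of the [n] cards is a
    permutation [x : 'S_n] sending a position to the card lying there. *)

(** Transposition of positions [k] and [k.+1]; the identity if [n <= k.+1],
    which never happens for the edges used by the shuffle. *)
Definition adj_tperm (n k : nat) : 'S_n :=
  match insub k, insub k.+1 with
  | Some a, Some b => tperm a b
  | _, _ => 1%g
  end.

(** Left end of the edge updated at step [j < n.-1] of a round. In 1-based
    notation, with [j' = j.+1], the edge is [(j', j'+1)] going left to right
    ([ltr = true]) and [(n-j', n-j'+1)] going right to left. *)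
Definition cat_edge (n : nat) (ltr : bool) (j : nat) : nat :=
  if ltr then j else (n - j.+2)%N.

(** Arrangement after [t] steps from [x]: [nth false dir r] is the direction
    of round [r], and [nth false swap s] tells whether the edge visited at
    step [s] gets its cards transposed. Since [(u * v) i = v (u i)] for
    permutations, multiplying on the left by a transposition acts on
    positions. *)
Fixpoint cat_state (n : nat) (x : 'S_n) (dir swap : seq bool) (t : nat) : 'S_n :=
  if t is s.+1 then
    let y := cat_state x dir swap s in
    if nth false swap s then
      (adj_tperm n (cat_edge n (nth false dir (s %/ n.-1)) (s %% n.-1)) * y)%g
    else y
  else x.

(** [P_x^t(y)], computed on the uniform space of [t] direction coins and [t]
    transposition coins. Only the first [ceil (t / n.-1) <= t] direction coins
    are read, so the others do not affect the law. *)
Definition cat_prob (R : realType) (n : nat) (t : nat) (x y : 'S_n) : R :=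
  #|[set w : t.-tuple bool * t.-tuple bool | cat_state x w.1 w.2 t == y]|%:R
  / #|{: t.-tuple bool * t.-tuple bool}|%:R.

Definition uniform_dist (R : realType) (T : finType) (y : T) : R :=
  #|T|%:R^-1.

Definition tv_dist (R : realType) (T : finType) (p q : T -> R) : R :=
  2^-1 * \sum_(y : T) `|p y - q y|.

Definition cat_dist (R : realType) (n : nat) (x : 'S_n) (t : nat) : R :=
  tv_dist (cat_prob R t x) (@uniform_dist R {perm 'I_n}).

(** Total variation distances are nonnegative, so starting the maximum at [0]
    is harmless. *)
Definition cat_max_dist (R : realType) (n : nat) (t : nat) : R :=
  \big[Num.max/0]_(x : 'S_n) cat_dist R x t.

(** The least [t] with [cat_max_dist R n t <= eps], as an extended real: it is
    [+oo] if there is no such [t], for instance if [eps < 0]. *)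
Definition cat_tmix (R : realType) (n : nat) (eps : R) : \bar R :=
  ereal_inf [set (t%:R)%:E | t in [set t : nat | cat_max_dist R n t <= eps]]%classic.

(* Main.v *)
Require Import Defs.
From mathcomp Require Import all_boot all_order all_fingroup all_algebra.
From mathcomp Require Import all_classical all_reals all_analysis.
From mathcomp Require Import ring lra zify.
Import Order.TTheory GRing.Theory Num.Theory.
Import numFieldNormedType.Exports.
Local Open Scope ring_scope.

(** Every step averages a function of the arrangement over a lazy flip, so the
    shuffle is governed by the operator of a round: the mean of a left-to-right
    and of a right-to-left sweep of lazy flips. On additive statistics, sums
    over positions of a weight [g] times a function of the card lying there,
    this operator acts through the one-card operator [round1] on [g]
    ([round_addstat]). In one dimension everything is explicit. The cosine
    [cos (pi (x + 1/2) / n)] has Rayleigh quotient at least [1 - pi^2 / n^2]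
    ([round1_rayleigh]); conversely, if the gradient of a function is dominated
    by a cosine wave, a round multiplies this bound by [wave_rate]
    ([wave_contract]), which gives a spectral gap with the same leading term
    ([spectral_gap]). A round has [n - 1] steps, which explains the order n^3.

    Lower bound. The additive statistic of this cosine has mean about
    [n / 2 * (1 - pi^2 / n^2)^r] after [r] rounds. Its variance stays of order
    [n * ln n] ([addstat_variance]), and is of order [n] at equilibrium, so
    before the announced time the two laws are distinguished by Chebyshev's
    inequality ([cat_max_dist_lower]).

    Upper bound. Order the arrangements by heights, with the identity on top
    (Bruhat order). Flips preserve increasing functions, hence the law of the
    deck started from the identity has an increasing density, and censoring
    updates can only move it away from uniform ([censored_phases],
    [increasing_l1_le]). Cut the deck into a fixed number [K] of blocks and
    keep only the edges inside the blocks during short initial and final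
    phases, which amount to exact shuffles of each block ([block_mixing]), since
    blocks are [K] times shorter and mix about K^2 times faster. In between, the
    full shuffle runs for slightly more than the announced time.

    The resulting law is invariant under permutations of positions inside
    blocks and of cards of the same type, the type of a card being its final
    block. It is compared with its images under random flips of a matching of
    two blocks. Because the density is increasing, the total cost of exchanging
    two cards of different types between different blocks is bounded by the
    mean of a centred additive statistic ([addstat_dirichlet], [swap_cost_bound]),
    which has decayed to slightly less than n^1/2. On the other hand a
    matching has of the order of [n] lanes carrying two given types, with high
    probability ([bad_lanes_le], [low_count_le]), so that flipping them at
    random is a binomial smoothing, and an isoperimetric inequality for the
    binomial law gains a factor n^-1/2 ([binomial_l1], [cost_bound]). Thus
    random flips of matchings barely change the law; but about [ln n] of them,
    alternated with shuffles of the blocks, bring any law close to uniform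
    ([near_uniform]). Taking [K] large makes the local phases negligible,
    whence the factor [1 + o(1)]. *)

Set Implicit Arguments.
Unset Strict Implicit.
Unset Printing Implicit Defensive.

(** * From coin tosses to averaging operators *)

Section Coins.
Variable R : realType.

Definition coin_avg (t : nat) (F : seq bool -> R) : R :=
  (\sum_(w : t.-tuple bool) F w) / 2 ^+ t.

Lemma coin_avg_eq t F G :
  (forall w, size w = t -> F w = G w) -> coin_avg t F = coin_avg t G.
Proof.
move=> FG; congr (_ / _); apply: eq_bigr => w _.
by rewrite FG ?size_tuple.
Qed.

Lemma coin_avg_const t (c : R) : coin_avg t (fun=> c) = c.
Proof.
rewrite /coin_avg sumr_const card_tuple card_bool.
rewrite -[X in X / _]mulr_natr natrX mulfK //.
Qed.

Lemma coin_avgDh t F G :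
  coin_avg t (fun w => (F w + G w) / 2) = (coin_avg t F + coin_avg t G) / 2.
Proof. by rewrite /coin_avg -mulr_suml big_split /=; ring. Qed.

Lemma coin_avg_rcons t F :
  coin_avg t.+1 F = (coin_avg t (fun w => F (rcons w true))
                     + coin_avg t (fun w => F (rcons w false))) / 2.
Proof.
pose h (p : t.-tuple bool * bool) := [tuple of rcons p.1 p.2].
have hb : bijective h.
  apply: inj_card_bij => [[u a] [v b] /(congr1 val)/= /rcons_inj[uv ->]|].
    by congr pair; apply: val_inj.
  by rewrite card_prod !card_tuple card_bool expnSr.
rewrite /coin_avg (reindex h) /=; last exact: onW_bij.
rewrite -(pair_big xpredT xpredT (fun u b => F (rcons (tval u) b))) /=.
under eq_bigr do rewrite big_bool.
rewrite big_split /= exprS invfM; ring.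
Qed.

Lemma coin_avg_cons t F :
  coin_avg t.+1 F = (coin_avg t (fun w => F (true :: w))
                     + coin_avg t (fun w => F (false :: w))) / 2.
Proof.
pose h (p : t.-tuple bool * bool) := [tuple of p.2 :: p.1].
have hb : bijective h.
  apply: inj_card_bij => [[u a] [v b] /(congr1 val)/= [-> uv]|].
    by congr pair; apply: val_inj.
  by rewrite card_prod !card_tuple card_bool expnSr.
rewrite /coin_avg (reindex h) /=; last exact: onW_bij.
rewrite -(pair_big xpredT xpredT (fun u b => F (b :: tval u))) /=.
under eq_bigr do rewrite big_bool.
rewrite big_split /= exprS invfM; ring.
Qed.

End Coins.

Section Operators.
Variables (R : realType) (n : nat).
Implicit Types (f g p : 'S_n -> R) (x y : 'S_n).

Definition lazy_flip (s : 'S_n) f : 'S_n -> R :=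
  fun x => (f x + f (s * x)%g) / 2.

Definition sweep (es : seq nat) f : 'S_n -> R :=
  foldr (fun e => lazy_flip (adj_tperm n e)) f es.

(** The [s] first edges of a left-to-right, resp. right-to-left, round that
    pass the filter [S]; the filter is what censoring needs. *)
Definition up_edges (S : pred nat) (s : nat) : seq nat :=
  [seq e <- iota 0 s | S e].
Definition down_edges (S : pred nat) (s : nat) : seq nat :=
  [seq e <- [seq (n - j.+2)%N | j <- iota 0 s] | S e].

Definition round (S : pred nat) (s : nat) f : 'S_n -> R :=
  fun x => (sweep (up_edges S s) f x + sweep (down_edges S s) f x) / 2.

Lemma sweep_cat es1 es2 f : sweep (es1 ++ es2) f = sweep es1 (sweep es2 f).
Proof. by rewrite /sweep foldr_cat. Qed.

Let edge_at (D : seq bool) (s : nat) : nat :=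
  cat_edge n (nth false D (s %/ n.-1)) (s %% n.-1).

Let edges_of D t := [seq edge_at D s | s <- iota 0 t].

Lemma cat_state_rcons x D w b t :
  size w = t -> cat_state x D (rcons w b) t = cat_state x D w t.
Proof.
move=> sw; have: (t <= size w)%N by rewrite sw.
elim: t {sw} => //= s IHs ssw.
by rewrite IHs 1?ltnW// nth_rcons ssw.
Qed.

Lemma swap_avg x D f t :
  coin_avg t (fun w => f (cat_state x D w t)) = sweep (edges_of D t) f x.
Proof.
elim: t f => [|t IHt] f; first exact: (coin_avg_const 0 (f x)).
rewrite coin_avg_rcons /edges_of -addn1 iotaD map_cat sweep_cat /= -IHt.
rewrite addrC /lazy_flip coin_avgDh; congr ((_ + _) / 2).
  apply: coin_avg_eq => w sw; rewrite addn1 /= nth_rcons sw ltnn eqxx.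
  by rewrite cat_state_rcons.
apply: coin_avg_eq => w sw; rewrite addn1 /= nth_rcons sw ltnn eqxx.
by rewrite cat_state_rcons.
Qed.

Lemma edges_of_first b D s : (s <= n.-1)%N ->
  edges_of (b :: D) s = if b then up_edges predT s else down_edges predT s.
Proof.
move=> sn; rewrite /edges_of.
transitivity [seq cat_edge n b j | j <- iota 0 s].
  apply/eq_in_map => j; rewrite mem_iota add0n /= => js.
  have jn : (j < n.-1)%N by lia.
  by rewrite /edge_at divn_small // modn_small.
rewrite /cat_edge /up_edges /down_edges !filter_predT.
by case: b; rewrite ?map_id.
Qed.

Lemma edges_of_shift b D t : (0 < n.-1)%N ->
  edges_of (b :: D) (n.-1 + t) = edges_of (b :: D) n.-1 ++ edges_of D t.
Proof.
move=> n1; rewrite /edges_of iotaD map_cat add0n; congr (_ ++ _).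
rewrite -[X in iota X]addn0 iotaDl -map_comp; apply: eq_map => j /=.
by rewrite /edge_at modnDl divnDl ?dvdnn // divnn n1 add1n.
Qed.

(** A round reads only its own direction coin, so peeling off the first coin
    peels off the first round. *)
Lemma direction_avg x r s k f : (0 < n.-1)%N -> (s <= n.-1)%N -> (r < k)%N ->
  coin_avg k (fun D => sweep (edges_of D (r * n.-1 + s)) f x)
  = iter r (round predT n.-1) (round predT s f) x.
Proof.
move=> n1 sn; elim: r x k => [|r IHr] x [|k] //= rk.
  rewrite mul0n add0n coin_avg_cons.
  under coin_avg_eq do rewrite edges_of_first //.
  under [X in _ + X]coin_avg_eq do rewrite edges_of_first //.
  by rewrite !coin_avg_const.
have avg_sweep es F : coin_avg k (fun D => sweep es (F D) x)
    = sweep es (fun y => coin_avg k (fun D => F D y)) x.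
  elim: es x {IHr} => //= e es IH x.
  by rewrite /lazy_flip coin_avgDh !IH.
have -> : (r.+1 * n.-1 + s = n.-1 + (r * n.-1 + s))%N by lia.
rewrite coin_avg_cons.
under coin_avg_eq do rewrite edges_of_shift // edges_of_first // sweep_cat.
under [X in _ + X]coin_avg_eq do
  rewrite edges_of_shift // edges_of_first // sweep_cat.
rewrite !avg_sweep [in RHS]/round.
by congr ((sweep _ _ x + sweep _ _ x) / 2); apply/funext => y; apply: IHr.
Qed.

Lemma sum_cat_prob x t f :
  \sum_y cat_prob R t x y * f y
  = coin_avg t (fun D => coin_avg t (fun w => f (cat_state x D w t))).
Proof.
rewrite /cat_prob.
under eq_bigr => y _ do rewrite -sum1dep_card natr_sum mulrAC mulr_suml.
rewrite -mulr_suml.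
transitivity ((\sum_(w : t.-tuple bool * t.-tuple bool)
   f (cat_state x w.1 w.2 t)) / #|{: t.-tuple bool * t.-tuple bool}|%:R).
  congr (_ / _); rewrite (exchange_big_dep xpredT) //=.
  apply: eq_bigr => w _; rewrite (big_pred1 (cat_state x w.1 w.2 t)) ?mul1r //.
rewrite card_prod card_tuple card_bool natrM natrX.
rewrite -(pair_big xpredT xpredT
  (fun (u v : t.-tuple bool) => f (cat_state x u v t))) /= /coin_avg.
rewrite -mulr_suml -mulrA -invfM.
by [].
Qed.

(** Averaging over the coins of successive steps composes one lazy flip per
    step, with the flip of the first step outermost. *)
Lemma sum_cat_prob_round x r s f : (1 < n)%N -> (0 < s <= n.-1)%N ->
  \sum_y cat_prob R (r * n.-1 + s) x y * f y
  = iter r (round predT n.-1) (round predT s f) x.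
Proof.
move=> n1 /andP[s0 sn]; rewrite sum_cat_prob.
under coin_avg_eq do rewrite swap_avg.
apply: direction_avg => //; [lia|nia].
Qed.

(** Steps multiply on the left, whereas the initial arrangement sits on the
    right. *)
Lemma cat_stateM x D w t : cat_state x D w t = (cat_state 1 D w t * x)%g.
Proof.
elim: t => /= [|t ->]; first by rewrite mul1g.
by case: ifP; rewrite ?mulgA.
Qed.

(** Multiplication on the right permutes the names of the cards, so all
    starting arrangements are equally far from uniform. *)
Lemma cat_max_distE t : cat_max_dist R n t = cat_dist R (1 : 'S_n)%g t.
Proof.
have eqd x : cat_dist R x t = cat_dist R (1 : 'S_n)%g t.
  rewrite /cat_dist /tv_dist; congr (_ * _).
  rewrite (reindex_inj (mulIg x)) /=; apply: eq_bigr => y _.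
  rewrite /uniform_dist; congr `| _ - _ |; rewrite /cat_prob; congr (_%:R / _).
  by apply: eq_card => w; rewrite !inE cat_stateM (can_eq (mulgK x)).
rewrite /cat_max_dist; under eq_bigr do rewrite eqd.
rewrite big_const.
have d0 : 0 <= cat_dist R (1 : 'S_n)%g t.
  by rewrite /cat_dist /tv_dist mulr_ge0 // sumr_ge0.
have : (0 < #|'S_n|)%N by apply/card_gt0P; exists 1%g.
case: #|_| => // k _; elim: k => /= [|k IHk]; first by apply/max_idPl.
by rewrite IHk maxxx.
Qed.

End Operators.

(** * The trajectory of a single card *)

Section OneCard.
Variable R : realType.
Implicit Types (b g h : nat -> R) (e x : nat) (es : seq nat).

Definition grad g e : R := g e.+1 - g e.

(** One-card counterpart of [lazy_flip]: a card lying at an end of the updated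
    edge goes to either end with probability one half. *)
Definition avg1 e g : nat -> R :=
  fun x => if (x == e) || (x == e.+1) then (g e + g e.+1) / 2 else g x.

Definition sweep1 es g : nat -> R := foldr avg1 g es.

Lemma sweep1_cat es1 es2 g : sweep1 (es1 ++ es2) g = sweep1 es1 (sweep1 es2 g).
Proof. by rewrite /sweep1 foldr_cat. Qed.

Lemma sweep1_lin es (c : R) g h :
  sweep1 es (fun x => c * g x + h x)
  = fun x => c * sweep1 es g x + sweep1 es h x.
Proof.
elim: es => //= e es ->; apply/funext => x; rewrite /avg1.
by case: ifP => // _; ring.
Qed.

Lemma sweep1_const es (c : R) : sweep1 es (fun=> c) = fun=> c.
Proof.
elim: es => //= e es ->; apply/funext => x; rewrite /avg1.
by case: ifP => // _; field.
Qed.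

Lemma sweep1_mono es g :
  {homo g : x y / (x <= y)%N >-> x <= y} ->
  {homo sweep1 es g : x y / (x <= y)%N >-> x <= y}.
Proof.
move=> gm; elim: es => //= e es; set k := sweep1 es g => km x y xy.
rewrite /avg1; have k1 := km e e.+1 (leqnSn e).
case: ifP => [/orP xe|/negbT/norP[xe xe1]]; case: ifP => [/orP ye|/negbT/norP[ye ye1]] //.
- have k2 : k e.+1 <= k y.
    apply: km; case: xe => /eqP xe; first by move: ye ye1 xy; rewrite xe; lia.
    by rewrite -xe.
  by lra.
- have k2 : k x <= k e.
    by apply: km; case: ye => /eqP ye; move: xe xe1 xy; rewrite ye; lia.
  by lra.
- exact: km.
Qed.

(** Each entry records an edge and the gradient that the function has there
    when that edge is about to be averaged. *)
Fixpoint sweep_grads es g : seq (nat * R) :=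
  if es is e :: es' then (e, grad (sweep1 es' g) e) :: sweep_grads es' g
  else [::].


Section UpSweep.
Variables (S : pred nat) (g : nat -> R).

(** Value at the moving end [x] of what remains of the sweep once the edges
    below [x] are removed; [k] edges remain. *)
Fixpoint front x k : R :=
  if k is k'.+1 then if S x then (g x + front x.+1 k') / 2 else g x
  else g x.

Let suffix j k := sweep1 [seq e <- iota j k | S e] g.

Lemma suffix_lt j k x : (x < j)%N -> suffix j k x = g x.
Proof.
elim: k j => //= k IHk j xj; rewrite /suffix /=.
have IH : suffix j.+1 k x = g x by apply: IHk; lia.
case: ifP => // _ /=; rewrite /avg1 -/(suffix _ _).
by case: ifP => //; lia.
Qed.

Lemma suffix_front j k : suffix j k j = front j k.
Proof.
elim: k j => //= k IHk j; rewrite /suffix /=; case: ifP => Sj /=.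
  by rewrite /avg1 eqxx /= -/(suffix _ _) suffix_lt ?ltnSn// IHk.
by rewrite -/(suffix _ _) suffix_lt.
Qed.

Lemma suffix_gt j k x : (j < x <= j + k)%N ->
  suffix j k x = if S x.-1 then (g x.-1 + front x (j + k - x)) / 2
                 else front x (j + k - x).
Proof.
elim: k j => [|k IHk] j /andP[jx xk]; first by lia.
rewrite /suffix /=.
have -> : (j + k.+1 - x = j.+1 + k - x)%N by lia.
have [xj|xj] := eqVneq x j.+1.
  rewrite xj /= addKn.
  case: ifP => Sj /=; last by rewrite -/(suffix _ _) suffix_front.
  by rewrite /avg1 eqxx orbT /= -/(suffix _ _) suffix_front suffix_lt.
have IH := IHk j.+1 _.
case: ifP => Sj /=; last by rewrite -/(suffix _ _) IH //; lia.
rewrite /avg1 -/(suffix _ _); case: ifP; first by lia.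
by move=> _; rewrite IH //; lia.
Qed.

Lemma suffix_beyond j k x : (j + k < x)%N -> suffix j k x = g x.
Proof.
elim: k j => //= k IHk j xj; rewrite /suffix /=.
have IH : suffix j.+1 k x = g x by apply: IHk; lia.
case: ifP => // _ /=; rewrite /avg1 -/(suffix _ _).
by case: ifP => //; lia.
Qed.

Lemma sweep_grads_up N :
  sweep_grads (up_edges S N) g
  = [seq (x, front x.+1 (N - x.+1) - g x) | x <- up_edges S N].
Proof.
rewrite /up_edges.
suff H j k : (j + k = N)%N -> sweep_grads [seq e <- iota j k | S e] g
  = [seq (x, front x.+1 (N - x.+1) - g x) | x <- [seq e <- iota j k | S e]].
  by apply: H; rewrite add0n.
elim: k j => //= k IHk j jk; case: ifP => Sj /=; last by rewrite IHk //; lia.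
rewrite IHk ?addSnnS//; congr ((_, _) :: _).
rewrite /grad -/(suffix _ _) suffix_front suffix_lt//; congr (front _ _ - _).
by lia.
Qed.

Lemma sweep1_upE N x : (0 < x <= N)%N ->
  sweep1 (up_edges S N) g x = if S x.-1 then (g x.-1 + front x (N - x)) / 2
                              else front x (N - x).
Proof. by move=> xN; rewrite /up_edges -/(suffix _ _) suffix_gt ?add0n. Qed.

Lemma sweep1_up0 N : sweep1 (up_edges S N) g 0%N = front 0 N.
Proof. by rewrite /up_edges -/(suffix _ _) suffix_front. Qed.

Lemma sweep1_up_beyond N x : (N < x)%N -> sweep1 (up_edges S N) g x = g x.
Proof. by move=> xN; rewrite /up_edges -/(suffix _ _) suffix_beyond ?add0n. Qed.

(** If [ph] bounds the gradient of [g], a supersolution [ps] of the recursion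
    satisfied by the gradient of [front] bounds the latter. *)
Variables (N : nat) (ph ps : nat -> R) (C : R).
Hypothesis C0 : 0 <= C.
Hypothesis gph : forall x, S x -> (x < N)%N -> `|grad g x| <= C * ph x.
Hypothesis phps : forall x, S x -> (x < N)%N ->
  (ph x + (if (x.+1 < N)%N && S x.+1 then ps x.+1 else 0)) / 2 <= ps x.

(** Backward induction along the recursion of [front]: the supersolution is
    preserved by one more averaging. *)
Lemma front_grad x : S x -> (x < N)%N ->
  `|front x.+1 (N - x.+1) - g x| <= 2 * C * ps x.
Proof.
move=> Sx xN; have [k kN] : exists k, (k = N - x.+1)%N by eexists.
rewrite -kN; elim: k x Sx xN kN => [|k IHk] x Sx xN kN.
  have := gph Sx xN; have := phps Sx xN.
  have -> : (x.+1 < N)%N = false by lia.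
  rewrite addr0 /grad /= => p1 p2; apply: le_trans p2 _.
  by rewrite -mulrA mulrCA ler_wpM2l//; lra.
rewrite /=; have := gph Sx xN; have := phps Sx xN.
have x1N : (x.+1 < N)%N by lia.
rewrite x1N /grad /=; case: ifP => Sx1 p1 p2; last first.
  by apply: le_trans p2 _; rewrite -mulrA mulrCA ler_wpM2l//; lra.
have kN' : (k = N - x.+2)%N by lia.
have := IHk x.+1 Sx1 x1N kN'; set F := front _ _ => p3.
have -> : (g x.+1 + F) / 2 - g x = (g x.+1 - g x) + (F - g x.+1) / 2 by field.
apply: le_trans (ler_normD _ _) _; rewrite normrM [`|2^-1|]gtr0_norm//.
have : C * (ph x + ps x.+1) <= C * (2 * ps x) by rewrite ler_wpM2l//; lra.
lra.
Qed.

Lemma up_grad x : S x -> (x < N)%N ->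
  `|grad (sweep1 (up_edges S N) g) x|
  <= C * (if (0 < x)%N && S x.-1 then (ph x.-1 + ps x) / 2 else 0).
Proof.
move=> Sx xN; rewrite /grad sweep1_upE ?xN//= Sx.
have fx : front x (N - x) = (g x + front x.+1 (N - x.+1)) / 2.
  by rewrite -[(N - x)%N]prednK ?subn_gt0// -subnS /= Sx.
case: ltnP => [x0|]; last first.
  rewrite leqn0 => /eqP x0; subst x; rewrite sweep1_up0.
  by rewrite -[in X in _ - X](subn0 N) fx subn1 subrr normr0 mulr0.
rewrite sweep1_upE ?x0 1?ltnW//; case: ifP => /= Sx1; last first.
  by rewrite fx subrr normr0 mulr0.
have := front_grad Sx xN; rewrite fx; set F := front _ _ => p1.
have x1N : (x.-1 < N)%N by lia.
have := gph Sx1 x1N; rewrite /grad (prednK x0) => p2.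
have -> : (g x + F) / 2 - (g x.-1 + (g x + F) / 2) / 2
  = (F - g x) / 4 + (g x - g x.-1) / 2 by field.
apply: le_trans (ler_normD _ _) _; rewrite !normrM [`|2^-1|]gtr0_norm//.
by rewrite [`|4^-1|]gtr0_norm//; lra.
Qed.

End UpSweep.

(** * Left-right reflection *)

Section Reflect.
Variable n : nat.

Definition flip_pos x : nat := (n.-1 - x)%N.

Lemma flip_posK x : (x < n)%N -> flip_pos (flip_pos x) = x.
Proof. by rewrite /flip_pos; lia. Qed.

Lemma avg1_flip e g h : (e.+1 < n)%N ->
  (forall x, (x < n)%N -> g x = h (flip_pos x)) ->
  forall x, (x < n)%N -> avg1 (n.-2 - e) g x = avg1 e h (flip_pos x).
Proof.
move=> en gh x xn; rewrite /avg1.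
have E1 : (x == n.-2 - e)%N = (flip_pos x == e.+1) by rewrite /flip_pos; lia.
have E2 : (x == (n.-2 - e).+1)%N = (flip_pos x == e) by rewrite /flip_pos; lia.
rewrite E1 E2 orbC; case: ifP => _; last by rewrite gh.
have H1 : (n.-2 - e < n)%N by lia.
have H2 : ((n.-2 - e).+1 < n)%N by lia.
rewrite !gh// addrC /flip_pos.
by congr ((h _ + h _) / 2); lia.
Qed.

Lemma sweep1_flip es g h : all (fun e => e.+1 < n)%N es ->
  (forall x, (x < n)%N -> g x = h (flip_pos x)) ->
  forall x, (x < n)%N ->
    sweep1 [seq (n.-2 - e)%N | e <- es] g x = sweep1 es h (flip_pos x).
Proof.
move=> + gh; elim: es => [_ x xn|e es IH /= /andP[en esn] x xn]; first exact: gh.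
by apply: avg1_flip => // y yn; apply: IH.
Qed.

Lemma sweep_grads_flip es g : all (fun e => e.+1 < n)%N es ->
  sweep_grads [seq (n.-2 - e)%N | e <- es] g
  = [seq ((n.-2 - p.1)%N, - p.2) | p <- sweep_grads es (fun x => g (flip_pos x))].
Proof.
elim: es => //= e es IH /andP[en esn]; rewrite IH//; congr ((_, _) :: _).
have H x : (x < n)%N -> sweep1 [seq (n.-2 - e)%N | e <- es] g x
    = sweep1 es (fun x => g (flip_pos x)) (flip_pos x).
  by apply: sweep1_flip => // y yn; rewrite flip_posK.
rewrite /grad !H; [|lia|lia]; rewrite opprB /flip_pos.
by congr (sweep1 _ _ _ - sweep1 _ _ _); lia.
Qed.

Lemma down_edgesE S s : (s <= n.-1)%N ->
  down_edges n S s
  = [seq (n.-2 - e)%N | e <- up_edges (fun e => S (n.-2 - e)%N) s].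
Proof.
move=> sn; rewrite /down_edges /up_edges.
have -> : [seq (n - j.+2)%N | j <- iota 0 s] = [seq (n.-2 - j)%N | j <- iota 0 s].
  by apply: eq_map => j; lia.
by rewrite filter_map.
Qed.

Lemma up_edges_lt S s : (s <= n.-1)%N -> all (fun e => e.+1 < n)%N (up_edges S s).
Proof.
move=> sn; apply/allP => e; rewrite mem_filter mem_iota => /and3P[_ _].
by lia.
Qed.

Lemma down_edges_lt S s : (s <= n.-1)%N ->
  all (fun e => e.+1 < n)%N (down_edges n S s).
Proof.
move=> sn; rewrite down_edgesE//; apply/allP => e /mapP[x].
by rewrite mem_filter mem_iota => /and3P[_ _ xs] ->; lia.
Qed.

End Reflect.

End OneCard.

(** * One-card rounds as symmetric operators *)

Section LogConvex.
Variables (R : realType) (a : nat -> R).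
Hypothesis a_ge0 : forall k, 0 <= a k.
Hypothesis a_logconvex : forall k, a k.+1 ^+ 2 <= a k * a k.+2.

(** The ratios of consecutive terms of a log-convex sequence are
    nondecreasing, so all of them exceed the first one. *)
Lemma logconvex_growth (th : R) : 0 <= th -> th * a 0 <= a 1 ->
  forall k, th ^+ k * a 0 <= a k.
Proof.
move=> th0 h01; have step k : th * a k <= a k.+1.
  elim: k => // k IHk; have [a0|a0] := eqVneq (a k) 0.
    have := a_logconvex k; rewrite a0 mul0r => h.
    have -> : a k.+1 = 0 by apply/eqP; rewrite -sqrf_eq0 eq_le h sqr_ge0.
    by rewrite mulr0.
  have ak : 0 < a k by rewrite lt_neqAle eq_sym a0 a_ge0.
  rewrite -(ler_pM2l ak); apply: le_trans (a_logconvex k).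
  by rewrite mulrCA mulrA expr2 ler_wpM2r.
elim=> [|k IHk]; first by rewrite mul1r.
by rewrite exprS -mulrA (le_trans _ (step k))// ler_wpM2l.
Qed.

Lemma bernoulli_le (x : R) k : 1 <= x -> 1 + k%:R * (x - 1) <= x ^+ k.
Proof.
move=> x1; elim: k => [|k IHk]; first by rewrite mul0r addr0.
have h : 0 <= k%:R * (x - 1) ^+ 2 by rewrite mulr_ge0 ?sqr_ge0.
have x0 : 0 <= x by lra.
have := ler_wpM2l x0 IHk; rewrite exprS -natr1; lra.
Qed.

(** If the first ratio exceeded [lam], so would all the following ones, and
    the sequence would outgrow every multiple of the powers of [lam]. *)
Lemma logconvex_decay (lam C : R) : 0 <= lam ->
  (forall k, a k <= C * lam ^+ k) -> a 1 <= lam * a 0.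
Proof.
move=> lam0 aC; rewrite leNgt; apply/negP => h.
have [a0|a0] := eqVneq (a 0) 0.
  have := a_logconvex 0; rewrite a0 mul0r => h'.
  have a1 : a 1 = 0 by apply/eqP; rewrite -sqrf_eq0 eq_le h' sqr_ge0.
  by move: h; rewrite a0 a1 mulr0 ltxx.
have a0p : 0 < a 0 by rewrite lt_neqAle eq_sym a0 a_ge0.
have [l0|l0] := eqVneq lam 0.
  by have := aC 1%N; move: h; rewrite l0 expr1 mul0r mulr0; lra.
have lp : 0 < lam by rewrite lt_neqAle eq_sym l0.
have h1 : a 1 / a 0 * a 0 <= a 1 by rewrite divfK.
have grow := logconvex_growth (divr_ge0 (a_ge0 1) (a_ge0 0)) h1.
set x := a 1 / a 0 / lam.
have x1 : 1 < x by rewrite /x ltr_pdivlMr// ltr_pdivlMr// mul1r.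
have xC k : x ^+ k * a 0 <= C.
  have lk : 0 < lam ^+ k by rewrite exprn_gt0.
  rewrite -(ler_pM2r lk) (le_trans _ (aC k))//.
  by rewrite mulrAC -exprMn /x divfK.
pose k := Num.bound `|C / a 0 / (x - 1)|.
have kb : C / a 0 / (x - 1) < k%:R.
  by apply: le_lt_trans (ler_norm _) (archi_boundP (normr_ge0 _)).
have := xC k; apply/negP; rewrite -ltNge -ltr_pdivrMr//.
apply: lt_le_trans (bernoulli_le k (ltW x1)).
by move: kb; rewrite ltr_pdivrMr ?subr_gt0//; lra.
Qed.

End LogConvex.

Section Dot.
Variables (R : realType) (n : nat).
Implicit Types (b g h : nat -> R) (es : seq nat).

Definition dot b g : R := \sum_(i < n) b i * g i.

Lemma dotC b g : dot b g = dot g b.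
Proof. by apply: eq_bigr => i _; rewrite mulrC. Qed.


Lemma dot_lin b c g h : dot b (fun x => c * g x + h x) = c * dot b g + dot b h.
Proof.
by rewrite /dot mulr_sumr -big_split /=; apply: eq_bigr => i _; ring.
Qed.

Lemma dot_linl b c g h : dot (fun x => c * g x + h x) b = c * dot g b + dot h b.
Proof. by rewrite dotC dot_lin !(dotC b). Qed.

Lemma dot_ge0 b : 0 <= dot b b.
Proof. by apply: sumr_ge0 => i _; rewrite -expr2 sqr_ge0. Qed.

Lemma dot_cauchy b g : dot b g ^+ 2 <= dot b b * dot g g.
Proof.
have H t : 0 <= dot g g - 2 * t * dot b g + t ^+ 2 * dot b b.
  have := dot_ge0 (fun x => (- t) * b x + g x).
  rewrite dot_lin !dot_linl (dotC g b).
  by move=> h; apply: le_trans h _; rewrite le_eqVlt; apply/orP; left; apply/eqP; ring.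
have [b0|b0] := eqVneq (dot b b) 0.
  rewrite b0 mul0r; have [->|bg] := eqVneq (dot b g) 0; first by rewrite expr0n.
  have := H ((dot g g + 1) / (2 * dot b g)); rewrite b0 mulr0 addr0.
  have -> : 2 * ((dot g g + 1) / (2 * dot b g)) * dot b g = dot g g + 1.
    by field; rewrite bg.
  lra.
have bp : 0 < dot b b by rewrite lt_neqAle eq_sym b0 dot_ge0.
have := H (dot b g / dot b b); rewrite -(pmulr_rge0 _ bp).
have -> : dot b b * (dot g g - 2 * (dot b g / dot b b) * dot b g +
  (dot b g / dot b b) ^+ 2 * dot b b) = dot b b * dot g g - dot b g ^+ 2.
  by field.
lra.
Qed.

Lemma dot_avg1 b g e : (e.+1 < n)%N ->
  dot b g - dot b (avg1 e g) = grad b e * grad g e / 2.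
Proof.
move=> en; have e0 : (e < n)%N by exact: ltnW.
rewrite /dot -sumrB (bigD1 (Ordinal en)) //= (bigD1 (Ordinal e0)) /=; last first.
  by rewrite -val_eqE /=; lia.
rewrite big1 => [|i /andP[i1 i2]].
  by rewrite /avg1 eqxx orbT eqxx /grad /=; field.
move: i1 i2; rewrite -!val_eqE /= /avg1 => /negbTE -> /negbTE ->.
by rewrite subrr.
Qed.

(** Averaging an edge lowers the pairing by half the product of the two
    gradients there; summing over the sweep gives a discrete integration by
    parts. *)
Lemma dot_sweep1 b g es : all (fun e => e.+1 < n)%N es ->
  dot b g - dot b (sweep1 es g)
  = (\sum_(p <- sweep_grads es g) grad b p.1 * p.2) / 2.
Proof.
elim: es => [|e es IH] /=; first by rewrite subrr big_nil mul0r.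
move=> /andP[en esn]; rewrite big_cons mulrDl -(IH esn) /= -dot_avg1//; ring.
Qed.

Lemma dot_avg1C b g e : (e.+1 < n)%N -> dot b (avg1 e g) = dot (avg1 e b) g.
Proof.
move=> en; have := dot_avg1 b g en; have := dot_avg1 g b en.
by rewrite (dotC g b) (dotC g) mulrC; lra.
Qed.

Lemma dot_sweep1_rev b g es : all (fun e => e.+1 < n)%N es ->
  dot b (sweep1 es g) = dot (sweep1 (rev es) b) g.
Proof.
elim: es b => //= e es IH b /andP[en esn].
by rewrite dot_avg1C// IH// rev_cons -cats1 sweep1_cat.
Qed.

Definition dir_edges (S : pred nat) (d : bool) (s : nat) : seq nat :=
  if d then up_edges S s else down_edges n S s.

Lemma dir_edges_lt S d s : (s <= n.-1)%N ->
  all (fun e => e.+1 < n)%N (dir_edges S d s).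
Proof. by case: d; [exact: up_edges_lt|exact: down_edges_lt]. Qed.

Lemma dir_edges_rev S d : rev (dir_edges S d n.-1) = dir_edges S (~~ d) n.-1.
Proof.
suff H : rev (down_edges n S n.-1) = up_edges S n.-1.
  by case: d => //=; rewrite -H revK.
rewrite /down_edges -filter_rev /up_edges; apply: (congr1 (seq.filter S)).
apply: (@eq_from_nth _ 0%N) => [|i]; first by rewrite size_rev size_map.
rewrite size_rev size_map size_iota => i1.
rewrite nth_rev size_map size_iota// (nth_map 0%N) ?size_iota; last by lia.
by rewrite !nth_iota; lia.
Qed.

Lemma size_dir_edges S d s : (size (dir_edges S d s) <= s)%N.
Proof.
by case: d; rewrite /= size_filter (leq_trans (count_size _ _))//
  ?size_map size_iota.
Qed.

Definition round1 S s g : nat -> R :=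
  fun x => (sweep1 (dir_edges S true s) g x
            + sweep1 (dir_edges S false s) g x) / 2.

Lemma dot_round1E b S s g : dot b (round1 S s g)
  = (dot b (sweep1 (dir_edges S true s) g)
     + dot b (sweep1 (dir_edges S false s) g)) / 2.
Proof.
rewrite /dot -big_split /= mulr_suml; apply: eq_bigr => i _.
by rewrite /round1; ring.
Qed.

(** Each averaging is symmetric, and reversing the order of the edges of a
    sweep reverses its direction; hence a round, which mixes both directions
    equally, is symmetric. *)
Lemma dot_dirC S d b g : dot b (sweep1 (dir_edges S d n.-1) g)
  = dot (sweep1 (dir_edges S (~~ d) n.-1) b) g.
Proof. by rewrite dot_sweep1_rev ?dir_edges_lt// dir_edges_rev. Qed.

Lemma dot_roundC S b g : dot b (round1 S n.-1 g) = dot (round1 S n.-1 b) g.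
Proof.
rewrite dot_round1E [RHS]dotC dot_round1E (dot_dirC S true b g).
by rewrite (dot_dirC S false b g) /= addrC; congr ((_ + _) / 2); apply: dotC.
Qed.

Lemma dot_iter_roundC S r b g :
  dot b (iter r (round1 S n.-1) g) = dot (iter r (round1 S n.-1) b) g.
Proof.
elim: r b g => //= r IHr b g; by rewrite dot_roundC IHr -iterSr.
Qed.

Lemma round1_lin S s c g h : round1 S s (fun x => c * g x + h x)
  = fun x => c * round1 S s g x + round1 S s h x.
Proof. by apply/funext => x; rewrite /round1 !sweep1_lin; field. Qed.

Lemma round1_const S s (c : R) : round1 S s (fun=> c) = fun=> c.
Proof. by apply/funext => x; rewrite /round1 !sweep1_const; field. Qed.

Lemma iter_round1_const S s r (c : R) : iter r (round1 S s) (fun=> c) = fun=> c.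
Proof. by elim: r => //= r ->; rewrite round1_const. Qed.

Lemma iter_round1_lin S s r c g h : iter r (round1 S s) (fun x => c * g x + h x)
  = fun x => c * iter r (round1 S s) g x + iter r (round1 S s) h x.
Proof. by elim: r => //= r ->; rewrite round1_lin. Qed.

Lemma round1_mono S s g :
  {homo g : x y / (x <= y)%N >-> x <= y} ->
  {homo round1 S s g : x y / (x <= y)%N >-> x <= y}.
Proof.
move=> gm x y xy; rewrite /round1.
have := sweep1_mono (dir_edges S true s) gm xy.
have := sweep1_mono (dir_edges S false s) gm xy.
lra.
Qed.

End Dot.

Section Lipschitz.
Variables (R : realType) (n : nat).
Implicit Types (b g h : nat -> R) (S : pred nat).

Definition lip (l : R) g := forall e, (e.+1 < n)%N -> `|grad g e| <= l.

Lemma grad_flip g e : (e.+1 < n)%N ->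
  grad (fun x => g (flip_pos n x)) e = - grad g (n.-2 - e)%N.
Proof.
move=> en; rewrite /grad opprB /flip_pos.
by congr (g _ - g _); lia.
Qed.

Lemma lip_flip l g : lip l g -> lip l (fun x => g (flip_pos n x)).
Proof. by move=> gl e en; rewrite grad_flip// normrN gl//; lia. Qed.

Lemma dir_grads_le S d s g l : (s <= n.-1)%N -> 0 <= l -> lip l g ->
  forall p, p \in sweep_grads (dir_edges n S d s) g ->
  (p.1.+1 < n)%N /\ `|p.2| <= 2 * l.
Proof.
move=> sn l0.
have up S' h : lip l h -> forall p, p \in sweep_grads (up_edges S' s) h ->
    (p.1.+1 < n)%N /\ `|p.2| <= 2 * l.
  move=> hl p; rewrite sweep_grads_up => /mapP[x + ->] /=.
  rewrite mem_filter mem_iota add0n => /and3P[Sx _ xs]; split; first by lia.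
  rewrite -[2 * l]mulr1.
  apply: (@front_grad R S' h s (fun=> 1) (fun=> 1) l l0 _ _ x Sx xs).
    by move=> y _ ys; rewrite mulr1; apply: hl; lia.
  by move=> y _ _; case: ifP => _; lra.
case: d => gl p; first exact: up.
rewrite /= down_edgesE// sweep_grads_flip ?up_edges_lt// => /mapP[q qin ->] /=.
have [q1 q2] := up _ _ (lip_flip gl) _ qin.
by rewrite normrN; split => //; lia.
Qed.

Lemma lip_dir_gen d s g l : (s <= n.-1)%N -> 0 <= l -> lip l g ->
  lip (if s == n.-1 then l else 2 * l) (sweep1 (dir_edges n predT d s) g).
Proof.
move=> sn l0.
have up h : lip l h ->
    lip (if s == n.-1 then l else 2 * l) (sweep1 (up_edges predT s) h).
  move=> hl e en; have [es|es|es] := ltngtP e s.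
  - have := @up_grad R predT h s (fun=> 1) (fun=> 1) l l0 _ _ e isT es.
    case: ifP => _ H; apply: le_trans (H _ _) _ => //.
    + by move=> y _ ys; rewrite mulr1; apply: hl; lia.
    + by move=> y _ _; case: ifP => _; lra.
    + by case: ifP => _; lra.
    + by move=> y _ ys; rewrite mulr1; apply: hl; lia.
    + by move=> y _ _; case: ifP => _; lra.
    + by case: ifP => _; lra.
  - rewrite /grad !sweep1_up_beyond//; last by lia.
    by case: ifP => _; apply: le_trans (hl e en) _; lra.
  - have -> : (s == n.-1) = false by lia.
    subst s; rewrite /grad sweep1_up_beyond//.
    case: e en sn => [|e] en sn; first by have := hl _ en; rewrite /grad /=; lra.
    rewrite sweep1_upE ?leqnn// subnn /=.
    have en' : (e.+1 < n)%N by lia.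
    have := hl _ en; have := hl _ en'; rewrite /grad => h1 h2.
    have -> : h e.+2 - (h e + h e.+1) / 2
       = (h e.+2 - h e.+1) + (h e.+1 - h e) / 2 by field.
    apply: le_trans (ler_normD _ _) _; rewrite normrM [`|2^-1|]gtr0_norm//.
    lra.
case: d => gl; first exact: up.
rewrite /= down_edgesE//.
have fl := lip_flip (up _ (lip_flip gl)).
move=> e en; have := fl e en; congr (`|_| <= _).
rewrite /grad !(@sweep1_flip _ n _ g (fun x => g (flip_pos n x))) ?up_edges_lt//;
  by [move=> x xn; rewrite flip_posK|lia].
Qed.

(** The moving end of a sweep carries a gradient of at most twice the
    Lipschitz constant, which the next averaging halves; only a partial sweep
    leaves a doubled gradient behind. *)
Lemma lip_dir d g l : 0 <= l -> lip l g ->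
  lip l (sweep1 (dir_edges n predT d n.-1) g).
Proof. by move=> l0 gl; have := lip_dir_gen d (leqnn _) l0 gl; rewrite eqxx. Qed.

Lemma lip_dir_partial d s g l : (s <= n.-1)%N -> 0 <= l -> lip l g ->
  lip (2 * l) (sweep1 (dir_edges n predT d s) g).
Proof.
move=> sn l0 gl e en; apply: le_trans (lip_dir_gen d sn l0 gl en) _.
by case: ifP => _; lra.
Qed.

Lemma lip_round g l : 0 <= l -> lip l g -> lip l (round1 n predT n.-1 g).
Proof.
move=> l0 gl e en; rewrite /grad /round1.
have := lip_dir true l0 gl en; have := lip_dir false l0 gl en; rewrite /grad.
set a := sweep1 _ g _; set b := sweep1 _ g _.
set a' := sweep1 _ g _; set b' := sweep1 _ g _ => h1 h2.
have -> : (a' + a) / 2 - (b' + b) / 2 = (a' - b' + (a - b)) / 2 by field.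
rewrite normrM [`|2^-1|]gtr0_norm//; have := ler_normD (a' - b') (a - b).
lra.
Qed.

Lemma lip_iter_round r g l : 0 <= l -> lip l g ->
  lip l (iter r (round1 n predT n.-1) g).
Proof. by move=> l0 gl; elim: r => //= r; apply: lip_round. Qed.

(** By the integration by parts above: every edge contributes a product of
    gradients of order [k * l]. *)
Lemma dot_defect S d s b g k l : (s <= n.-1)%N -> 0 <= k -> 0 <= l ->
  lip k b -> lip l g ->
  `|dot n b g - dot n b (sweep1 (dir_edges n S d s) g)| <= n%:R * (k * l).
Proof.
move=> sn k0 l0 bk gl; rewrite dot_sweep1 ?dir_edges_lt//.
rewrite normrM [`|2^-1|]gtr0_norm// ler_pdivrMr//.
apply: le_trans (ler_norm_sum _ _ _) _.
have H := dir_grads_le (S := S) (d := d) sn l0 gl.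
set L := sweep_grads _ _ in H *.
apply: le_trans (_ : \sum_(p <- L) (k * (2 * l)) <= _).
  rewrite !big_seq; apply: ler_sum => p /H[p1 p2]; rewrite normrM.
  by rewrite ler_pM// bk.
rewrite big_const_seq count_predT iter_addr_0 -[_ *+ size _]mulr_natl.
have -> : n%:R * (k * l) * 2 = n%:R * (k * (2 * l)) by ring.
rewrite ler_wpM2r ?mulr_ge0// ler_nat.
have -> : size L = size (dir_edges n S d s).
  by rewrite /L; elim: (dir_edges _ _ _ _) => //= e es ->.
by rewrite (leq_trans (size_dir_edges _ _ _ _))//; lia.
Qed.

Lemma sum_grads_sqr S d s g l : (s <= n.-1)%N -> 0 <= l -> lip l g ->
  \sum_(p <- sweep_grads (dir_edges n S d s) g) p.2 ^+ 2 <= n%:R * (4 * l ^+ 2).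
Proof.
move=> sn l0 gl; have H := dir_grads_le (S := S) (d := d) sn l0 gl.
set L := sweep_grads _ _ in H *.
apply: le_trans (_ : \sum_(p <- L) (4 * l ^+ 2) <= _).
  rewrite !big_seq; apply: ler_sum => p /H[p1 p2].
  have -> : 4 * l ^+ 2 = (2 * l) ^+ 2 by ring.
  by rewrite -[p.2 ^+ 2]real_normK ?num_real// lerXn2r// nnegrE ?mulr_ge0.
rewrite big_const_seq count_predT iter_addr_0 -[_ *+ size _]mulr_natl.
rewrite ler_wpM2r ?mulr_ge0 ?sqr_ge0// ler_nat.
have -> : size L = size (dir_edges n S d s).
  by rewrite /L; elim: (dir_edges _ _ _ _) => //= e es ->.
by rewrite (leq_trans (size_dir_edges _ _ _ _))//; lia.
Qed.

(** Completing squares telescopes the recursion [v x = u x + v x.+1 / 2]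
    of the gradients met by a sweep. *)
Lemma sum_geometric_corr (u v : nat -> R) N :
  (forall x, (x < N)%N -> v x = u x + v x.+1 / 2) -> v N = 0 ->
  \sum_(0 <= x < N) u x * v x <= 2 * \sum_(0 <= x < N) u x ^+ 2.
Proof.
move=> uv vN; rewrite -subr_ge0.
have : \sum_(0 <= x < N) (v x ^+ 2 - v x.+1 ^+ 2) = v 0%N ^+ 2.
  rewrite (@telescope_sumr_eq _ 0 N (fun x => - v x ^+ 2))//; first by rewrite vN; ring.
  by move=> x _; ring.
have : \sum_(0 <= x < N) (v x ^+ 2 - v x.+1 ^+ 2)
   <= 4 * \sum_(0 <= x < N) (2 * u x ^+ 2 - u x * v x).
  rewrite mulr_sumr; apply: ler_sum_nat => x /andP[_ xN].
  have -> : u x = v x - v x.+1 / 2 by rewrite uv//; ring.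
  have : 0 <= 3 * (v x - v x.+1) ^+ 2 by rewrite mulr_ge0 ?sqr_ge0.
  lra.
rewrite [\sum_(0 <= x < N) (2 * _ - _)]sumrB -mulr_sumr => h1 h2; have := sqr_ge0 (v 0%N); lra.
Qed.

(** In the gradients of one sweep the term coming from edge [x] is carried to
    the next edge with weight one half; a telescoping sum of squares absorbs
    these correlations. *)
Lemma round1_rayleigh g : (0 < n)%N ->
  dot n g g - dot n g (round1 n predT n.-1 g)
  <= \sum_(0 <= x < n.-1) grad g x ^+ 2.
Proof.
move=> n0; rewrite dot_round1E (dot_dirC n predT false g g) [dot n (sweep1 _ g) g]dotC /=.
have := @dot_sweep1 R n g g (dir_edges n predT true n.-1) (dir_edges_lt _ _ (leqnn _)).
rewrite /= sweep_grads_up big_map.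
have -> : up_edges predT n.-1 = index_iota 0 n.-1.
  by rewrite /up_edges filter_predT /index_iota subn0.
set D := dot n g _ => hD /=.
pose v x := if (x < n.-1)%N then front predT g x.+1 (n.-1 - x.+1) - g x else 0.
have hv x : (x < n.-1)%N -> v x = grad g x + v x.+1 / 2.
  move=> xn; rewrite /v xn; case: ltnP => xn1.
    have -> : (n.-1 - x.+1 = (n.-1 - x.+2).+1)%N by lia.
    by rewrite /= /grad; field.
  have -> : (n.-1 - x.+1 = 0)%N by lia.
  by rewrite /= /grad mul0r addr0.
have vN : v n.-1 = 0 by rewrite /v ltnn.
have := sum_geometric_corr hv vN.
have -> : \sum_(0 <= x < n.-1) grad g x * v x
  = \sum_(0 <= x < n.-1) grad g x * (front predT g x.+1 (n.-1 - x.+1) - g x).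
  by apply: eq_big_nat => x /andP[_ xn]; rewrite /v xn.
lra.
Qed.

(** [ph] dominates the gradient, [ps] and [ps'] are supersolutions of the
    recursions of the two sweeps. *)
Lemma round1_contract S (ph ps ps' : nat -> R) (lam C : R) g : 0 <= C ->
  (forall x, S x -> (x < n.-1)%N ->
    (ph x + (if (x.+1 < n.-1)%N && S x.+1 then ps x.+1 else 0)) / 2 <= ps x) ->
  (forall x, S x -> (x < n.-1)%N ->
    (ph x + (if (0 < x)%N && S x.-1 then ps' x.-1 else 0)) / 2 <= ps' x) ->
  (forall x, S x -> (x < n.-1)%N ->
    ((if (0 < x)%N && S x.-1 then (ph x.-1 + ps x) / 2 else 0)
     + (if (x.+1 < n.-1)%N && S x.+1 then (ph x.+1 + ps' x) / 2 else 0)) / 2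
    <= lam * ph x) ->
  (forall x, S x -> (x < n.-1)%N -> `|grad g x| <= C * ph x) ->
  forall x, S x -> (x < n.-1)%N ->
    `|grad (round1 n S n.-1 g) x| <= C * lam * ph x.
Proof.
move=> C0 hps hps' hlam gph x Sx xn.
have up := up_grad C0 gph hps Sx xn.
pose S' e := S (n.-2 - e)%N.
pose rf (f : nat -> R) (e : nat) := f (n.-2 - e)%N.
have gph' y : S' y -> (y < n.-1)%N ->
   `|grad (fun x => g (flip_pos n x)) y| <= C * rf ph y.
  by move=> Sy yn; rewrite grad_flip ?normrN; [apply: gph => //; lia|lia].
have hps2 y : S' y -> (y < n.-1)%N ->
    (rf ph y + (if (y.+1 < n.-1)%N && S' y.+1 then rf ps' y.+1 else 0)) / 2
    <= rf ps' y.
  move=> Sy yn; have yn' : (n.-2 - y < n.-1)%N by lia.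
  have := hps' _ Sy yn'; rewrite /rf /S'.
  have -> : (0 < n.-2 - y)%N = (y.+1 < n.-1)%N by lia.
  by have -> : (n.-2 - y).-1 = (n.-2 - y.+1)%N by lia.
have xn' : (n.-2 - x < n.-1)%N by lia.
have Sx' : S' (n.-2 - x)%N by rewrite /S'; have -> : (n.-2 - (n.-2 - x) = x)%N by lia.
have := up_grad C0 gph' hps2 Sx' xn'.
have E1 : (n.-2 - (n.-2 - x) = x)%N by lia.
have E2 : (0 < n.-2 - x)%N = (x.+1 < n.-1)%N by lia.
rewrite /S' /rf E1 E2.
have -> : (if (x.+1 < n.-1)%N && S (n.-2 - (n.-2 - x).-1)%N then
     (ph (n.-2 - (n.-2 - x).-1)%N + ps' x) / 2 else 0)
   = if (x.+1 < n.-1)%N && S x.+1 then (ph x.+1 + ps' x) / 2 else 0.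
  case: ltnP => //= h; by have -> : (n.-2 - (n.-2 - x).-1 = x.+1)%N by lia.
move=> dn; have := hlam _ Sx xn => /(ler_wpM2l C0).
have gr : `|grad (sweep1 (dir_edges n S false n.-1) g) x| <=
   C * (if (x.+1 < n.-1)%N && S x.+1 then (ph x.+1 + ps' x) / 2 else 0).
  apply: le_trans dn; rewrite /= down_edgesE// /grad.
  rewrite !(@sweep1_flip _ n _ g (fun x => g (flip_pos n x))) ?up_edges_lt//;
    try by [move=> y yn; rewrite flip_posK|lia].
  have -> : flip_pos n x.+1 = (n.-2 - x)%N by rewrite /flip_pos; lia.
  have -> : flip_pos n x = (n.-2 - x).+1 by rewrite /flip_pos; lia.
  by rewrite distrC.
move: up gr; rewrite /grad /round1 [dir_edges n S true _]/=.
set F := if _ then (_ + ps x) / 2 else _; set G := if _ then _ else _.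
set a := sweep1 _ g _; set b := sweep1 _ g _.
set a' := sweep1 _ g _; set b' := sweep1 _ g _ => h1 h2 h3.
have -> : (a + a') / 2 - (b + b') / 2 = ((a - b) + (a' - b')) / 2 by field.
rewrite normrM [`|2^-1|]gtr0_norm//; have := ler_normD (a - b) (a' - b').
lra.
Qed.

End Lipschitz.

(** * Elementary bounds on sine and cosine *)

Section Trig.
Variable R : realType.
Implicit Types x y : R.

Lemma ge_of_derive_ge0 (f df : R -> R) : f 0 = 0 ->
  (forall x, is_derive x 1 f (df x)) -> (forall x, 0 <= x -> 0 <= df x) ->
  forall x, 0 <= x -> 0 <= f x.
Proof.
move=> f0 fdf df0 x x0.
have [c /itvP cx e] : exists2 c, c \in `[0, x]%R & f x - f 0 = df c * (x - 0).
  apply: MVT_segment => //.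
  apply: derivable_within_continuous => y _.
  by apply: ex_derive; exact: (fdf y).
move: e; rewrite f0 !subr0 => ->; rewrite mulr_ge0 ?df0//.
by rewrite cx.
Qed.

Lemma sin_le x : 0 <= x -> sin x <= x.
Proof.
move=> x0; rewrite -subr_ge0.
apply: (@ge_of_derive_ge0 (fun x => x - sin x) (fun x => 1 - cos x)) => //.
by rewrite sin0 subr0.
Qed.

Lemma cos_ge x : 1 - x ^+ 2 / 2 <= cos x.
Proof.
wlog x0 : x / 0 <= x => [H|].
  case: (leP 0 x) => [|x0]; first exact: H.
  by rewrite -cosN -sqrrN; apply: H; rewrite oppr_ge0 ltW.
rewrite -subr_ge0.
apply: (@ge_of_derive_ge0 (fun x => cos x - (1 - x ^+ 2 / 2))
   (fun x => x - sin x)) => //.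
- by rewrite cos0 expr0n /=; lra.
- move=> y; apply: is_derive_eq.
  by rewrite /GRing.scale /=; lra.
- by move=> y y0; rewrite subr_ge0 sin_le.
Qed.

Lemma sin_ge x : 0 <= x -> x - x ^+ 3 / 6 <= sin x.
Proof.
move=> x0; rewrite -subr_ge0.
apply: (@ge_of_derive_ge0 (fun x => sin x - (x - x ^+ 3 / 6))
   (fun x => cos x - (1 - x ^+ 2 / 2))) => //.
- by rewrite sin0 expr0n /=; lra.
- move=> y; apply: is_derive_eq.
  by rewrite /GRing.scale /=; lra.
- by move=> y y0; rewrite subr_ge0 cos_ge.
Qed.

Lemma cos_le x : cos x <= 1 - x ^+ 2 / 2 + x ^+ 4 / 24.
Proof.
wlog x0 : x / 0 <= x => [H|].
  case: (leP 0 x) => [|x0]; first exact: H.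
  have := H (- x); rewrite cosN sqrrN oppr_ge0 => h; apply: le_trans (h (ltW x0)) _.
  by rewrite (exprM _ 2 2) sqrrN -exprM.
rewrite -subr_ge0.
apply: (@ge_of_derive_ge0 (fun x => 1 - x ^+ 2 / 2 + x ^+ 4 / 24 - cos x)
   (fun x => sin x - (x - x ^+ 3 / 6))) => //.
- by rewrite cos0 !expr0n /=; lra.
- move=> y; apply: is_derive_eq.
  by rewrite /GRing.scale /=; lra.
- by move=> y y0; rewrite subr_ge0 sin_ge.
Qed.

Lemma abs_sin_le x : `|sin x| <= `|x|.
Proof.
wlog x0 : x / 0 <= x => [H|].
  case: (leP 0 x) => [|x0]; first exact: H.
  by have := H (- x); rewrite sinN !normrN oppr_ge0 => h; apply: h; rewrite ltW.
rewrite [`|x|]ger0_norm// ler_norml sin_le// andbT.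
have [x1|x1] := leP x pi; last first.
  by have := sin_geN1 x; have := pi_ge2 R; lra.
by have : 0 <= sin x by [apply: sin_ge0_pi; rewrite x0]; lra.
Qed.

Lemma cos_abs_le x y : `|x| <= y -> y <= pi -> cos y <= cos x.
Proof.
move=> xy yp; rewrite -(cos_norm x).
have [->//|xy'] := eqVneq `|x| y.
have x0 := normr_ge0 x.
apply: ltW; rewrite ltr_cos ?lt_neqAle ?xy' ?xy//; rewrite in_itv /=; lra.
Qed.

End Trig.

(** * Cosine waves and the spectral gap *)

Section Contraction.
Variables (R : realType) (n : nat).
Implicit Types (b g h : nat -> R) (S : pred nat) (al be : R).

(** Decay factor per round of a cosine wave of frequency [al]. *)
Definition wave_rate al : R := (cos al + (2 - cos al) / (5 - 4 * cos al)) / 2.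

Lemma wave_rate_ge0 al : 0 <= cos al -> 0 <= wave_rate al.
Proof.
move=> c0; have c1 := cos_le1 al; rewrite /wave_rate divr_ge0// addr_ge0//.
Qed.

Lemma wave_rate_le al : 0 <= al -> al <= 1 ->
  wave_rate al <= 1 - al ^+ 2 * (1 - 4 * al ^+ 2).
Proof.
move=> a0 a1.
have c1 := cos_le1 al; have cl := cos_le al; have cg := cos_ge al.
set c := cos al in c1 cl cg *; set s := al ^+ 2 in cl cg *.
have s0 : 0 <= s by rewrite sqr_ge0.
have s1 : s <= 1 by rewrite expr_le1.
have s4 : al ^+ 4 = s ^+ 2 by rewrite -exprM.
rewrite s4 in cl.
have c5 : 0 < 5 - 4 * c by lra.
suff : (2 - c) / (5 - 4 * c) <= 1 + (1 - c) - 2 * s * (1 - 4 * s).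
  by rewrite /wave_rate -/c -/s; lra.
rewrite ler_pdivrMr//.
(* with e = 1 - c, the inequality is 2 s (1 - 4 s) (1 + 4 e) <= 4 e (1 + e) *)
pose e : R := 1 - c.
have e1 : s / 2 - s ^+ 2 / 24 <= e by rewrite /e; lra.
have e2 : e <= s / 2 by rewrite /e; lra.
have e0 : 0 <= e by rewrite /e; lra.
suff : 2 * s * (1 - 4 * s) * (1 + 4 * e) <= 4 * e * (1 + e).
  by rewrite /e; lra.
have [s14|s14] := leP (1 - 4 * s) 0.
  apply: (@le_trans _ _ 0); last by rewrite !mulr_ge0//; lra.
  have : 0 <= (2 * s * (1 + 4 * e)) * (4 * s - 1) by rewrite !mulr_ge0//; lra.
  lra.
have h1 : 2 * s * (1 - 4 * s) * (1 + 4 * e) <= 2 * s * (1 - 4 * s) * (1 + 2 * s).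
  by rewrite ler_wpM2l ?mulr_ge0//; lra.
have h2 : 2 * s * (1 - 4 * s) * (1 + 2 * s) <= 2 * s * (1 - 2 * s).
  rewrite -mulrA ler_wpM2l//; first lra.
  by have := sqr_ge0 s; lra.
have h3 : 2 * s * (1 - 2 * s) <= 4 * e.
  have : 2 * s - s ^+ 2 / 6 <= 4 * e by lra.
  by have := sqr_ge0 s; lra.
have : 0 <= e * e by rewrite mulr_ge0.
lra.
Qed.

(** The supersolution associated with a cosine wave of frequency [al] is again
    a combination of cosine waves, [(2 cos (al x) - cos (al (x - 1))) / (5 - 4
    cos al)]. The center of the wave may depend on the block of inner edges,
    which the filter [S] separates. *)
Lemma wave_contract S (ctr : nat -> R) al be C g :
  0 <= al -> al <= cos be -> be <= pi -> 0 <= C ->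
  (forall x, S x -> (x < n.-1)%N -> `|al * (x%:R - ctr x)| + al <= be) ->
  (forall x, S x -> S x.+1 -> (x.+1 < n.-1)%N -> ctr x.+1 = ctr x) ->
  (forall x, S x -> (x < n.-1)%N ->
     `|grad g x| <= C * cos (al * (x%:R - ctr x))) ->
  forall x, S x -> (x < n.-1)%N ->
    `|grad (round1 n S n.-1 g) x|
    <= C * wave_rate al * cos (al * (x%:R - ctr x)).
Proof.
move=> a0 ab bpi C0 Sbe Sctr gph.
pose A x := al * (x%:R - ctr x); pose c := cos al.
have c1 : c <= 1 by apply: cos_le1.
have c5 : 0 < 5 - 4 * c by lra.
have AS1 x : S x -> S x.+1 -> (x.+1 < n.-1)%N -> A x.+1 = A x + al.
  by move=> Sx Sx1 x1; rewrite /A Sctr// -natr1; ring.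
have key x : S x -> (x < n.-1)%N ->
    [/\ al <= cos (A x), al <= cos (A x + al) & al <= cos (A x - al)].
  move=> Sx xn; have := Sbe _ Sx xn; rewrite -/(A x) => h.
  split; apply: le_trans ab _; apply: cos_abs_le => //; first by lra.
    by apply: le_trans (ler_normD _ _) _; rewrite (ger0_norm a0).
  by apply: le_trans (ler_normB _ _) _; rewrite (ger0_norm a0).
have twice y : al <= cos y -> 0 <= 2 * cos y - cos (y - al)
    /\ 0 <= 2 * cos y - cos (y + al).
  move=> ay; rewrite cosB cosD -/c.
  have : cos y * c <= cos y by rewrite ler_piMr//; lra.
  have : `|sin y * sin al| <= al.
    rewrite normrM -[leRHS]mul1r ler_pM ?sin_max//.
    by apply: le_trans (abs_sin_le _) _; rewrite ger0_norm.
  by rewrite ler_norml => /andP[]; lra.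
pose ph x := cos (A x).
pose ps x := (2 * cos (A x) - cos (A x - al)) / (5 - 4 * c).
pose ps' x := (2 * cos (A x) - cos (A x + al)) / (5 - 4 * c).
have ps0 x : S x -> (x < n.-1)%N -> 0 <= ps x.
  by move=> Sx xn; have [k _ _] := key _ Sx xn; rewrite divr_ge0 ?(ltW c5)//;
    have [] := twice _ k.
have ps'0 x : S x -> (x < n.-1)%N -> 0 <= ps' x.
  by move=> Sx xn; have [k _ _] := key _ Sx xn; rewrite divr_ge0 ?(ltW c5)//;
    have [] := twice _ k.
have rec y : (cos y + (2 * cos (y + al) - cos y) / (5 - 4 * c)) / 2
     = (2 * cos y - cos (y - al)) / (5 - 4 * c)
  /\ (cos y + (2 * cos (y - al) - cos y) / (5 - 4 * c)) / 2
     = (2 * cos y - cos (y + al)) / (5 - 4 * c).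
  by rewrite cosB cosD -/c; split; field; lra.
apply: (@round1_contract R n S ph ps ps') => // x Sx xn.
- have [k k1 k2] := key _ Sx xn; have [e _] := rec (A x).
  have [d _] := twice _ k1; rewrite addrK in d.
  rewrite {2}/ps -e /ph; case: ifP => [/andP[x1 Sx1]|_].
    by rewrite /ps AS1// addrK.
  have : 0 <= (2 * cos (A x + al) - cos (A x)) / (5 - 4 * c).
    by rewrite divr_ge0// ltW.
  by lra.
- have [k k1 k2] := key _ Sx xn; have [_ e] := rec (A x).
  have [_ d] := twice _ k2; rewrite subrK in d.
  rewrite {2}/ps' -e /ph; case: ifP => [/andP[x1 Sx1]|_].
    have Ax : A x = A x.-1 + al by rewrite -{1}(prednK x1) AS1// ?prednK.
    have Ax' : A x.-1 = A x - al by rewrite Ax addrK.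
    by rewrite /ps' Ax' subrK.
  have : 0 <= (2 * cos (A x - al) - cos (A x)) / (5 - 4 * c).
    by rewrite divr_ge0// ltW.
  by lra.
have [k k1 k2] := key _ Sx xn.
have -> : wave_rate al * ph x = ((cos (A x - al) + ps x) / 2
   + (cos (A x + al) + ps' x) / 2) / 2.
  by rewrite /wave_rate -/c /ph /ps /ps' cosB cosD -/c; field; lra.
have := ps0 _ Sx xn; have := ps'0 _ Sx xn => p' p.
rewrite ler_wpM2r// lerD//.
  case: ifP => [/andP[x1 Sx1]|_]; last by lra.
  have Ax : A x = A x.-1 + al by rewrite -{1}(prednK x1) AS1// ?prednK.
  by rewrite /ph Ax addrK.
case: ifP => [/andP[x1 Sx1]|_]; last by lra.
by rewrite /ph AS1.
Qed.

Lemma wave_contract_iter S (ctr : nat -> R) al be r g :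
  0 < al -> al <= cos be -> be <= pi -> 0 <= cos al ->
  (forall x, S x -> (x < n.-1)%N -> `|al * (x%:R - ctr x)| + al <= be) ->
  (forall x, S x -> S x.+1 -> (x.+1 < n.-1)%N -> ctr x.+1 = ctr x) ->
  (forall x, S x -> (x < n.-1)%N -> `|grad g x| <= 1) ->
  forall x, S x -> (x < n.-1)%N ->
    `|grad (iter r (round1 n S n.-1) g) x| <= wave_rate al ^+ r / cos be.
Proof.
move=> a0 ab bpi ca Sbe Sctr g1.
have cb : 0 < cos be by exact: lt_le_trans ab.
have w0 := wave_rate_ge0 ca.
have cphi x : S x -> (x < n.-1)%N -> cos be <= cos (al * (x%:R - ctr x)).
  by move=> Sx xn; apply: cos_abs_le => //; have := Sbe _ Sx xn; lra.
suff H x : S x -> (x < n.-1)%N -> `|grad (iter r (round1 n S n.-1) g) x|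
    <= wave_rate al ^+ r / cos be * cos (al * (x%:R - ctr x)).
  move=> x Sx xn; apply: le_trans (H _ Sx xn) _.
  by rewrite ler_piMr ?cos_le1// divr_ge0 ?exprn_ge0// ltW.
elim: r x => [|r IHr] x Sx xn.
  apply: le_trans (g1 _ Sx xn) _.
  by rewrite expr0 mul1r mulrC ler_pdivlMr// mul1r cphi.
rewrite iterS exprSr [_ * _ / _]mulrAC.
apply: (wave_contract (ltW a0) ab bpi _ Sbe Sctr IHr Sx xn).
by rewrite divr_ge0 ?exprn_ge0// ltW.
Qed.

Lemma grad_bound_dist (S : pred nat) g (c : R) (x y : nat) : (x <= y)%N ->
  (forall z, (x <= z < y)%N -> `|grad g z| <= c) ->
  `|g y - g x| <= (y - x)%:R * c.
Proof.
move=> xy; have [k ->] : exists k, y = (x + k)%N by exists (y - x)%N; lia.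
rewrite addKn; elim: k {y xy} => [|k IHk] gc.
  by rewrite addn0 subrr normr0 mul0r.
have -> : g (x + k.+1)%N - g x = grad g (x + k) + (g (x + k)%N - g x).
  by rewrite /grad addnS; ring.
apply: le_trans (ler_normD _ _) _; rewrite -natr1 mulrDl mul1r addrC lerD//.
  by apply: IHk => z /andP[z1 z2]; apply: gc; lia.
by apply: gc; lia.
Qed.

Lemma iter_round1_mean r g :
  dot n (fun=> 1) (iter r (round1 n predT n.-1) g) = dot n (fun=> 1) g.
Proof. by rewrite dot_iter_roundC iter_round1_const. Qed.

(** A mean-zero function takes both signs, so its values are bounded by its
    variation. *)
Lemma mean0_bound g (c : R) : 0 <= c -> dot n (fun=> 1) g = 0 ->
  (forall x, (x < n.-1)%N -> `|grad g x| <= c) ->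
  dot n g g <= n%:R * (n%:R * c) ^+ 2.
Proof.
move=> c0 g0 gc.
have gb (i j : 'I_n) : `|g i - g j| <= n%:R * c.
  wlog ij : i j / (j <= i)%N => [H|].
    by case: (leqP j i) => [|/ltnW]; [exact: H|rewrite distrC; exact: H].
  apply: le_trans (grad_bound_dist predT ij _) _ => [z /andP[_ zi]|].
    by apply: gc; have := ltn_ord i; lia.
  by rewrite ler_wpM2r// ler_nat; have := ltn_ord i; lia.
have [n0|n0] := posnP n.
  by rewrite /dot; apply: le_trans (_ : 0 <= _);
   [rewrite big1// => i _; have := ltn_ord i; lia|rewrite mulr_ge0 ?sqr_ge0].
have np : 0 < n%:R :> R by rewrite ltr0n.
have gi (i : 'I_n) : `|g i| <= n%:R * c.
  have e : n%:R * g i = \sum_(j < n) (g i - g j).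
    rewrite sumrB sumr_const card_ord mulr_natl.
    have : dot n (fun=> 1) g = \sum_(j < n) g j.
      by apply: eq_bigr => j _; rewrite mul1r.
    by rewrite g0 => <-; rewrite subr0.
  rewrite -(ler_pM2l np) -[X in X * `|_|]normr_nat -normrM e.
  apply: le_trans (ler_norm_sum _ _ _) _.
  apply: le_trans (ler_sum _ (fun j _ => gb i j)) _.
  by rewrite sumr_const card_ord -[_ *+ n]mulr_natl.
apply: le_trans (_ : \sum_(i < n) (n%:R * c) ^+ 2 <= _).
  apply: ler_sum => i _; rewrite -expr2 -[g i ^+ 2]real_normK ?num_real//.
  by rewrite lerXn2r ?nnegrE ?mulr_ge0.
by rewrite sumr_const card_ord -[_ *+ n]mulr_natl.
Qed.

(** The pointwise contraction bounds the spectrum of the round on mean-zero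
    functions, because its moments are log-convex; the resulting bound holds
    without the multiplicative constant. *)
Lemma spectral_gap al r b g : (1 < n)%N -> 0 < al ->
  al <= cos (al * n%:R / 2) -> al * n%:R / 2 <= pi -> 0 <= cos al ->
  dot n (fun=> 1) g = 0 ->
  dot n b (iter r (round1 n predT n.-1) g) ^+ 2
  <= dot n b b * (wave_rate al ^+ (2 * r) * dot n g g).
Proof.
move=> n1 a0 ab bpi ca g0.
set M := round1 n predT n.-1; set lam := wave_rate al.
have lam0 : 0 <= lam by exact: wave_rate_ge0.
have gap h : dot n (fun=> 1) h = 0 -> dot n (M h) (M h) <= lam ^+ 2 * dot n h h.
  move=> h0.
  pose H : R := \sum_(x < n) `|grad h x|.
  have hH x : (x < n.-1)%N -> `|grad h x| <= H.
    move=> xn; have xn' : (x < n)%N by lia.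
    rewrite /H (bigD1 (Ordinal xn')) //= lerDl.
    by apply: sumr_ge0 => i _; apply: normr_ge0.
  have H0 : 0 <= H by apply: sumr_ge0 => i _; apply: normr_ge0.
  set be := al * n%:R / 2 in ab bpi.
  have cb : 0 < cos be by exact: lt_le_trans ab.
  pose ctr (_ : nat) : R := (n%:R - 2) / 2.
  have Sbe x : predT x -> (x < n.-1)%N -> `|al * (x%:R - ctr x)| + al <= be.
    move=> _ xn; rewrite normrM (gtr0_norm a0).
    have -> : be = al * ((n%:R - 2) / 2) + al by rewrite /be; field.
    rewrite lerD2r ler_wpM2l ?(ltW a0)// ler_norml /ctr.
    have : x%:R <= n%:R - 2 :> R by rewrite -natrB// ler_nat; lia.
    by have := ler0n R x; lra.
  have sup k x : (x < n.-1)%N ->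
      `|grad (iter k M h) x| <= H * (lam ^+ k / cos be).
    move=> xn.
    have [H00|H00] := eqVneq H 0.
      rewrite H00 mul0r.
      have hc : forall y, (y < n)%N -> h y = h 0%N.
        move=> y yn; apply/eqP; rewrite -subr_eq0 -normr_le0.
        apply: le_trans (grad_bound_dist (c := 0) predT (leq0n y) _) _.
          by move=> z /andP[_ zy]; rewrite -H00; apply: hH; lia.
        by rewrite mulr0.
      have hk : forall y, (y < n)%N -> h y = 0.
        move: h0; rewrite /dot; under eq_bigr do rewrite mul1r hc//.
        rewrite sumr_const card_ord -mulr_natl => /eqP; rewrite mulf_eq0.
        rewrite pnatr_eq0 => /orP[|/eqP h00 y yn]; first by lia.
        by rewrite hc.
      have z : dot n (iter k M h) (iter k M h) = 0.
        rewrite -dot_iter_roundC; apply: big1 => i _.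
        by rewrite hk ?mul0r.
      have zz y : (y < n)%N -> iter k M h y = 0.
        move=> yn; move: z; rewrite /dot => /eqP.
        rewrite psumr_eq0 => [/allP/(_ (Ordinal yn))|i _]; last first.
          by rewrite -expr2 sqr_ge0.
        rewrite mem_index_enum => /(_ isT) /=.
        by rewrite -expr2 sqrf_eq0 => /eqP.
      by rewrite /grad !zz ?subrr ?normr0//; lia.
    have Hp : 0 < H by rewrite lt_neqAle eq_sym H00.
    have e : iter k M (fun y => H^-1 * h y + 0) =
        fun y => H^-1 * iter k M h y + 0.
      by rewrite /M iter_round1_lin iter_round1_const.
    have := @wave_contract_iter predT ctr al be k (fun y => H^-1 * h y + 0)
      a0 ab bpi ca Sbe (fun _ _ _ _ => erefl) _ x isT xn.
    rewrite -/M e /grad !addr0 -mulrBr normrM gtr0_norm ?invr_gt0//.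
    rewrite mulrC ler_pdivrMr// [_ * H]mulrC; apply => y _ yn.
    rewrite !addr0 -mulrBr normrM gtr0_norm ?invr_gt0//.
    by rewrite mulrC ler_pdivrMr// mul1r hH.
  pose a k := dot n (iter k M h) (iter k M h).
  have ac k : a k.+1 ^+ 2 <= a k * a k.+2.
    have -> : a k.+1 = dot n (iter k M h) (iter k.+2 M h).
      by rewrite /a !iterS -/M (dot_roundC n predT (iter k M h)).
    exact: dot_cauchy.
  have := @logconvex_decay R a (fun k => dot_ge0 _ _) ac (lam ^+ 2)
    (n%:R * (n%:R * (H / cos be)) ^+ 2) (sqr_ge0 _).
  apply => k.
  have := @mean0_bound (iter k M h) (H * (lam ^+ k / cos be)).
  rewrite iter_round1_mean h0 => /(_ _ erefl (@sup k)) h1.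
  apply: le_trans (h1 _) _; first by rewrite mulr_ge0// divr_ge0 ?exprn_ge0// ltW.
  rewrite -exprM mulnC exprM le_eqVlt; apply/orP; left; apply/eqP.
  by rewrite !exprMn; ring.
have ak k : dot n (iter k M g) (iter k M g) <= lam ^+ (2 * k) * dot n g g.
  elim: k => [|k IHk]; first by rewrite muln0 mul1r.
  rewrite iterS; apply: le_trans (gap _ _) _; first by rewrite iter_round1_mean.
  by rewrite mulnS exprD -mulrA ler_wpM2l ?sqr_ge0.
apply: le_trans (dot_cauchy _ _ _) _.
by rewrite ler_wpM2l ?dot_ge0.
Qed.

End Contraction.

(** * Additive statistics *)

Section Positive.
Variables (R : realType) (n : nat).
Implicit Types (f g : 'S_n -> R) (S : pred nat).

Lemma sweep_le es f g : (forall x, f x <= g x) ->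
  forall x, sweep es f x <= sweep es g x.
Proof.
move=> fg; elim: es => //= e es IH x.
by rewrite /lazy_flip ler_wpM2r// lerD.
Qed.

Lemma sweep_lin es c f g x :
  sweep es (fun y => c * f y + g y) x = c * sweep es f x + sweep es g x.
Proof. by elim: es x => //= e es IH x; rewrite /lazy_flip !IH; ring. Qed.

Lemma sweep_const es (c : R) (x : 'S_n) : sweep es (fun=> c) x = c.
Proof. by elim: es x => //= e es IH x; rewrite /lazy_flip !IH; field. Qed.

Lemma round_le S s f g : (forall x, f x <= g x) ->
  forall x, round S s f x <= round S s g x.
Proof. by move=> fg x; rewrite /round ler_wpM2r// lerD// sweep_le. Qed.

Lemma round_lin S s c f g x :
  round S s (fun y => c * f y + g y) x = c * round S s f x + round S s g x.
Proof. by rewrite /round !sweep_lin; ring. Qed.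

Lemma round_const S s (c : R) (x : 'S_n) : round S s (fun=> c) x = c.
Proof. by rewrite /round !sweep_const; field. Qed.

Lemma iter_round_le r S s f g : (forall x, f x <= g x) ->
  forall x, iter r (round S s) f x <= iter r (round S s) g x.
Proof. by move=> fg; elim: r => //= r IH x; apply: round_le. Qed.

Lemma iter_round_lin r S s c f g :
  iter r (round S s) (fun y => c * f y + g y)
  = fun x => c * iter r (round S s) f x + iter r (round S s) g x.
Proof. by elim: r => //= r ->; apply/funext => x; apply: round_lin. Qed.

Lemma iter_round_const r S s (c : R) :
  iter r (round S s) (fun _ : 'S_n => c) = fun=> c.
Proof. by elim: r => //= r ->; apply/funext => x; apply: round_const. Qed.

Lemma iter_round_ge0 r S s f : (forall x, 0 <= f x) ->
  forall x, 0 <= iter r (round S s) f x.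
Proof.
move=> f0 x; have := @iter_round_le r S s (fun=> 0) f f0 x.
by rewrite iter_round_const.
Qed.

End Positive.


Section Additive.
Variables (R : realType) (n : nat).
Implicit Types (g a : nat -> R) (x : 'S_n).

Definition addstat g a : 'S_n -> R := fun x => \sum_(p < n) g p * a (x p).

Lemma adj_tpermE e (en : (e.+1 < n)%N) :
  adj_tperm n e = tperm (Ordinal (ltnW en)) (Ordinal en).
Proof.
rewrite /adj_tperm.
case: insubP => [u _ ue|]; last by rewrite ltnW.
case: insubP => [v _ ve|]; last by rewrite en.
by congr tperm; apply: val_inj.
Qed.

Lemma adj_tpermK e : (adj_tperm n e * adj_tperm n e)%g = 1%g.
Proof.
rewrite /adj_tperm; case: insub => [u|]; last by rewrite mulg1.
by case: insub => [v|]; rewrite ?tperm2 ?mulg1.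
Qed.

Lemma lazy_addstat e g a : (e.+1 < n)%N ->
  lazy_flip (adj_tperm n e) (addstat g a) = addstat (avg1 e g) a.
Proof.
move=> en; rewrite (adj_tpermE en); apply/funext => x.
set t := tperm _ _; rewrite /lazy_flip.
have -> : addstat g a (t * x)%g = \sum_(p < n) g (t p) * a (x p).
  rewrite /addstat (reindex_inj (@perm_inj _ t)); apply: eq_bigr => p _ /=.
  by rewrite permM tpermK.
rewrite /addstat -big_split mulr_suml; apply: eq_bigr => p _ /=.
rewrite -mulrDl mulrAC; congr (_ * _).
rewrite /avg1 /t; case: tpermP => [->|->|pe pe1] /=.
- by rewrite eqxx.
- by rewrite eqxx orbT addrC.
have -> : (p == e :> nat) = false by apply/eqP => h; apply: pe; apply: val_inj.
have -> : (p == e.+1 :> nat) = false by apply/eqP => h; apply: pe1; apply: val_inj.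
by rewrite /=; field.
Qed.

Lemma sweep_addstat es g a : all (fun e => e.+1 < n)%N es ->
  sweep es (addstat g a) = addstat (sweep1 es g) a.
Proof. by elim: es => //= e es IH /andP[en /IH ->]; apply: lazy_addstat. Qed.

Lemma round_addstat S s g a : (s <= n.-1)%N ->
  round S s (addstat g a) = addstat (round1 n S s g) a.
Proof.
move=> sn; apply/funext => x; rewrite /round.
have := sweep_addstat g a (dir_edges_lt S true sn); rewrite /= => ->.
have := sweep_addstat g a (dir_edges_lt S false sn); rewrite /= => ->.
rewrite /addstat -big_split mulr_suml; apply: eq_bigr => p _ /=.
by rewrite /round1 /=; ring.
Qed.

Lemma iter_round_addstat r S g a :
  iter r (round S n.-1) (addstat g a) = addstat (iter r (round1 n S n.-1) g) a.
Proof. by elim: r => //= r ->; apply: round_addstat. Qed.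

Lemma addstat1 g a : addstat g a 1%g = dot n a g.
Proof. by apply: eq_bigr => p _; rewrite perm1 mulrC. Qed.

Lemma addstat_tperm g a (p q : 'I_n) x :
  addstat g a x - addstat g a (tperm p q * x)%g
  = (g p - g q) * (a (x p) - a (x q)).
Proof.
have [->|pq] := eqVneq p q.
  by rewrite tperm1 mul1g !subrr mul0r.
rewrite /addstat -sumrB (bigD1 p) //= (bigD1 q) 1?eq_sym //= big1.
  by rewrite !permM tpermL tpermR; ring.
by move=> i /andP[ip iq]; rewrite permM tpermD 1?eq_sym// subrr.
Qed.

(** Centred additive statistics are eigenfunctions of the random transposition
    walk, so their correlation with any [w] is a Dirichlet form. *)
Lemma addstat_dirichlet (w : 'S_n -> R) g a : dot n (fun=> 1) g = 0 ->
  4 * n%:R * \sum_x w x * addstat g a x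
  = \sum_(p < n) \sum_(q < n) \sum_x
      (w x - w (tperm p q * x)%g) * ((g p - g q) * (a (x p) - a (x q))).
Proof.
move=> g0.
have sg : \sum_(p < n) g p = 0.
  by rewrite -[RHS]g0; apply: eq_bigr => i _; rewrite mul1r.
have eig x : \sum_(p < n) \sum_(q < n)
    (addstat g a x - addstat g a (tperm p q * x)%g) = 2 * n%:R * addstat g a x.
  under eq_bigr do under eq_bigr do rewrite addstat_tperm.
  transitivity (\sum_(p < n) \sum_(q < n) (g p * a (x p) + g q * a (x q)
     - (g p * a (x q) + a (x p) * g q))).
    by apply: eq_bigr => p _; apply: eq_bigr => q _; ring.
  have G : \sum_(p < n) g p * a (x p) = addstat g a x by [].
  under eq_bigr do rewrite sumrB !big_split /= sumr_const card_ord G.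
  under eq_bigr do rewrite -!mulr_sumr sg mulr0 addr0.
  rewrite sumrB big_split /= sumr_const card_ord -mulr_suml sg mul0r subr0.
  by rewrite sumrMnl G -[_ *+ n]mulr_natl; ring.
have dir (p q : 'I_n) : \sum_x (w x - w (tperm p q * x)%g)
      * ((g p - g q) * (a (x p) - a (x q)))
    = 2 * \sum_x w x * (addstat g a x - addstat g a (tperm p q * x)%g).
  under eq_bigr do rewrite -addstat_tperm mulrBl.
  rewrite sumrB (reindex_inj (mulgI (tperm p q))) /=.
  rewrite [X in _ - X](reindex_inj (mulgI (tperm p q))) /=.
  under eq_bigr do rewrite mulgA tperm2 mul1g.
  under [X in _ - X]eq_bigr do rewrite mulgA tperm2 mul1g.
  rewrite (reindex_inj (mulgI (tperm p q))) /=.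
  under eq_bigr do rewrite mulgA tperm2 mul1g.
  rewrite mulr_sumr -sumrB; apply: eq_bigr => x _; ring.
under [RHS]eq_bigr do under eq_bigr do rewrite dir.
transitivity (2 * \sum_x w x * (2 * n%:R * addstat g a x)).
  by rewrite !mulr_sumr; apply: eq_bigr => x _; ring.
transitivity (2 * \sum_x \sum_(p < n) w x * \sum_(q < n)
    (addstat g a x - addstat g a (tperm p q * x)%g)).
  by congr (_ * _); apply: eq_bigr => x _; rewrite -eig mulr_sumr.
rewrite exchange_big mulr_sumr /=; apply: eq_bigr => p _.
under eq_bigr do rewrite mulr_sumr.
by rewrite exchange_big mulr_sumr.
Qed.

Lemma addstat_second_moment g a : (0 < n)%N -> dot n (fun=> 1) g = 0 ->
  (forall i, `|g i| <= 1) -> (forall i, `|a i| <= 1) ->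
  \sum_x addstat g a x ^+ 2 <= #|'S_n|%:R * (4 * n%:R).
Proof.
move=> n0 g0 g1 a1; have np : 0 < n%:R :> R by rewrite ltr0n.
have := addstat_dirichlet (addstat g a) a g0.
have bnd (p q : 'I_n) : \sum_x (addstat g a x - addstat g a (tperm p q * x)%g)
     * ((g p - g q) * (a (x p) - a (x q))) <= #|'S_n|%:R * 16.
  apply: le_trans (_ : \sum_(x : 'S_n) (16 : R) <= _).
    apply: ler_sum => x _; rewrite addstat_tperm -expr2.
    have h1 : `|g p - g q| <= 2 by have := ler_normB (g p) (g q);
      have := g1 p; have := g1 q; lra.
    have h2 : `|a (x p) - a (x q)| <= 2 by have := ler_normB (a (x p)) (a (x q));
      have := a1 (x p); have := a1 (x q); lra.
    rewrite -[X in X <= _]real_normK ?num_real// normrM.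
    have -> : 16 = (2 * 2) ^+ 2 :> R by ring.
    by rewrite lerXn2r ?nnegrE ?mulr_ge0// ler_pM.
  by rewrite sumr_const -[leLHS]mulr_natl.
have -> : \sum_x addstat g a x * addstat g a x = \sum_x addstat g a x ^+ 2.
  by apply: eq_bigr => x _; rewrite expr2.
move=> e; have : 4 * n%:R * \sum_x addstat g a x ^+ 2
    <= 4 * n%:R * (#|'S_n|%:R * (4 * n%:R)).
  rewrite e; apply: le_trans (_ : \sum_(p < n) \sum_(q < n) (#|'S_n|%:R * 16) <= _).
    by apply: ler_sum => p _; apply: ler_sum => q _; apply: bnd.
  rewrite !sumr_const card_ord -[(_ *+ n) *+ n]mulr_natl -[_ *+ n]mulr_natl.
  by rewrite le_eqVlt; apply/orP; left; apply/eqP; ring.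
by rewrite ler_pM2l ?mulr_gt0.
Qed.

(** Each flip adds to the conditional variance the square of half a product of
    two gradients. *)
Lemma sweep_sqr es g a x : all (fun e => e.+1 < n)%N es ->
  (forall i, `|a i| <= 1) ->
  sweep es (fun y => addstat g a y ^+ 2) x
  <= addstat (sweep1 es g) a x ^+ 2 + \sum_(p <- sweep_grads es g) p.2 ^+ 2.
Proof.
move=> + a1; elim: es x => [|e es IH] x /=; first by rewrite big_nil addr0.
move=> /andP[en esn]; rewrite big_cons /=.
rewrite -(lazy_addstat _ _ en) /lazy_flip (adj_tpermE en).
set t := tperm _ _; have := IH x esn; have := IH (t * x)%g esn.
set V := \sum_(p <- _) _; set F := addstat (sweep1 es g) a.
set gr := grad (sweep1 es g) e => h1 h2.
have d : (F x - F (t * x)%g) ^+ 2 <= 4 * gr ^+ 2.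
  rewrite /F /t addstat_tperm exprMn /= mulrC.
  apply: ler_pM; rewrite ?sqr_ge0//; last first.
    by rewrite /gr /grad /= -opprB sqrrN.
  have -> : 4 = 2 ^+ 2 :> R by ring.
  rewrite -[leLHS]real_normK ?num_real// lerXn2r ?nnegrE//.
  set i := x _; set j := x _.
  by have := ler_normB (a i) (a j); have := a1 i; have := a1 j; lra.
lra.
Qed.

(** Second moment of [dot b (Q g)] for a product [Q] of [r] one-card sweeps in
    independent random directions. *)
Fixpoint dir_sqr r (b g : nat -> R) : R :=
  if r is r'.+1 then
    (dir_sqr r' b (sweep1 (dir_edges n predT true n.-1) g)
     + dir_sqr r' b (sweep1 (dir_edges n predT false n.-1) g)) / 2
  else dot n b g ^+ 2.

Lemma iter_round_sqr r g a l : 0 <= l -> lip n l g -> (forall i, `|a i| <= 1) ->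
  iter r (round predT n.-1) (fun y => addstat g a y ^+ 2) 1%g
  <= dir_sqr r a g + r%:R * (n%:R * (4 * l ^+ 2)).
Proof.
move=> l0 + a1; elim: r g => [|r IHr] g gl.
  by rewrite /= addstat1 mul0r addr0.
rewrite iterSr.
pose G d := sweep1 (dir_edges n predT d n.-1) g.
pose V : R := n%:R * (4 * l ^+ 2).
apply: le_trans (_ : iter r (round predT n.-1) (fun y =>
   2^-1 * addstat (G true) a y ^+ 2 + (2^-1 * addstat (G false) a y ^+ 2 + V))
   1%g <= _).
  apply: iter_round_le => y; rewrite /round.
  have h d : sweep (dir_edges n predT d n.-1) (fun y => addstat g a y ^+ 2) y
     <= addstat (G d) a y ^+ 2 + V.
    apply: le_trans (sweep_sqr _ _ _ a1) _; first exact: dir_edges_lt.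
    by rewrite lerD2l; apply: sum_grads_sqr.
  have := h true; have := h false; rewrite /=; lra.
rewrite !iter_round_lin iter_round_const.
have Gl d : lip n l (G d) by exact: lip_dir.
have hA d := IHr _ (Gl d).
rewrite -[r.+1%:R]natr1 [dir_sqr _ _ _]/= -/(G true) -/(G false) -/V.
have := hA true; have := hA false; rewrite -/V.
set A := iter _ _ _ _; set B := iter _ _ _ _; lra.
Qed.

Lemma sqr_avg_le (u v c d : R) : `|u - c| <= d -> `|v - c| <= d ->
  (u ^+ 2 + v ^+ 2) / 2 <= ((u + v) / 2) ^+ 2 + d ^+ 2.
Proof.
move=> uc vc.
have : (u - v) ^+ 2 <= (2 * d) ^+ 2.
  rewrite -[leLHS]real_normK ?num_real//; have d0 := le_trans (normr_ge0 _) uc.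
  rewrite lerXn2r ?nnegrE ?mulr_ge0//.
  by move: uc vc; rewrite !ler_norml => /andP[? ?] /andP[? ?]; apply/andP; lra.
lra.
Qed.

(** All the rounds can be moved to the other side of the pairing, where they
    preserve the Lipschitz constant. *)
Lemma dot_iter_defect d s r b g k l : (s <= n.-1)%N -> 0 <= k -> 0 <= l ->
  lip n k b -> lip n l g ->
  `|dot n b (iter r (round1 n predT n.-1) (sweep1 (dir_edges n predT d s) g))
    - dot n b (iter r (round1 n predT n.-1) g)| <= n%:R * (k * l).
Proof.
move=> sn k0 l0 bk gl; rewrite !dot_iter_roundC distrC.
by apply: dot_defect => //; apply: lip_iter_round.
Qed.

Lemma dot_iter_round_partial s r b g :
  dot n b (iter r (round1 n predT n.-1) (round1 n predT s g))
  = (dot n b (iter r (round1 n predT n.-1) (sweep1 (dir_edges n predT true s) g))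
   + dot n b (iter r (round1 n predT n.-1) (sweep1 (dir_edges n predT false s) g)))
   / 2.
Proof. by rewrite !dot_iter_roundC dot_round1E. Qed.

(** The two directions of a round change the mean by amounts bounded by the
    summation by parts, so each round adds little variance. *)
Lemma dir_sqr_le r b g k l : 0 <= k -> 0 <= l -> lip n k b -> lip n l g ->
  dir_sqr r b g <= dot n b (iter r (round1 n predT n.-1) g) ^+ 2
                   + r%:R * (n%:R * (k * l)) ^+ 2.
Proof.
move=> k0 l0 bk; elim: r g => [|r IHr] g gl; first by rewrite /= mul0r addr0.
rewrite [dir_sqr _ _ _]/= iterSr dot_iter_round_partial -[r.+1%:R]natr1.
have Gl d : lip n l (sweep1 (dir_edges n predT d n.-1) g) by exact: lip_dir.
have := sqr_avg_le (dot_iter_defect true r (leqnn _) k0 l0 bk gl)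
  (dot_iter_defect false r (leqnn _) k0 l0 bk gl).
have := IHr _ (Gl true); have := IHr _ (Gl false); rewrite /=; lra.
Qed.

(** The fluctuations of an additive statistic with Lipschitz weights come from
    the transpositions, bounded by the gradients they meet, and from the
    directions, bounded by a summation by parts. *)
Lemma addstat_variance r s g a k l : (s <= n.-1)%N -> 0 <= k -> 0 <= l ->
  lip n k a -> lip n l g -> (forall i, `|a i| <= 1) ->
  iter r (round predT n.-1) (round predT s (fun y => addstat g a y ^+ 2)) 1%g
  <= dot n a (iter r (round1 n predT n.-1) (round1 n predT s g)) ^+ 2
     + r.+1%:R * (16 * n%:R * l ^+ 2 + 4 * (n%:R * (k * l)) ^+ 2).
Proof.
move=> sn k0 l0 ak gl a1.
pose G d := sweep1 (dir_edges n predT d s) g.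
pose V : R := n%:R * (4 * l ^+ 2).
apply: le_trans (_ : iter r (round predT n.-1) (fun y =>
   2^-1 * addstat (G true) a y ^+ 2 + (2^-1 * addstat (G false) a y ^+ 2 + V))
   1%g <= _).
  apply: iter_round_le => y; rewrite /round.
  have h d : sweep (dir_edges n predT d s) (fun y => addstat g a y ^+ 2) y
     <= addstat (G d) a y ^+ 2 + V.
    apply: le_trans (sweep_sqr _ _ _ a1) _; first exact: dir_edges_lt.
    by rewrite lerD2l; apply: sum_grads_sqr.
  have := h true; have := h false; rewrite /=; lra.
rewrite !iter_round_lin iter_round_const dot_iter_round_partial.
have Gl d : lip n (2 * l) (G d) by exact: lip_dir_partial.
have l2 : 0 <= 2 * l by rewrite mulr_ge0.
have := sqr_avg_le (dot_iter_defect true r sn k0 l0 ak gl)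
  (dot_iter_defect false r sn k0 l0 ak gl).
have := iter_round_sqr r l2 (Gl true) a1; have := iter_round_sqr r l2 (Gl false) a1.
have := dir_sqr_le r k0 l2 ak (Gl true); have := dir_sqr_le r k0 l2 ak (Gl false).
rewrite -/(G true) -/(G false) -[r.+1%:R]natr1.
have -> : n%:R * (k * (2 * l)) = 2 * (n%:R * (k * l)) by ring.
set W : R := n%:R * (k * l).
have VE : n%:R * (4 * (2 * l) ^+ 2) = 4 * V by rewrite /V; ring.
rewrite VE; have -> : 16 * n%:R * l ^+ 2 = 4 * V by rewrite /V; ring.
have V0 : 0 <= V by rewrite /V mulr_ge0 ?mulr_ge0 ?sqr_ge0.
have W0 : 0 <= W ^+ 2 by exact: sqr_ge0.
have -> : (2 * W) ^+ 2 = 4 * W ^+ 2 by ring.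
set W2 := W ^+ 2 in W0 *.
have : 0 <= r%:R * W2 by rewrite mulr_ge0.
lra.
Qed.

End Additive.

(** * The lower bound *)

Section LowerBound.
Variables (R : realType) (n : nat).
Hypothesis n1 : (1 < n)%N.

Let th : R := pi / n%:R.
Let f (x : nat) : R := cos (th * (x%:R + 2^-1)).

Let np : 0 < n%:R :> R. Proof. by rewrite ltr0n ltnW. Qed.
Let thn : th * n%:R = pi. Proof. by rewrite /th divfK// gt_eqF. Qed.
Let th0 : 0 < th. Proof. by rewrite divr_gt0 ?pi_gt0. Qed.
Let sinth : 0 < sin th.
Proof.
apply: sin_gt0_pi; rewrite th0 /= -thn ltr_pMr// ltr1n//.
Qed.

Let sum_cos2 : \sum_(0 <= x < n) cos (2 * th * (x%:R + 2^-1)) = 0 :> R.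
Proof.
apply: (mulfI (lt0r_neq0 sinth)); rewrite mulr0 mulr_sumr.
rewrite (@telescope_sumr_eq _ 0 n (fun x : nat => sin (2 * th * x%:R) / 2))//.
  rewrite -mulrA thn mulr0 sin0 mul0r subr0.
  by rewrite mulr_natl sin2pi mul0r.
move=> x _; rewrite -[x.+1%:R]natr1.
have -> : 2 * th * (x%:R + 1) = 2 * th * (x%:R + 2^-1) + th by field.
have -> : 2 * th * x%:R = 2 * th * (x%:R + 2^-1) - th by field.
by rewrite sinD sinB; field.
Qed.

Let sum_cos2' : \sum_(0 <= x < n.-1) cos (2 * th * x.+1%:R) = - 1 :> R.
Proof.
apply: (mulfI (lt0r_neq0 sinth)); rewrite mulr_sumr.
rewrite (@telescope_sumr_eq _ 0 n.-1
  (fun x : nat => sin (2 * th * (x%:R + 2^-1)) / 2))//.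
  have -> : 2 * th * (n.-1%:R + 2^-1) = - th + pi *+ 2.
    rewrite -thn -[in RHS](prednK (ltnW n1)) -[(n.-1.+1)%:R]natr1.
    by rewrite -mulr_natl; field.
  have -> : 2 * th * (0%:R + 2^-1) = th by field.
  by rewrite sinD2pi sinN; field.
move=> x _; rewrite -![x.+1%:R]natr1.
have -> : 2 * th * (x%:R + 1 + 2^-1) = 2 * th * (x%:R + 1) + th by field.
have -> : 2 * th * (x%:R + 2^-1) = 2 * th * (x%:R + 1) - th by field.
by rewrite sinD sinB; field.
Qed.

Let cos_sqr (x : R) : cos x ^+ 2 = (1 + cos (2 * x)) / 2.
Proof. by rewrite mulr_natl cos_mulr2n -mulr_natl; field. Qed.

Let dotff : dot n f f = n%:R / 2.
Proof.
rewrite /dot -(big_mkord xpredT (fun i => f i * f i)).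
under eq_bigr do rewrite -expr2 /f cos_sqr mulrA.
rewrite -mulr_suml big_split /= sum_cos2 addr0 sumr_const_nat subn0.
by [].
Qed.

Let dot1f : dot n (fun=> 1) f = 0.
Proof.
rewrite /dot -(big_mkord xpredT (fun i => 1 * f i)).
have s2 : sin (th / 2) != 0.
  apply: lt0r_neq0; apply: sin_gt0_pi; rewrite divr_gt0//=.
  have n1' : 1 <= n%:R :> R by rewrite ler1n ltnW.
  by rewrite -thn ltr_pM2l//; lra.
apply: (mulfI s2); rewrite mulr0 mulr_sumr.
rewrite (@telescope_sumr_eq _ 0 n (fun x : nat => sin (th * x%:R) / 2))//.
  by rewrite thn mulr0 sin0 sinpi subrr.
move=> x _; rewrite -[x.+1%:R]natr1 mul1r /f.
have -> : th * (x%:R + 1) = th * (x%:R + 2^-1) + th / 2 by field.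
have -> : th * x%:R = th * (x%:R + 2^-1) - th / 2 by field.
by rewrite sinD sinB; field.
Qed.

Let gradf x : grad f x = - (2 * sin (th / 2)) * sin (th * x.+1%:R).
Proof.
rewrite /grad /f -![x.+1%:R]natr1.
have -> : th * (x%:R + 1 + 2^-1) = th * (x%:R + 1) + th / 2 by field.
have -> : th * (x%:R + 2^-1) = th * (x%:R + 1) - th / 2 by field.
by rewrite cosD cosB; ring.
Qed.

Let sin2_le : (2 * sin (th / 2)) ^+ 2 <= th ^+ 2.
Proof.
have t2 : 0 <= th / 2 by rewrite divr_ge0 ?ltW.
have h : `|sin (th / 2)| <= th / 2.
  by apply: le_trans (abs_sin_le _) _; rewrite ger0_norm.
have -> : (2 * sin (th / 2)) ^+ 2 = 4 * sin (th / 2) ^+ 2 by ring.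
have : sin (th / 2) ^+ 2 <= (th / 2) ^+ 2.
  rewrite -[leLHS]real_normK ?num_real// lerXn2r ?nnegrE//.
lra.
Qed.

Let sum_gradf : \sum_(0 <= x < n.-1) grad f x ^+ 2 <= th ^+ 2 * (n%:R / 2).
Proof.
under eq_bigr do rewrite gradf exprMn sqrrN.
rewrite -mulr_sumr.
have -> : \sum_(0 <= i < n.-1) sin (th * i.+1%:R) ^+ 2 = n%:R / 2 :> R.
  under eq_bigr do rewrite sin2cos2 cos_sqr mulrA.
  rewrite sumrB -mulr_suml big_split /= sum_cos2' !sumr_const_nat !subn0.
  by rewrite -[in RHS](prednK (ltnW n1)) -[(n.-1.+1)%:R]natr1; field.
by rewrite ler_wpM2r ?divr_ge0.
Qed.

Let lipf : lip n th f.
Proof.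
move=> x _; rewrite gradf normrM normrN.
have h : `|2 * sin (th / 2)| <= th.
  rewrite -ler_sqr ?nnegrE ?normr_ge0//; last exact: ltW.
  by rewrite real_normK ?num_real//; exact: sin2_le.
by rewrite -[leRHS]mulr1 ler_pM// sin_max.
Qed.

Let f1 i : `|f i| <= 1. Proof. exact: cos_max. Qed.

Let M := round1 (R := R) n predT n.-1.

Lemma dot_round_defect s b g k l : (s <= n.-1)%N -> 0 <= k -> 0 <= l ->
  lip n k b -> lip n l g ->
  `|dot n b g - dot n b (round1 n predT s g)| <= n%:R * (k * l :> R).
Proof.
move=> sn k0 l0 bk gl; rewrite dot_round1E.
have h d := dot_defect predT d sn k0 l0 bk gl.
set A := dot n b (sweep1 _ _); set B := dot n b (sweep1 _ _).
have -> : dot n b g - (A + B) / 2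
  = ((dot n b g - A) + (dot n b g - B)) / 2 by field.
rewrite normrM [`|2^-1|]gtr0_norm// ler_pdivrMr//.
apply: le_trans (ler_normD _ _) _.
have := h true; have := h false; rewrite -/A -/B; lra.
Qed.

(** The cosine of the lowest frequency is nearly an eigenfunction: its
    Rayleigh quotient is at least [1 - th ^ 2], and log-convexity turns this
    single estimate into a lower bound for all iterates. *)
Lemma mean_lower r s : (s <= n.-1)%N -> th ^+ 2 <= 1 ->
  n%:R / 2 * (1 - th ^+ 2) ^+ r - 2 * (n%:R * th ^+ 2)
  <= dot n f (iter r M (round1 n predT s f)).
Proof.
move=> sn th1.
pose a k := dot n (iter k M f) (iter k M f).
have ac k : a k.+1 ^+ 2 <= a k * a k.+2.
  have -> : a k.+1 = dot n (iter k M f) (iter k.+2 M f).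
    by rewrite /a !iterS (dot_roundC n predT (iter k M f)).
  exact: dot_cauchy.
have a0 : a 0%N = n%:R / 2 by exact: dotff.
have fMf : (1 - th ^+ 2) * (n%:R / 2) <= dot n f (M f).
  have := round1_rayleigh f (ltnW n1); rewrite dotff -/M => h1.
  by have := le_trans h1 sum_gradf; lra.
have a1 : (1 - th ^+ 2) ^+ 2 * a 0%N <= a 1%N.
  have n2 : 0 < n%:R / 2 :> R by rewrite divr_gt0.
  rewrite -(ler_pM2l n2) -{2}a0; apply: le_trans (dot_cauchy n f (M f)).
  rewrite a0.
  have -> : n%:R / 2 * ((1 - th ^+ 2) ^+ 2 * (n%:R / 2))
    = ((1 - th ^+ 2) * (n%:R / 2)) ^+ 2 by ring.
  have h0 : 0 <= (1 - th ^+ 2) * (n%:R / 2) by rewrite mulr_ge0 ?subr_ge0// ltW.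
  by rewrite lerXn2r// nnegrE// (le_trans h0).
have grow := logconvex_growth (fun k => dot_ge0 _ _) ac (sqr_ge0 _) a1.
have lipk k : lip n th (iter k M f) by apply: lip_iter_round lipf; apply: ltW.
have t0 := ltW th0.
have := dot_round_defect sn t0 t0 (lipk r) lipf.
rewrite -/M -!dot_iter_roundC -/M => h1.
have rE : r = (odd r + (r./2).*2)%N by rewrite odd_double_half.
have h2 : `|a r./2 - dot n f (iter r M f)| <= n%:R * (th * th).
  have -> : a r./2 = dot n f (iter (r./2).*2 M f).
    by rewrite -addnn iterD dot_iter_roundC.
  rewrite [in X in _ - X]rE; case: (odd r) => /=; last first.
    by rewrite add0n subrr normr0; apply: mulr_ge0 => //; apply: mulr_ge0.
  rewrite add0n; have := dot_round_defect (leqnn _) t0 t0 (lipk (r./2).*2) lipf.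
  by rewrite (dot_roundC n predT f) [dot n f _]dotC [dot n (round1 _ _ _ f) _]dotC.
have h3 : (1 - th ^+ 2) ^+ 2 ^+ r./2 * a 0%N <= a r./2 := grow r./2.
rewrite a0 -exprM mul2n in h3.
have h4 : (1 - th ^+ 2) ^+ r <= (1 - th ^+ 2) ^+ (r./2).*2.
  rewrite ler_wiXn2l ?subr_ge0//; first by have := sqr_ge0 th; lra.
  by rewrite [X in (_ <= X)%N]rE leq_addl.
have h5 : n%:R / 2 * (1 - th ^+ 2) ^+ r <= n%:R / 2 * (1 - th ^+ 2) ^+ (r./2).*2.
  by rewrite ler_wpM2l ?divr_ge0.
move: h1 h2; rewrite !ler_norml => /andP[h11 h12] /andP[h21 h22].
lra.
Qed.


(** A positive time is a number of complete rounds followed by a nonempty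
    initial part of a round; time zero needs a separate argument, with an
    empty part. *)
Lemma cat_prob_rounds t : exists r s, [/\ (s <= n.-1)%N, (r * n.-1 <= t)%N &
  forall h : 'S_n -> R, \sum_y cat_prob R t 1%g y * h y
    = iter r (round predT n.-1) (round predT s h) 1%g].
Proof.
case: t => [|t].
  exists 0%N, 0%N; split => // h; rewrite sum_cat_prob /=.
  rewrite !coin_avg_const.
  by rewrite /round /=; field.
have nn : (0 < n.-1)%N by lia.
exists (t %/ n.-1)%N, (t %% n.-1).+1; split.
- by rewrite ltn_mod.
- by rewrite (leq_trans (leq_divM _ _)).
move=> h; have e : (t.+1 = t %/ n.-1 * n.-1 + (t %% n.-1).+1)%N.
  by rewrite addnS -divn_eq.
by rewrite {1}e sum_cat_prob_round// ltn_mod.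
Qed.

Let Phi : 'S_n -> R := addstat f f.

(** Chebyshev's inequality on both sides of the level [m / 2]: at time [t] the
    additive statistic of the cosine exceeds it with high probability, at
    equilibrium it stays below. *)
Lemma cat_max_dist_lower t : exists2 r, (r * n.-1 <= t)%N &
  th ^+ 2 <= 1 -> forall m : R, 0 < m ->
  m <= n%:R / 2 * (1 - th ^+ 2) ^+ r - 2 * (n%:R * th ^+ 2) ->
  1 - 4 * (r.+1%:R * (16 * n%:R * th ^+ 2 + 4 * (n%:R * th ^+ 2) ^+ 2)
           + 4 * n%:R) / m ^+ 2 <= cat_max_dist R n t.
Proof.
have [r [s [sn rt Ep]]] := cat_prob_rounds t.
exists r => // th1 m m0 mle; rewrite cat_max_distE.
have mle' := le_trans mle (mean_lower r sn th1).
set m' := dot n f _ in mle'.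
set V := r.+1%:R * _.
have t0 := ltW th0.
have var : \sum_y cat_prob R t 1%g y * (Phi y - m') ^+ 2 <= V.
  rewrite Ep.
  have -> : (fun y => (Phi y - m') ^+ 2) = (fun y =>
     (- (2 * m')) * Phi y + (1 * Phi y ^+ 2 + m' ^+ 2)).
    by apply/funext => y; ring.
  have -> : round predT s (fun y => - (2 * m') * Phi y + (1 * Phi y ^+ 2 + m' ^+ 2))
    = (fun y => (- (2 * m')) * round predT s Phi y
       + (1 * round predT s (fun y => Phi y ^+ 2) y + m' ^+ 2)).
    by apply/funext => y; rewrite !round_lin round_const.
  rewrite !iter_round_lin iter_round_const.
  have := addstat_variance r sn t0 t0 lipf lipf f1.
  rewrite -/Phi round_addstat// iter_round_addstat addstat1 -/M -/m'.
  rewrite -!expr2 -/V; lra.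
pose phi (y : 'S_n) : R := if m' / 2 <= Phi y then 1 else 0.
have m'0 : 0 < m' by exact: lt_le_trans mle'.
have sq4 z : 0 <= 4 * z ^+ 2 / m' ^+ 2.
  by apply: divr_ge0; rewrite ?sqr_ge0// mulr_ge0 ?sqr_ge0.
have phi1 y : 1 - 4 * (Phi y - m') ^+ 2 / m' ^+ 2 <= phi y.
  rewrite /phi; case: (leP (m' / 2) (Phi y)) => h.
    have := sq4 (Phi y - m'); lra.
  suff : 1 <= 4 * (Phi y - m') ^+ 2 / m' ^+ 2 by lra.
  rewrite ler_pdivlMr ?exprn_gt0// mul1r.
  have -> : 4 * (Phi y - m') ^+ 2 = (2 * (m' - Phi y)) ^+ 2 by ring.
  by rewrite lerXn2r ?nnegrE//; lra.
have phi2 y : phi y <= 4 * Phi y ^+ 2 / m' ^+ 2.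
  rewrite /phi; case: (leP (m' / 2) (Phi y)) => h; last exact: sq4.
  rewrite ler_pdivlMr ?exprn_gt0// mul1r.
  have -> : 4 * Phi y ^+ 2 = (2 * Phi y) ^+ 2 by ring.
  by rewrite lerXn2r ?nnegrE//; lra.
have p0 (y : 'S_n) : 0 <= cat_prob R t 1%g y :> R by rewrite divr_ge0.
have sp : \sum_(y : 'S_n) cat_prob R t 1%g y = 1 :> R.
  transitivity (\sum_(y : 'S_n) cat_prob R t 1%g y * (1 : R)).
    by apply: eq_bigr => y _; rewrite mulr1.
  rewrite (Ep (fun=> 1)) (_ : round predT s _ = fun=> 1) ?iter_round_const//.
  by apply/funext => y; rewrite round_const.
have cp : 0 < #|'S_n|%:R :> R.
  by rewrite ltr0n; apply/card_gt0P; exists 1%g.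
set u := @uniform_dist R {perm 'I_n}.
have uE y : u y = (#|'S_n|%:R)^-1 by [].
have su : \sum_y u y = 1.
  under eq_bigr do rewrite uE; rewrite sumr_const -[LHS]mulr_natl.
  by rewrite mulfV// gt_eqF.
apply: le_trans (_ : \sum_y (cat_prob R t 1%g y - u y) * (phi y - 2^-1) <= _);
  last first.
  rewrite /cat_dist /tv_dist mulr_sumr; apply: ler_sum => y _.
  apply: le_trans (ler_norm _) _; rewrite normrM mulrC -/u ler_wpM2r//.
  by rewrite /phi; case: ifP => _; rewrite ler_norml; lra.
have -> : \sum_y (cat_prob R t 1%g y - u y) * (phi y - 2^-1)
  = \sum_y cat_prob R t 1%g y * phi y - \sum_y u y * phi y.
  under eq_bigr do rewrite mulrBr.
  rewrite sumrB -mulr_suml sumrB sp su subrr mul0r subr0.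
  by rewrite -sumrB; apply: eq_bigr => y _; rewrite mulrBl.
have P : 1 - 4 * V / m' ^+ 2 <= \sum_y cat_prob R t 1%g y * phi y.
  apply: le_trans (_ : \sum_y cat_prob R t 1%g y *
     (1 - 4 * (Phi y - m') ^+ 2 / m' ^+ 2) <= _); last first.
    by apply: ler_sum => y _; rewrite ler_wpM2l.
  under eq_bigr do rewrite mulrBr mulr1.
  rewrite sumrB sp lerD2l lerN2.
  have -> : \sum_i cat_prob R t 1%g i * (4 * (Phi i - m') ^+ 2 / m' ^+ 2)
     = 4 * (\sum_y cat_prob R t 1%g y * (Phi y - m') ^+ 2) / m' ^+ 2.
    by rewrite mulr_sumr mulr_suml; apply: eq_bigr => y _; ring.
  by rewrite ler_wpM2r ?invr_ge0 ?sqr_ge0//; lra.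
have Q : \sum_y u y * phi y <= 4 * (4 * n%:R) / m' ^+ 2.
  apply: le_trans (_ : \sum_y u y * (4 * Phi y ^+ 2 / m' ^+ 2) <= _).
    by apply: ler_sum => y _; rewrite ler_wpM2l// uE invr_ge0.
  have -> : \sum_y u y * (4 * Phi y ^+ 2 / m' ^+ 2)
     = 4 * ((\sum_y Phi y ^+ 2) / #|'S_n|%:R) / m' ^+ 2.
    rewrite !mulr_suml mulr_sumr mulr_suml; apply: eq_bigr => y _.
    by rewrite uE; ring.
  rewrite ler_wpM2r ?invr_ge0 ?sqr_ge0// ler_wpM2l// ler_pdivrMr//.
  by rewrite mulrC; apply: addstat_second_moment => //; exact: ltnW.
apply: le_trans (_ : 1 - 4 * (V + 4 * n%:R) / m' ^+ 2 <= _); last first.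
  have -> : 4 * (V + 4 * n%:R) / m' ^+ 2
     = 4 * V / m' ^+ 2 + 4 * (4 * n%:R) / m' ^+ 2 by ring.
  lra.
rewrite lerD2l lerN2 ler_wpM2l//.
  rewrite mulr_ge0// addr_ge0// ?mulr_ge0// addr_ge0//.
    by rewrite mulr_ge0 ?sqr_ge0// mulr_ge0.
  by rewrite mulr_ge0 ?sqr_ge0.
rewrite lef_pV2 ?posrE ?exprn_gt0//.
by rewrite lerXn2r ?nnegrE// ltW.
Qed.

End LowerBound.

(** * Asymptotics of the lower bound *)

Section LowerAsymptotics.
Variable R : realType.

Lemma expR_sub_le (x : R) : 0 <= x -> x <= 2^-1 ->
  expR (- (x + 2 * x ^+ 2)) <= 1 - x.
Proof.
move=> x0 x1; rewrite expRN invf_ple ?posrE ?expR_gt0//; last by lra.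
apply: le_trans (expR_ge1Dx _).
rewrite -[leLHS]mul1r ler_pdivrMr; last by lra.
have : 0 <= x ^+ 2 * (1 - 2 * x) by rewrite mulr_ge0 ?sqr_ge0//; lra.
lra.
Qed.

Lemma pi_le4 : pi <= 4 :> R.
Proof. have := pihalf_lt2 R; lra. Qed.

Lemma ln2_ge : 2^-1 <= ln 2 :> R.
Proof.
have h : 0 < expR (- 2^-1) :> R by exact: expR_gt0.
rewrite -[leLHS]opprK -[in leRHS](invrK 2) lnV ?posrE ?invr_gt0//.
rewrite lerN2 -ler_expR lnK ?posrE ?invr_gt0//.
by have := expR_ge1Dx (- 2^-1 : R); lra.
Qed.

(** Here [y] is of order n^-2, so the second-order term of the logarithm costs
    only a constant factor. *)
Lemma power_rate_ge (L y : R) (n r : nat) : 50 < n%:R :> R -> 0 <= y ->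
  n%:R * y <= 16 / n%:R -> L <= n%:R -> r%:R * y <= L / 2 + 2^-1 ->
  expR (- (3 / 2)) * expR (- (L / 2)) <= (1 - y) ^+ r.
Proof.
move=> n50 y0 yn Ln ry.
have np : 0 < n%:R :> R by lra.
have in50 : 16 / n%:R <= 2^-1 :> R by rewrite ler_pdivrMr//; lra.
have y1 : y <= 2^-1.
  have : 50 * y <= n%:R * y by rewrite ler_wpM2r// ltW.
  lra.
apply: (@le_trans _ _ (expR (- (y + 2 * y ^+ 2)) ^+ r)); last first.
  rewrite lerXn2r ?nnegrE ?expR_ge0//; first by lra.
  exact: expR_sub_le.
rewrite -expRM_natl -expRD ler_expR.
have y2 : y ^+ 2 <= y * (16 / n%:R / n%:R).
  by rewrite expr2 ler_wpM2l// ler_pdivlMr// mulrC.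
have q0 : 0 <= 16 / n%:R / n%:R :> R by rewrite !divr_ge0// ltW.
have ry2 : r%:R * y ^+ 2 <= 2^-1.
  apply: (@le_trans _ _ (r%:R * y * (16 / n%:R / n%:R))).
    by rewrite -mulrA ler_wpM2l.
  apply: (@le_trans _ _ (n%:R * (16 / n%:R / n%:R))).
    by apply: ler_wpM2r => //; lra.
  have -> : n%:R * (16 / n%:R / n%:R) = 16 / n%:R :> R.
    by field; rewrite gt_eqF.
  exact: in50.
have -> : r%:R * - (y + 2 * y ^+ 2) = - (r%:R * y + 2 * (r%:R * y ^+ 2)) by ring.
lra.
Qed.

Lemma variance_le (l y : R) (n r : nat) : 50 < n%:R :> R -> 0 <= y ->
  n%:R * y <= 16 / n%:R -> 2^-1 <= l -> r%:R * y <= l / 2 + 2^-1 ->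
  4 * (r.+1%:R * (16 * n%:R * y + 4 * (n%:R * y) ^+ 2) + 4 * n%:R)
  <= 256 * (n%:R * l).
Proof.
move=> n50 y0 yn l1 ry.
have np : 0 < n%:R :> R by lra.
have in50 : 16 / n%:R <= 1 :> R by rewrite ler_pdivrMr//; lra.
have ny1 : n%:R * y <= 1 by exact: le_trans in50.
have ny0 : 0 <= n%:R * y by rewrite mulr_ge0// ltW.
have h1 : n%:R <= 2 * (n%:R * l).
  have : n%:R * 1 <= n%:R * (2 * l) by rewrite ler_wpM2l ?(ltW np)//; lra.
  by rewrite mulr1 [n%:R * (2 * l)]mulrCA.
have h2 : r%:R * (n%:R * y) <= 2 * (n%:R * l).
  have -> : r%:R * (n%:R * y) = n%:R * (r%:R * y) by ring.
  have : n%:R * (r%:R * y) <= n%:R * (2 * l).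
    by rewrite ler_wpM2l ?(ltW np)//; lra.
  by rewrite [n%:R * (2 * l)]mulrCA.
have h3 : r%:R * (n%:R * y) ^+ 2 <= r%:R * (n%:R * y).
  by rewrite ler_wpM2l// expr2 ler_piMl.
have h4 : (n%:R * y) ^+ 2 <= 1 by rewrite expr_le1.
rewrite -[r.+1%:R]natr1.
have -> : (r%:R + 1) * (16 * n%:R * y + 4 * (n%:R * y) ^+ 2) =
  16 * (r%:R * (n%:R * y)) + 4 * (r%:R * (n%:R * y) ^+ 2)
  + 16 * (n%:R * y) + 4 * (n%:R * y) ^+ 2 by ring.
lra.
Qed.

(** The threshold is chosen of order the square root of [n * ln n / eps]: at
    that height the mean of the statistic still dominates its fluctuations,
    whose variance is of order [n * ln n]. *)
Lemma lower_constants (ka c eps : R) (n r t : nat) :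
  ka = expR (- (3 / 2)) / 4 -> c = 100 + 64 / ka + 256 / ka ^+ 2 ->
  0 < eps -> eps <= 1 -> (1 < n)%N -> (r * n.-1 <= t)%N ->
  1 < n%:R * eps / (c * ln n%:R) ->
  t%:R < n%:R ^+ 3 / (2 * pi ^+ 2) * ln (n%:R * eps / (c * ln n%:R)) ->
  let th := pi / n%:R : R in
  exists m, [/\ th ^+ 2 <= 1, 0 < m,
   m <= n%:R / 2 * (1 - th ^+ 2) ^+ r - 2 * (n%:R * th ^+ 2) &
   4 * (r.+1%:R * (16 * n%:R * th ^+ 2 + 4 * (n%:R * th ^+ 2) ^+ 2)
           + 4 * n%:R) / m ^+ 2 < eps].
Proof.
move=> kaE cE eps0 eps1 n1 rt; set x := n%:R * eps / _ => x1 tT th.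
have ka0 : 0 < ka by rewrite kaE divr_gt0 ?expR_gt0.
have i1 : 0 < 64 / ka by rewrite divr_gt0 ?ltr0n.
have i2 : 0 < 256 / ka ^+ 2 by rewrite divr_gt0 ?exprn_gt0 ?ltr0n.
have [c0 c1 c2] : [/\ 100 < c, 64 / ka < c & 256 / ka ^+ 2 < c].
  by rewrite cE; split; lra.
clear cE i1 i2.
have n2 : 2 <= n%:R :> R by rewrite ler_nat.
have np : 0 < n%:R :> R by rewrite ltr0n ltnW.
have cp : 0 < c by apply: lt_trans c0; rewrite ltr0n.
have ln2n : 2^-1 <= ln n%:R :> R.
  by apply: le_trans ln2_ge _; rewrite ler_ln ?posrE.
have lnp : 0 < ln n%:R :> R by apply: lt_le_trans ln2n; rewrite invr_gt0.
have cl0 : 0 < c * ln n%:R by rewrite mulr_gt0.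
have ne : c * ln n%:R < n%:R * eps.
  by move: x1; rewrite ltr_pdivlMr// mul1r.
have nc : c / 2 < n%:R.
  apply: (@le_lt_trans _ _ (c * ln n%:R)); first by rewrite ler_pM2l.
  by apply: lt_le_trans ne _; rewrite ler_piMr// ltW.
have nk : 32 / ka <= n%:R.
  have -> : 32 / ka = 64 / ka / 2 by field; rewrite gt_eqF.
  by apply: ltW; apply: lt_trans nc; rewrite ltr_pM2r.
have n50 : 50 < n%:R :> R by clear -c0 nc; lra.
have x0 : 0 < x by apply: lt_trans x1.
have cl1 : 1 <= c * ln n%:R.
  have : 100 * 2^-1 <= c * ln n%:R.
    by apply: ler_pM; rewrite ?invr_ge0// ltW.
  by clear; lra.
have xn : x <= n%:R.
  rewrite /x ler_pdivrMr// ler_pM2l//; exact: le_trans eps1 cl1.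
set L := ln x in tT.
have L0 : 0 < L by exact: ln_gt0.
have Ln : L <= ln n%:R by rewrite ler_ln ?posrE.
have lnn : ln n%:R <= n%:R :> R.
  by rewrite -[leRHS]lnK ?posrE//; apply: le_trans (expR_ge1Dx _); rewrite lerDr.
have pp := pi_gt0 R.
have pp' : pi ^+ 2 <= 16 :> R.
  have -> : 16 = 4 ^+ 2 :> R by ring.
  by rewrite lerXn2r ?nnegrE ?pi_ge0 ?pi_le4.
have thE : th ^+ 2 * n%:R ^+ 2 = pi ^+ 2 by rewrite -exprMn /th divfK// gt_eqF.
have y0 : 0 <= th ^+ 2 by exact: sqr_ge0.
have yp : 0 < th ^+ 2 by rewrite exprn_gt0// divr_gt0.
set y := th ^+ 2 in thE y0 yp *.
have yn : n%:R * y <= 16 / n%:R.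
  rewrite ler_pdivlMr//; apply: le_trans pp'; rewrite -thE.
  by rewrite le_eqVlt; apply/orP; left; apply/eqP; ring.
have n1R : n.-1%:R = n%:R - 1 :> R by rewrite -subn1 natrB// ltnW.
have rn : r%:R * (n%:R - 1) < n%:R ^+ 3 / (2 * pi ^+ 2) * L.
  by apply: le_lt_trans tT; rewrite -n1R -natrM ler_nat.
have ryn : r%:R * y * (n%:R - 1) <= n%:R * L / 2.
  have -> : n%:R * L / 2 = y * (n%:R ^+ 3 / (2 * pi ^+ 2) * L).
    by rewrite -thE; field; rewrite !gt_eqF.
  have -> : r%:R * y * (n%:R - 1) = y * (r%:R * (n%:R - 1)) by ring.
  by rewrite ler_wpM2l// ltW.
have L1n : L <= n%:R - 1.
  apply: le_trans Ln _; have := @le_ln1Dx R (n%:R - 1).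
  by rewrite [1 + _]addrC subrK; apply; clear -n2; lra.
have ry : r%:R * y <= L / 2 + 2^-1.
  have e : n%:R * L / 2 <= (L / 2 + 2^-1) * (n%:R - 1) by clear -L1n; lra.
  have h : 0 < n%:R - 1 :> R by clear -n2; lra.
  by rewrite -(ler_pM2r h) (le_trans ryn).
pose w := expR (- (L / 2)).
have w0 : 0 < w by exact: expR_gt0.
have wE : w ^+ 2 * x = 1.
  rewrite /w expr2 -expRD -[x in _ * x]lnK ?posrE// -/L -expRD.
  by rewrite (_ : _ + _ = 0) ?expR0//; field.
have w2 : n%:R * w ^+ 2 * eps = c * ln n%:R.
  have xE : x * (c * ln n%:R) = n%:R * eps by rewrite /x divfK// gt_eqF.
  have : w ^+ 2 * (x * (c * ln n%:R)) = c * ln n%:R by rewrite mulrA wE mul1r.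
  by rewrite xE => <-; ring.
have pw : 4 * ka * w <= (1 - y) ^+ r.
  have := power_rate_ge n50 y0 yn (le_trans Ln lnn) ry.
  by rewrite kaE -/w [4 * _]mulrC divfK.
have nw1 : 1 <= n%:R * w.
  have h : 1 <= (n%:R * w) ^+ 2.
    apply: (@le_trans _ _ (n%:R * (n%:R * w ^+ 2 * eps))).
      rewrite w2; apply: le_trans cl1 _; rewrite ler_peMl ?(ltW cl0)//.
      by rewrite ler1n ltnW.
    have -> : (n%:R * w) ^+ 2 = n%:R * (n%:R * w ^+ 2 * 1) by ring.
    rewrite ler_wpM2l ?(ltW np)// ler_wpM2l// mulr_ge0 ?sqr_ge0//.
  rewrite -ler_sqr ?nnegrE// ?expr1n//.
  by rewrite mulr_ge0// ltW.
have nyk : 2 * (n%:R * y) <= ka * (n%:R * w).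
  have h : 32 / n%:R <= ka by rewrite ler_pdivrMr// mulrC -ler_pdivrMr.
  apply: (@le_trans _ _ ka); last by rewrite ler_peMr// ltW.
  apply: le_trans h; have -> : 32 / n%:R = 2 * (16 / n%:R) :> R by ring.
  by rewrite ler_pM2l.
have nwp : 0 < n%:R * w by rewrite mulr_gt0.
exists (ka * (n%:R * w)); split.
- have : n%:R * y <= 1.
    apply: le_trans yn _; rewrite ler_pdivrMr//; clear -n50; lra.
  apply: le_trans; rewrite ler_peMl// ler1n ltnW//.
- by rewrite mulr_gt0.
- have : n%:R / 2 * (4 * ka * w) <= n%:R / 2 * (1 - y) ^+ r.
    by rewrite ler_wpM2l// divr_ge0// ltW.
  clear -nyk; lra.
rewrite ltr_pdivrMr ?exprn_gt0 ?mulr_gt0//.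
have -> : eps * (ka * (n%:R * w)) ^+ 2 = ka ^+ 2 * n%:R * (n%:R * w ^+ 2 * eps).
  by ring.
rewrite w2.
have ry' : r%:R * y <= ln n%:R / 2 + 2^-1.
  by apply: le_trans ry _; rewrite lerD2r ler_pM2r ?invr_gt0.
apply: le_lt_trans (variance_le n50 y0 yn ln2n ry') _.
have -> : ka ^+ 2 * n%:R * (c * ln n%:R) = (ka ^+ 2 * c) * (n%:R * ln n%:R) by ring.
rewrite ltr_pM2r ?mulr_gt0//.
by move: c2; rewrite ltr_pdivrMr ?exprn_gt0// mulrC.
Qed.

Lemma tmix_lower : exists2 c : R, 0 < c &
  forall (eps : R) (n : nat), 0 < eps -> (2 <= n)%N ->
    ((n%:R ^+ 3 / (2 * pi ^+ 2) * ln n%:R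
      - n%:R ^+ 3 / (2 * pi ^+ 2) * ln (c * ln n%:R / eps))%:E
     <= cat_tmix n (1 - eps))%E.
Proof.
(* the three terms of [c] make [n] large, the loss of an incomplete round small
   compared with the threshold, and the standard deviation small as well *)
pose ka : R := expR (- (3 / 2)) / 4.
have ka0 : 0 < ka by rewrite /ka divr_gt0 ?expR_gt0.
pose c := 100 + 64 / ka + 256 / ka ^+ 2.
have c0 : 0 < c by rewrite !addr_gt0 ?divr_gt0 ?exprn_gt0 ?ltr0n.
exists c => // eps n eps0 n1.
apply: le_ereal_inf_tmp => _ [t /= td <-]; rewrite lee_fin leNgt; apply/negP.
have np : 0 < n%:R :> R by rewrite ltr0n ltnW.
have lnp : 0 < ln n%:R :> R by apply: ln_gt0; rewrite ltr1n.
have cl : 0 < c * ln n%:R by rewrite mulr_gt0.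
have q0 : 0 < n%:R ^+ 3 / (2 * pi ^+ 2) :> R.
  by rewrite divr_gt0 ?exprn_gt0// mulr_gt0// exprn_gt0// pi_gt0.
rewrite -mulrBr -ln_div ?posrE ?divr_gt0// invf_div [n%:R * (eps / _)]mulrA => tT.
have [eps1|eps1] := ltP 1 eps.
  have : 0 <= cat_max_dist R n t.
    by rewrite cat_max_distE /cat_dist /tv_dist mulr_ge0// sumr_ge0.
  lra.
set x := n%:R * eps / _ in tT.
have x1 : 1 < x.
  rewrite ltNge; apply/negP => /ln_le0 x1.
  have := ler0n R t; have := mulr_ge0_le0 (ltW q0) x1; lra.
have [r rt H] := @cat_max_dist_lower R n n1 t.
have [m [th1 m0 mle me]] := lower_constants (erefl : ka = _) (erefl : c = _)
  eps0 eps1 n1 rt x1 tT.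
have := H th1 m m0 mle; lra.
Qed.

End LowerAsymptotics.

(** * Increasing functions on permutations *)

Section Bruhat.
Variable n : nat.
Implicit Types (x y : 'S_n) (i j e : nat).

Definition height x i j : nat :=
  (\sum_(p < n) ((p < i) && (x p < j) : nat))%N.

(** Bruhat order, with the identity as greatest element. *)
Definition above x y := forall i j, (height y i j <= height x i j)%N.

Lemma heightS x (i : 'I_n) j : height x i.+1 j = (height x i j + (x i < j))%N.
Proof.
rewrite /height (bigD1 i) //= [in RHS](bigD1 i) //= ltnn ltnSn /= add0n addnC.
congr (_ + _)%N; apply: eq_bigr => p pi.
by congr ((_ && _ : bool) : nat); rewrite ltnS leq_eqVlt (inj_eq val_inj) (negbTE pi).
Qed.

Lemma height_mulg (t : 'S_n) x i j :
  height (t * x)%g i j = (\sum_(p < n) ((t^-1%g p < i) && (x p < j) : nat))%N.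
Proof.
rewrite /height (reindex_inj (@perm_inj _ t^-1%g)); apply: eq_bigr => p _.
by rewrite permM permKV.
Qed.

Lemma height_adj (a b : 'I_n) x i j : b = a.+1 :> nat -> i != b ->
  height (tperm a b * x)%g i j = height x i j.
Proof.
move=> ab ib; rewrite height_mulg tpermV; apply: eq_bigr => p _.
by congr ((_ && _ : bool) : nat); case: tpermP => [->|->|//]; lia.
Qed.

(** At the only height that a transposition of [a] and [a.+1] can change, the
    two arrangements reach the two extreme values that the neighbouring heights
    allow. *)
Lemma height_sorted (a b : 'I_n) x j : b = a.+1 :> nat -> (x a < x b)%N ->
  height x b j = minn (height x a j).+1 (height x b.+1 j)
  /\ height (tperm a b * x)%g b j = maxn (height x a j) (height x b.+1 j).-1.
Proof.
move=> ab xab.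
have e1 y : height y b j = (height y a j + (y a < j))%N by rewrite ab heightS.
rewrite !heightS !e1 height_adj//; last by lia.
by rewrite permM tpermL; lia.
Qed.

(** Sorting the values at two positions can only raise every height. *)
Lemma above_tperm (p q : 'I_n) x : (p < q)%N -> (x q < x p)%N ->
  above (tperm p q * x)%g x.
Proof.
move=> pq xqp i j; rewrite height_mulg tpermV /height.
have qp : q != p by rewrite -val_eqE /= gtn_eqF.
rewrite (bigD1 p) //= (bigD1 q) //= [leqRHS](bigD1 p) //= [X in (_ <= _ + X)%N](bigD1 q) //=.
rewrite tpermL tpermR !addnA; apply: leq_add; first by lia.
apply: leq_sum => r /andP[rp rq]; by rewrite tpermD 1?eq_sym.
Qed.

Lemma above_id x : above x 1%g -> x = 1%g.
Proof.
move=> ax.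
have xle (p : 'I_n) : (x p <= p)%N.
  rewrite leqNgt; apply/negP => px.
  have := ax p.+1 p.+1; rewrite leqNgt => /negP; apply.
  rewrite /height (bigD1 p) //= [ltnRHS](bigD1 p) //= perm1 ltnSn.
  have -> : (x p < p.+1)%N = false by lia.
  rewrite /= add0n add1n ltnS.
  by apply: leq_sum => r _; rewrite perm1; lia.
have H m (p : 'I_n) : (p < m)%N -> x p = p.
  elim: m p => // m IH p pm; have := xle p; rewrite leq_eqVlt => /orP[/eqP|].
    by move=> h; apply: val_inj.
  move=> xp; have : x (x p) = x p by apply: IH; lia.
  by move/perm_inj.
by apply/permP => p; rewrite perm1 (H n).
Qed.

End Bruhat.

Section Increasing.
Variables (R : realType) (n : nat).
Implicit Types (f p phi : 'S_n -> R) (x y : 'S_n) (es : seq nat).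

Definition increasing f := forall x y, above x y -> f y <= f x.

Definition pairing p f : R := \sum_x p x * f x.

(** At the single height that a flip can change, the two arrangements of a
    pair give the extreme values allowed by the neighbouring heights, and
    these are monotone. *)
Lemma lazy_increasing e f : (e.+1 < n)%N -> increasing f ->
  increasing (lazy_flip (adj_tperm n e) f).
Proof.
move=> en fi x y xy; rewrite /lazy_flip (adj_tpermE en).
set a := Ordinal (ltnW en); set b := Ordinal en; set t := tperm a b.
have ab : b = a.+1 :> nat by [].
have tt (z : 'S_n) : (t * (t * z))%g = z by rewrite mulgA tperm2 mul1g.
pose srt (z : 'S_n) : 'S_n := if (z a < z b)%N then z else (t * z)%g.
pose uns (z : 'S_n) : 'S_n := if (z a < z b)%N then (t * z)%g else z.
have su z : f z + f (t * z)%g = f (srt z) + f (uns z).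
  by rewrite /srt /uns; case: ifP => // _; rewrite addrC.
have hs z j : height (srt z) b j = minn (height z a j).+1 (height z b.+1 j)
   /\ height (uns z) b j = maxn (height z a j) (height z b.+1 j).-1.
  rewrite /srt /uns; case: ltnP => h; first exact: height_sorted.
  have nab : (z a != z b :> nat) by rewrite val_eqE (inj_eq perm_inj) -val_eqE /=; lia.
  have h' : ((t * z)%g a < (t * z)%g b)%N.
    by rewrite !permM tpermL tpermR ltn_neqAle eq_sym nab.
  have ea : height (t * z)%g a j = height z a j by apply: height_adj => //=; lia.
  have eb : height (t * z)%g b.+1 j = height z b.+1 j.
    by apply: height_adj => //=; lia.
  by have := height_sorted j ab h'; rewrite -/t tt ea eb.
have ho z (i j : nat) : i != b :> nat -> height (srt z) i j = height z i j
   /\ height (uns z) i j = height z i j.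
  by move=> ib; rewrite /srt /uns; case: ifP => _; rewrite ?height_adj.
rewrite !su ler_wpM2r// lerD//; apply: fi => i j.
  have [ib|ib] := eqVneq i (b : nat).
    rewrite ib (hs x j).1 (hs y j).1.
    by have := xy a j; have := xy b.+1 j; lia.
  by rewrite (ho x i j ib).1 (ho y i j ib).1.
have [ib|ib] := eqVneq i (b : nat).
  rewrite ib (hs x j).2 (hs y j).2.
  by have := xy a j; have := xy b.+1 j; lia.
by rewrite (ho x i j ib).2 (ho y i j ib).2.
Qed.

Lemma sweep_increasing es f : all (fun e => e.+1 < n)%N es -> increasing f ->
  increasing (sweep es f).
Proof.
by move=> + fi; elim: es => //= e es IH /andP[en /IH]; apply: lazy_increasing.
Qed.

Lemma round_increasing S f : increasing f -> increasing (round S n.-1 f).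
Proof.
move=> fi x y xy; rewrite /round ler_wpM2r// lerD//.
  exact: (sweep_increasing (dir_edges_lt S true (leqnn _)) fi).
exact: (sweep_increasing (dir_edges_lt S false (leqnn _)) fi).
Qed.

Lemma iter_round_increasing r S f : increasing f ->
  increasing (iter r (round S n.-1) f).
Proof. by move=> fi; elim: r => //= r; apply: round_increasing. Qed.

Definition point_mass : 'S_n -> R := fun x => (x == 1%g)%:R.

Lemma point_mass_increasing : increasing point_mass.
Proof.
move=> x y; rewrite /point_mass; have [->|_] := eqVneq y 1%g.
  by move=> /above_id ->; rewrite eqxx.
by rewrite ler0n.
Qed.

Lemma pairing_point_mass f : pairing point_mass f = f 1%g.
Proof.
rewrite /pairing /point_mass (bigD1 1%g) //= eqxx mul1r big1 ?addr0// => x.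
by move=> /negbTE ->; rewrite mul0r.
Qed.

Lemma pairing_lazy e p f : pairing (lazy_flip (adj_tperm n e) p) f
  = pairing p (lazy_flip (adj_tperm n e) f).
Proof.
set t := adj_tperm n e; rewrite /pairing /lazy_flip.
have h : \sum_x p (t * x)%g * f x = \sum_x p x * f (t * x)%g.
  rewrite (reindex_inj (mulgI t)); apply: eq_bigr => x _.
  by rewrite mulgA adj_tpermK mul1g.
transitivity ((\sum_x p x * f x + \sum_x p (t * x)%g * f x) / 2).
  by rewrite -big_split mulr_suml; apply: eq_bigr => x _ /=; ring.
rewrite h -big_split mulr_suml; apply: eq_bigr => x _ /=; ring.
Qed.

Lemma pairing_sweep es p f :
  pairing (sweep es p) f = pairing p (sweep (rev es) f).
Proof.
elim: es f => //= e es IH f.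
by rewrite pairing_lazy IH rev_cons -cats1 sweep_cat.
Qed.

Lemma pairing_roundE S p f : pairing p (round S n.-1 f)
  = (pairing p (sweep (dir_edges n S true n.-1) f)
     + pairing p (sweep (dir_edges n S false n.-1) f)) / 2.
Proof.
rewrite /pairing -big_split mulr_suml; apply: eq_bigr => x _ /=.
by rewrite /round; ring.
Qed.

Lemma pairingC p f : pairing p f = pairing f p.
Proof. by apply: eq_bigr => x _; rewrite mulrC. Qed.

Lemma pairing_round S p f :
  pairing (round S n.-1 p) f = pairing p (round S n.-1 f).
Proof.
rewrite pairingC !pairing_roundE.
rewrite ![pairing f _]pairingC !pairing_sweep !dir_edges_rev /=.
by rewrite addrC.
Qed.

Lemma pairing_iter_round r S p f :
  pairing (iter r (round S n.-1) p) f = pairing p (iter r (round S n.-1) f).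
Proof. by elim: r f => //= r IHr f; rewrite pairing_round IHr -iterSr. Qed.

(** Peres and Winkler's censoring inequality: an update lowers the correlation
    of an increasing density with increasing functions. *)
Lemma pairing_lazy_le e p f : (e.+1 < n)%N -> increasing p -> increasing f ->
  pairing (lazy_flip (adj_tperm n e) p) f <= pairing p f.
Proof.
move=> en pI fI; rewrite (adj_tpermE en).
set a := Ordinal (ltnW en); set b := Ordinal en; set t := tperm a b.
have tt (z : 'S_n) : (t * (t * z))%g = z by rewrite mulgA tperm2 mul1g.
have h : 0 <= \sum_x (p x - p (t * x)%g) * (f x - f (t * x)%g).
  apply: sumr_ge0 => x _.
  have nab : (x a != x b :> nat).
    by rewrite val_eqE (inj_eq perm_inj) -val_eqE /=; lia.
  have [xab|xab] : (x a < x b)%N \/ (x b < x a)%N by lia.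
    have ax : above x (t * x)%g.
      rewrite -{1}(tt x); apply: above_tperm => //.
      by rewrite !permM tpermL tpermR.
    by rewrite mulr_ge0// subr_ge0; [exact: pI|exact: fI].
  have ax : above (t * x)%g x by exact: above_tperm.
  by rewrite mulr_le0// subr_le0; [exact: pI|exact: fI].
have s1 : \sum_x p (t * x)%g * f (t * x)%g = pairing p f.
  by rewrite /pairing [RHS](reindex_inj (mulgI t)).
have s2 : \sum_x p (t * x)%g * f x = \sum_x p x * f (t * x)%g.
  by rewrite (reindex_inj (mulgI t)); apply: eq_bigr => x _; rewrite tt.
have e1 : \sum_x (p x - p (t * x)%g) * (f x - f (t * x)%g)
   = 2 * pairing p f - 2 * \sum_x p (t * x)%g * f x.
  transitivity (pairing p f - \sum_x p x * f (t * x)%g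
    - \sum_x p (t * x)%g * f x + \sum_x p (t * x)%g * f (t * x)%g).
    by rewrite /pairing -!sumrB -big_split; apply: eq_bigr => x _ /=; ring.
  by rewrite s1 -s2; ring.
have -> : pairing (lazy_flip t p) f
   = (pairing p f + \sum_x p (t * x)%g * f x) / 2.
  by rewrite /pairing -big_split mulr_suml; apply: eq_bigr => x _ /=;
    rewrite /lazy_flip; ring.
lra.
Qed.

(** The censored edges are removed one at a time: the rest of the sweep keeps
    the density increasing, and the edges that are kept move to the test
    function. *)
Lemma pairing_sweep_le (S : pred nat) es p f :
  all (fun e => e.+1 < n)%N es -> increasing p -> increasing f ->
  pairing (sweep es p) f <= pairing (sweep [seq e <- es | S e] p) f.
Proof.
move=> + pI; elim: es f => //= e es IH f /andP[en esn] fI.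
case: ifP => _ /=; last first.
  apply: le_trans (IH _ esn fI); apply: pairing_lazy_le => //.
  exact: sweep_increasing.
by rewrite !pairing_lazy; apply: IH => //; apply: lazy_increasing.
Qed.

Lemma pairing_round_le S p f : increasing p -> increasing f ->
  pairing (round predT n.-1 p) f <= pairing (round S n.-1 p) f.
Proof.
move=> pI fI; rewrite ![pairing (round _ _ _) f]pairingC !pairing_roundE.
rewrite ler_wpM2r// ![pairing f _]pairingC.
have FE d : dir_edges n S d n.-1 = [seq e <- dir_edges n predT d n.-1 | S e].
  by case: d; rewrite /= /up_edges /down_edges filter_predT.
rewrite !FE lerD//; apply: pairing_sweep_le => //; exact: dir_edges_lt.
Qed.

Lemma pairing_iter_round_le r S p f : increasing p -> increasing f ->
  pairing (iter r (round predT n.-1) p) f <= pairing (iter r (round S n.-1) p) f.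
Proof.
move=> pI; elim: r f => //= r IHr f fI.
apply: le_trans (pairing_round_le _ _ fI) _; first exact: iter_round_increasing.
by rewrite !pairing_round; apply: IHr; apply: round_increasing.
Qed.

Lemma censored_phases (a b : nat) S f : increasing f ->
  pairing (iter (a + (b + a)) (round predT n.-1) point_mass) f
  <= pairing (iter a (round S n.-1) (iter b (round predT n.-1)
       (iter a (round S n.-1) point_mass))) f.
Proof.
move=> fI; rewrite !iterD; set M := iter _ (round predT _).
set MS := iter a (round S n.-1).
have dI := point_mass_increasing.
apply: le_trans (pairing_iter_round_le a S _ fI) _.
  by do 2!apply: iter_round_increasing.
rewrite -/MS /MS !(pairing_iter_round a S) !pairing_iter_round -/MS.
rewrite -!(pairing_iter_round a).
apply: pairing_iter_round_le => //; do 2!apply: iter_round_increasing => //.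
Qed.

(** The l1 distance to a constant is attained by a test function that is the
    indicator of the set where the density exceeds it, which is increasing
    with the density. *)
Lemma increasing_l1_le p p' (u : R) : increasing p ->
  \sum_x (p x - u) = 0 -> \sum_x (p' x - u) = 0 ->
  (forall f, increasing f -> pairing p f <= pairing p' f) ->
  \sum_x `|p x - u| <= \sum_x `|p' x - u|.
Proof.
move=> pI p0 p'0 pp.
pose phi x : R := if u <= p x then 1 else 0.
have phiI : increasing phi.
  move=> x y xy; rewrite /phi; have := pI _ _ xy.
  by case: ifP => [u1|_]; case: ifP => //; move/negbT; rewrite -ltNge; lra.
have h q : \sum_x (q x - u) = 0 ->
    \sum_x (q x - u) * (2 * phi x - 1) = 2 * pairing q phi - 2 * \sum_x u * phi x.
  move=> q0; transitivity (2 * (pairing q phi - \sum_x u * phi x) - \sum_x (q x - u)).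
    by rewrite /pairing -sumrB mulr_sumr -sumrB; apply: eq_bigr => x _; ring.
  by rewrite q0; ring.
apply: le_trans (_ : \sum_x (p x - u) * (2 * phi x - 1) <= _).
  apply: ler_sum => x _; rewrite /phi; case: (leP u (p x)) => ux.
    by rewrite ger0_norm ?subr_ge0//; lra.
  by rewrite ltr0_norm ?subr_lt0//; lra.
rewrite h//.
apply: (@le_trans _ _ (\sum_x (p' x - u) * (2 * phi x - 1))).
  by rewrite h//; have := pp _ phiI; lra.
apply: ler_sum => x _; apply: le_trans (ler_norm _) _.
rewrite normrM ler_piMr// /phi; case: ifP => _; rewrite ler_norml; lra.
Qed.

End Increasing.

(** * Coupling two decks *)

Section Coupling.
Variables (R : realType) (n : nat).
Implicit Types (f : 'S_n -> R) (g : nat -> R) (x y : 'S_n) (es : seq nat).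

(** Total displacement of the cards between two arrangements, measured
    through [g]. *)
Definition disp g x y : R :=
  \sum_(c < n) `|g (x^-1%g c) - g (y^-1%g c)|.

Let nondecr g := {homo g : i j / (i <= j)%N >-> i <= j}.

(** The two decks toss the same coin, except when some card sits at the two
    different ends of the updated edge in the two decks: opposite coins then
    bring its two copies together. *)
Lemma lazy_coupling e f g : (e.+1 < n)%N -> nondecr g ->
  (forall x y, `|f x - f y| <= disp g x y) ->
  forall x y, `|lazy_flip (adj_tperm n e) f x - lazy_flip (adj_tperm n e) f y|
    <= disp (avg1 e g) x y.
Proof.
move=> en gm fg x y; rewrite /lazy_flip (adj_tpermE en).
set a := Ordinal (ltnW en); set b := Ordinal en; set t := tperm a b.
have gab : g e <= g e.+1 by exact: gm.
have tinv z c : ((t * z)^-1%g : 'S_n) c = t (z^-1%g c).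
  by rewrite invMg permM tpermV.
have out1 (X Y : 'I_n) : X = a \/ X = b -> Y <> a -> Y <> b ->
    (`|g X - g Y| + `|g (t X) - g Y|) / 2 <= `|(g e + g e.+1) / 2 - g Y|.
  move=> Xab Ya Yb.
  have -> : `|g X - g Y| + `|g (t X) - g Y| = `|g e - g Y| + `|g e.+1 - g Y|.
    by case: Xab => ->; rewrite /t ?tpermL ?tpermR //= addrC.
  have [Ye|Ye] : (Y < e)%N \/ (e.+1 < Y)%N.
    have : (Y != e :> nat) by apply/eqP => h; apply: Ya; apply: val_inj.
    have : (Y != e.+1 :> nat) by apply/eqP => h; apply: Yb; apply: val_inj.
    by lia.
    have := gm _ _ (ltnW Ye) => h.
    by rewrite !ger0_norm; lra.
  have := gm _ _ (ltnW Ye) => h.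
  by rewrite !ler0_norm; lra.
have avg_out (X : 'I_n) : X <> a -> X <> b -> avg1 e g X = g X.
  move=> Xa Xb; rewrite /avg1.
  have -> : (X == e :> nat) = false by apply/eqP => h; apply: Xa; apply: val_inj.
  by have -> : (X == e.+1 :> nat) = false
    by apply/eqP => h; apply: Xb; apply: val_inj.
have avg_in (X : 'I_n) : X = a \/ X = b -> avg1 e g X = (g e + g e.+1) / 2.
  by case=> ->; rewrite /avg1 /= eqxx ?orbT.
have tout (X : 'I_n) : X <> a -> X <> b -> t X = X.
  by rewrite /t; case: tpermP.
have inout (X : 'I_n) : (X = a \/ X = b) \/ (X <> a /\ X <> b).
  have [->|/eqP Xa] := eqVneq X a; first by left; left.
  have [->|/eqP Xb] := eqVneq X b; first by left; right.
  by right.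
have half u v : `|u| + `|v| <= 2 * disp (avg1 e g) x y ->
    `|(u + v) / 2| <= disp (avg1 e g) x y.
  move=> h; rewrite normrM [`|2^-1|]gtr0_norm//.
  have := ler_normD u v; lra.
case: (boolP ((x a == y b) || (x b == y a))) => [cr|ncr].
- have -> : (f x + f (t * x)%g) / 2 - (f y + f (t * y)%g) / 2
    = ((f x - f (t * y)%g) + (f (t * x)%g - f y)) / 2 by field.
  apply: half; apply: le_trans (lerD (fg _ _) (fg _ _)) _.
  rewrite /disp -big_split mulr_sumr; apply: ler_sum => c _ /=; rewrite !tinv.
  have xX := permKV x c; have yY := permKV y c.
  set X := x^-1%g c in xX *; set Y := y^-1%g c in yY *.
  case: (inout X) => [Xin|[Xa Xb]]; case: (inout Y) => [Yin|[Ya Yb]].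
  + have XY : X <> Y.
      move=> XY; move: xX yY; rewrite XY => xX yY.
      case: Yin => Yab; rewrite Yab in xX yY; case/orP: cr => /eqP cr.
      * by move: cr; rewrite xX -yY => /perm_inj/(congr1 val)/=; lia.
      * by move: cr; rewrite yY -xX => /perm_inj/(congr1 val)/=; lia.
      * by move: cr; rewrite yY -xX => /perm_inj/(congr1 val)/=; lia.
      * by move: cr; rewrite xX -yY => /perm_inj/(congr1 val)/=; lia.
    rewrite !avg_in// subrr normr0 mulr0.
    by case: Xin => XE; case: Yin => YE; rewrite XE YE in XY *;
      rewrite /t ?tpermL ?tpermR ?subrr ?normr0 ?addr0.
  + rewrite avg_in// (avg_out Y)// (tout Y)//.
    by have := out1 X Y Xin Ya Yb; lra.
  + rewrite avg_out// (avg_in Y)// (tout X)//.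
    have := out1 Y X Yin Xa Xb; rewrite ![`|g X - _|]distrC; lra.
  + by rewrite !avg_out// !tout//; lra.
have -> : (f x + f (t * x)%g) / 2 - (f y + f (t * y)%g) / 2
    = ((f x - f y) + (f (t * x)%g - f (t * y)%g)) / 2 by field.
apply: half; apply: le_trans (lerD (fg _ _) (fg _ _)) _.
rewrite /disp -big_split mulr_sumr; apply: ler_sum => c _ /=; rewrite !tinv.
have xX := permKV x c; have yY := permKV y c.
set X := x^-1%g c in xX *; set Y := y^-1%g c in yY *.
case: (inout X) => [Xin|[Xa Xb]]; case: (inout Y) => [Yin|[Ya Yb]].
+ have XY : X = Y.
    case: Xin => XE; case: Yin => YE; rewrite XE YE // in xX yY *.
      by move: ncr; rewrite xX yY eqxx.
    by move: ncr; rewrite xX yY eqxx orbT.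
  by rewrite XY !subrr normr0 addr0 mulr0.
+ rewrite avg_in// (avg_out Y)// (tout Y)//.
  by have := out1 X Y Xin Ya Yb; lra.
+ rewrite avg_out// (avg_in Y)// (tout X)//.
  have := out1 Y X Yin Xa Xb; rewrite ![`|g X - _|]distrC; lra.
+ by rewrite !avg_out// !tout//; lra.
Qed.

Lemma sweep_coupling es f g : all (fun e => e.+1 < n)%N es -> nondecr g ->
  (forall x y, `|f x - f y| <= disp g x y) ->
  forall x y, `|sweep es f x - sweep es f y| <= disp (sweep1 es g) x y.
Proof.
move=> + gm fg; elim: es => //= e es IH /andP[en esn].
by apply: lazy_coupling => //; [exact: sweep1_mono|exact: IH].
Qed.

(** Both decks use the same direction; since [g] is monotone, its averages
    over the two directions do not cancel in the displacement. *)
Lemma round_coupling S f g : nondecr g ->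
  (forall x y, `|f x - f y| <= disp g x y) ->
  forall x y, `|round S n.-1 f x - round S n.-1 f y|
    <= disp (round1 n S n.-1 g) x y.
Proof.
move=> gm fg x y.
have h d := sweep_coupling (dir_edges_lt S d (leqnn _)) gm fg x y.
have -> : disp (round1 n S n.-1 g) x y
  = (disp (sweep1 (dir_edges n S true n.-1) g) x y
     + disp (sweep1 (dir_edges n S false n.-1) g) x y) / 2.
  rewrite /disp -big_split mulr_suml; apply: eq_bigr => c _ /=.
  set X := x^-1%g c; set Y := y^-1%g c; rewrite /round1.
  have k d := @sweep1_mono R (dir_edges n S d n.-1) g gm.
  have [XY|/ltnW XY] := leqP X Y.
    have h1 := k true _ _ XY; have h2 := k false _ _ XY.
    rewrite /= in h1 h2 *.
    by rewrite !ler0_norm; lra.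
  have h1 := k true _ _ XY; have h2 := k false _ _ XY.
  rewrite /= in h1 h2 *.
  by rewrite !ger0_norm; lra.
have := h true; have := h false; rewrite /round /=.
set A := sweep _ f x; set B := sweep _ f y.
set A' := sweep _ f x; set B' := sweep _ f y => h1 h2.
have -> : (A' + A) / 2 - (B' + B) / 2 = ((A' - B') + (A - B)) / 2 by field.
rewrite normrM [`|2^-1|]gtr0_norm//; have := ler_normD (A' - B') (A - B).
lra.
Qed.

(** Two different decks have displacement at least one, so the displacement
    dominates the oscillation of any bounded function. It evolves by the
    one-card dynamics. *)
Lemma iter_round_coupling r S f : (forall x, `|f x| <= 1) ->
  forall x y, `|iter r (round S n.-1) f x - iter r (round S n.-1) f y|
    <= 2 * disp (iter r (round1 n S n.-1) (fun i => i%:R)) x y.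
Proof.
move=> f1.
pose g0 (i : nat) : R := 2 * i%:R + 0.
have E x y : 2 * disp (iter r (round1 n S n.-1) (fun i => i%:R)) x y
    = disp (iter r (round1 n S n.-1) g0) x y.
  rewrite /g0 iter_round1_lin iter_round1_const /disp mulr_sumr.
  apply: eq_bigr => c _; rewrite !addr0 -mulrBr normrM.
  by rewrite [`|2|]gtr0_norm.
have g0m : nondecr g0.
  by move=> i j ij; rewrite /g0 lerD2r ler_wpM2l// ler_nat.
suff H x y : `|iter r (round S n.-1) f x - iter r (round S n.-1) f y|
    <= disp (iter r (round1 n S n.-1) g0) x y by move=> x y; rewrite E.
elim: r {E} x y => [|r IHr] x y /=.
  have [->|xy] := eqVneq x y.
    by rewrite subrr normr0 sumr_ge0.
  have [c xyc] : exists c, x^-1%g c != y^-1%g c.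
    apply/existsP; apply: contraNT xy => /existsPn h.
    apply/eqP/invg_inj/permP => c.
    by apply/eqP; have := h c; rewrite negbK.
  apply: le_trans (_ : 2 <= _).
    by have := ler_normB (f x) (f y); have := f1 x; have := f1 y; lra.
  rewrite /disp (bigD1 c) //= -[leLHS]addr0; apply: lerD; last exact: sumr_ge0.
  set X := x^-1%g c in xyc *; set Y := y^-1%g c in xyc *.
  have -> : g0 X - g0 Y = 2 * (X%:R - Y%:R) by rewrite /g0; ring.
  rewrite normrM [`|2|]gtr0_norm// ler_peMr//.
  have XY : (X != Y :> nat) by [].
  have [h|h] : (X < Y)%N \/ (Y < X)%N by lia.
    rewrite distrC ger0_norm ?subr_ge0 ?ler_nat 1?ltnW//.
    by rewrite -natrB 1?ltnW// ler1n subn_gt0.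
  rewrite ger0_norm ?subr_ge0 ?ler_nat 1?ltnW//.
  by rewrite -natrB 1?ltnW// ler1n subn_gt0.
apply: round_coupling => //.
by elim: r {IHr} => //= r; exact: round1_mono.
Qed.

End Coupling.

(** * Shuffling inside blocks *)

Section Blocks.
Variables (R : realType) (n m K : nat).
Implicit Types (f : 'S_n -> R) (x y h k : 'S_n).

(** [K] consecutive blocks of size [m], the last one absorbing the remainder. *)
Definition blk (p : nat) : nat := minn (p %/ m) K.-1.

Lemma blk_mono p q : (p <= q)%N -> (blk p <= blk q)%N.
Proof. by move=> pq; have := leq_div2r m pq; rewrite /blk; lia. Qed.

Lemma blk_mul p : (blk p * m <= p)%N.
Proof.
apply: leq_trans (leq_divM p m); rewrite leq_mul2r /blk geq_minl.
by rewrite orbT.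
Qed.

Definition inner_edge (e : nat) : bool := blk e == blk e.+1.

Definition block_perms : {set 'S_n} :=
  [set h : 'S_n | [forall p : 'I_n, blk (h p) == blk p]].

Lemma block_permsP h :
  reflect (forall p : 'I_n, blk (h p) = blk p) (h \in block_perms).
Proof.
by rewrite inE; apply: (iffP forallP) => H p; apply/eqP; rewrite H.
Qed.

Lemma block_perms1 : 1%g \in block_perms.
Proof. by apply/block_permsP => p; rewrite perm1. Qed.

Lemma block_permsM h k :
  h \in block_perms -> k \in block_perms -> (h * k)%g \in block_perms.
Proof.
move=> /block_permsP hB /block_permsP kB; apply/block_permsP => p.
by rewrite permM kB hB.
Qed.

Lemma block_permsV h : h \in block_perms -> h^-1%g \in block_perms.
Proof.
by move=> /block_permsP hB; apply/block_permsP => p; rewrite -hB permKV.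
Qed.

Lemma block_perms_tperm (p q : 'I_n) : blk p = blk q ->
  tperm p q \in block_perms.
Proof. by move=> pq; apply/block_permsP => r; case: tpermP => [->|->|]. Qed.

Lemma card_block_perms_gt0 : 0 < #|block_perms|%:R :> R.
Proof. by rewrite ltr0n; apply/card_gt0P; exists 1%g; exact: block_perms1. Qed.

Definition block_avg f : 'S_n -> R :=
  fun x => (\sum_(h in block_perms) f (h * x)%g) / #|block_perms|%:R.

Lemma sum_block_perms_mull (F : 'S_n -> R) k : k \in block_perms ->
  \sum_(h in block_perms) F (k * h)%g = \sum_(h in block_perms) F h.
Proof.
move=> kB; rewrite [RHS](reindex_inj (mulgI k)) /=; apply: eq_bigl => h.
apply/idP/idP => [|khB]; first exact: block_permsM.
by rewrite -(mulKg k h); apply: block_permsM => //; exact: block_permsV.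
Qed.

Lemma sum_block_perms_mulr (F : 'S_n -> R) k : k \in block_perms ->
  \sum_(h in block_perms) F (h * k)%g = \sum_(h in block_perms) F h.
Proof.
move=> kB; rewrite [RHS](reindex_inj (mulIg k)) /=; apply: eq_bigl => h.
apply/idP/idP => [hB|hkB]; first exact: block_permsM.
by rewrite -(mulgK k h); apply: block_permsM => //; exact: block_permsV.
Qed.

Lemma sum_block_permsV (F : 'S_n -> R) :
  \sum_(h in block_perms) F (h^-1)%g = \sum_(h in block_perms) F h.
Proof.
rewrite [RHS](reindex_inj (@invg_inj _)) /=; apply: eq_bigl => h.
apply/idP/idP; first exact: block_permsV.
by move/block_permsV; rewrite invgK.
Qed.

Lemma block_avg_invl f h x : h \in block_perms ->
  block_avg f (h * x)%g = block_avg f x.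
Proof.
move=> hB; rewrite /block_avg; congr (_ / _).
rewrite -(sum_block_perms_mulr (fun k => f (k * x)%g) hB).
by apply: eq_bigr => k _; rewrite mulgA.
Qed.

Lemma block_avg_id f : (forall h x, h \in block_perms -> f (h * x)%g = f x) ->
  block_avg f = f.
Proof.
move=> fi; apply/funext => x; rewrite /block_avg.
under eq_bigr => h hB do rewrite fi//.
by rewrite sumr_const -[X in X / _]mulr_natr mulfK// gt_eqF// card_block_perms_gt0.
Qed.

Lemma pairing_block_avg f p : pairing (block_avg p) f = pairing p (block_avg f).
Proof.
rewrite /pairing /block_avg.
transitivity ((\sum_(h in block_perms) \sum_x p (h * x)%g * f x) / #|block_perms|%:R).
  rewrite exchange_big mulr_suml; apply: eq_bigr => x _ /=.
  by rewrite -mulr_suml; ring.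
transitivity ((\sum_(h in block_perms) \sum_x p x * f (h * x)%g) / #|block_perms|%:R).
  congr (_ / _); rewrite -sum_block_permsV; apply: eq_bigr => h hB.
  rewrite (reindex_inj (mulgI h)); apply: eq_bigr => x _.
  by rewrite mulKg.
rewrite exchange_big mulr_suml; apply: eq_bigr => x _ /=.
by rewrite -mulr_sumr mulrA.
Qed.

Lemma inner_edge_tperm e : (e.+1 < n)%N -> inner_edge e ->
  adj_tperm n e \in block_perms.
Proof.
move=> en /eqP h; rewrite (adj_tpermE en); exact: block_perms_tperm.
Qed.

Lemma block_avg_sweep es f : all (fun e => e.+1 < n)%N es -> all inner_edge es ->
  block_avg (sweep es f) = block_avg f.
Proof.
elim: es => //= e es IH /andP[en esn] /andP[ei esi].
rewrite -(IH esn esi); apply/funext => x.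
set F := sweep es f; rewrite /block_avg; congr (_ / _).
rewrite /lazy_flip -mulr_suml big_split /=.
have -> : \sum_(h in block_perms) F (adj_tperm n e * (h * x))%g
   = \sum_(h in block_perms) F (h * x)%g.
  rewrite -(sum_block_perms_mull (fun h => F (h * x)%g) (inner_edge_tperm en ei)).
  by apply: eq_bigr => h _; rewrite mulgA.
by field.
Qed.

Lemma block_avg_round f : block_avg (round inner_edge n.-1 f) = block_avg f.
Proof.
have h d : block_avg (sweep (dir_edges n inner_edge d n.-1) f) = block_avg f.
  apply: block_avg_sweep; first exact: dir_edges_lt.
  by case: d; apply/allP => e; rewrite mem_filter => /andP[].
apply/funext => x.
transitivity ((block_avg (sweep (dir_edges n inner_edge true n.-1) f) x
  + block_avg (sweep (dir_edges n inner_edge false n.-1) f) x) / 2).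
  by rewrite /block_avg /round -mulr_suml big_split /=; ring.
by rewrite !h; field.
Qed.

Lemma block_avg_iter_round r f :
  block_avg (iter r (round inner_edge n.-1) f) = block_avg f.
Proof. by elim: r f => //= r IHr f; rewrite block_avg_round IHr. Qed.

Variable N : nat.
Hypothesis N4 : (4 <= N)%N.
Hypothesis blk_len : forall p, (p < n)%N -> (p - blk p * m < N)%N.

Let al : R := N%:R^-1.

Lemma cos1_ge : 2^-1 <= cos 1 :> R.
Proof. by have := cos_ge (1 : R); rewrite expr1n; lra. Qed.

Let Np : 0 < N%:R :> R. Proof. by rewrite ltr0n; lia. Qed.
Let al0 : 0 < al. Proof. by rewrite invr_gt0. Qed.
Let al4 : al <= 4^-1.
Proof. by rewrite lef_pV2 ?posrE// ler_nat. Qed.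

Lemma wave_rate_block : wave_rate al <= 1 - al ^+ 2 / 2.
Proof.
have al1 : al <= 1 by have := al4; lra.
apply: le_trans (wave_rate_le (ltW al0) al1) _.
have h : al ^+ 2 <= 16^-1.
  have -> : 16^-1 = (4^-1) ^+ 2 :> R by field.
  by rewrite lerXn2r ?nnegrE// ?(ltW al0).
have : 0 <= al ^+ 2 * (1 / 2 - 4 * al ^+ 2).
  by rewrite mulr_ge0 ?sqr_ge0//; lra.
lra.
Qed.

Lemma cos_al_ge0 : 0 <= cos al.
Proof.
have h := cos_ge al; have : al ^+ 2 <= 1 by rewrite expr_le1 ?(ltW al0)//; have := al4; lra.
lra.
Qed.

(** The contraction estimate is applied in every block with a wave that starts
    at the left end of that block. *)
Lemma block_grad r (x : nat) : inner_edge x -> (x < n.-1)%N ->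
  `|grad (iter r (round1 n inner_edge n.-1) (fun i => i%:R : R)) x|
  <= wave_rate al ^+ r * 2.
Proof.
move=> Sx xn.
have c1 := cos1_ge.
have p1 : 1 <= pi :> R by have := pi_ge2 R; lra.
pose ctr (x : nat) : R := (blk x * m)%:R.
have := @wave_contract_iter R n inner_edge ctr al 1 r (fun i => i%:R)
  al0 _ p1 cos_al_ge0 _ _ _ x Sx xn.
have al1 : al <= cos 1 by have := al4; lra.
move=> H; apply: le_trans (H _ _ _ _) _ => //.
- move=> y /eqP Sy yn; rewrite /ctr -natrB ?blk_mul// normrM !ger0_norm ?(ltW al0)//.
  have h : ((y - blk y * m).+1 <= N)%N.
    have yn' : (y.+1 < n)%N by lia.
    by have := blk_len yn'; rewrite -Sy; have := blk_mul y; lia.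
  have -> : al * (y - blk y * m)%:R + al = al * (y - blk y * m).+1%:R.
    by rewrite -[_.+1%:R]natr1; ring.
  by rewrite mulrC ler_pdivrMr// mul1r ler_nat.
- by move=> y /eqP Sy _ _; rewrite /ctr Sy.
- move=> y _ _; rewrite /grad -[y.+1%:R]natr1.
  have -> : y%:R + 1 - y%:R = 1 :> R by ring.
  by rewrite normr1.
rewrite ler_wpM2l ?exprn_ge0 ?wave_rate_ge0 ?cos_al_ge0//.
rewrite -[leRHS]invrK lef_pV2 ?posrE ?invr_gt0//; lra.
Qed.

Definition block_error r : R := 4 * n%:R * N%:R * wave_rate al ^+ r.

Lemma block_osc r f x h : (forall x, `|f x| <= 1) -> h \in block_perms ->
  `|iter r (round inner_edge n.-1) f x
    - iter r (round inner_edge n.-1) f (h * x)%g| <= block_error r.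
Proof.
move=> f1 hB; apply: le_trans (iter_round_coupling _ _ f1 _ _) _.
rewrite /disp.
set g := iter r _ _.
have bd (X Y : 'I_n) : blk X = blk Y -> `|g X - g Y| <= N%:R * (wave_rate al ^+ r * 2).
  wlog XY : X Y / (Y <= X)%N => [H|] bXY.
    by case: (leqP Y X) => [|/ltnW] h'; [exact: H|rewrite distrC; exact: H].
  apply: le_trans (grad_bound_dist (c := wave_rate al ^+ r * 2) inner_edge XY _) _.
    move=> z /andP[z1 z2]. apply: block_grad; last by have := ltn_ord X; lia.
    apply/eqP; have := blk_mono z1; have := blk_mono z2; have := blk_mono (leqnSn z).
    lia.
  rewrite ler_wpM2r ?mulr_ge0 ?exprn_ge0 ?wave_rate_ge0 ?cos_al_ge0//.
  rewrite ler_nat; have := blk_len (ltn_ord X); have := blk_mul Y; rewrite bXY.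
  by have := blk_mul X; lia.
apply: le_trans (_ : 2 * \sum_(c < n) (N%:R * (wave_rate al ^+ r * 2)) <= _).
  rewrite ler_wpM2l//; apply: ler_sum => c _; apply: bd.
  rewrite invMg permM.
  by move/block_permsV/block_permsP: hB => ->.
rewrite sumr_const card_ord -[_ *+ n]mulr_natl /block_error.
rewrite le_eqVlt; apply/orP; left; apply/eqP; ring.
Qed.

(** By duality with a function of absolute value at most one, whose
    oscillation inside a block is contracted. *)
Lemma block_mixing r f :
  \sum_x `|iter r (round inner_edge n.-1) f x - block_avg f x|
  <= block_error r * \sum_x `|f x|.
Proof.
set Mf := iter r _ f.
pose phi x : R := Num.sg (Mf x - block_avg f x).
have phi1 x : `|phi x| <= 1 by rewrite normr_sg; case: eqP.
have -> : \sum_x `|Mf x - block_avg f x|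
   = pairing f (iter r (round inner_edge n.-1) phi) - pairing f (block_avg phi).
  rewrite -pairing_iter_round -pairing_block_avg /pairing -sumrB.
  by apply: eq_bigr => x _; rewrite -mulrBl /phi mulrC -/Mf -normrEsg.
rewrite /pairing -sumrB mulr_sumr; apply: ler_sum => x _.
rewrite -mulrBr mulrC; apply: le_trans (ler_norm _) _.
rewrite normrM ler_wpM2r//.
rewrite -(block_avg_iter_round r phi) /block_avg.
set F := iter r _ phi; have cp := card_block_perms_gt0.
have -> : F x - (\sum_(h in block_perms) F (h * x)%g) / #|block_perms|%:R
  = (\sum_(h in block_perms) (F x - F (h * x)%g)) / #|block_perms|%:R.
  rewrite sumrB sumr_const -[_ *+ #|_|]mulr_natr.
  by field; rewrite gt_eqF.
rewrite normrM [`|_^-1|]gtr0_norm ?invr_gt0// ler_pdivrMr//.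
apply: le_trans (ler_norm_sum _ _ _) _.
apply: le_trans (_ : \sum_(h in block_perms) block_error r <= _).
  by apply: ler_sum => h hB; apply: block_osc.
by rewrite sumr_const -[leLHS]mulr_natr.
Qed.

Lemma geometric_small (q C d : R) : 0 <= q -> q < 1 -> 0 < d ->
  exists r, C * q ^+ r < d.
Proof.
move=> q0 q1 d0; have [q00|q00] := eqVneq q 0.
  by exists 1%N; rewrite q00 expr1 mulr0.
have qp : 0 < q by rewrite lt_neqAle eq_sym q00.
have i1 : 1 < q^-1 by rewrite invf_gt1.
pose k := Num.bound `|C / d / (q^-1 - 1)|.
exists k; have qk : 0 < q ^+ k by exact: exprn_gt0.
have kb : C / d / (q^-1 - 1) < k%:R.
  by apply: le_lt_trans (ler_norm _) (archi_boundP (normr_ge0 _)).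
have := bernoulli_le k (ltW i1); rewrite exprVn => h.
move: kb; rewrite ltr_pdivrMr ?subr_gt0// => kb.
have : C / d < (q ^+ k)^-1 by lra.
rewrite ltr_pdivrMr// mulrC => h'.
by rewrite -ltr_pdivlMr//.
Qed.

(** The exact shuffle of all blocks is a limit of rounds restricted to the
    inner edges, each of which preserves monotonicity. *)
Lemma block_avg_increasing f : increasing f -> increasing (block_avg f).
Proof.
move=> fI x y xy; rewrite leNgt; apply/negP => lt.
have q1 : wave_rate al < 1.
  apply: le_lt_trans wave_rate_block _.
  have : 0 < al ^+ 2 by rewrite exprn_gt0.
  lra.
have d0 : 0 < (block_avg f y - block_avg f x) / 2 by rewrite divr_gt0 ?subr_gt0.
have [r hr] := geometric_small (4 * n%:R * N%:R * \sum_x `|f x|)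
  (wave_rate_ge0 cos_al_ge0) q1 d0.
have hx z : `|iter r (round inner_edge n.-1) f z - block_avg f z|
    < (block_avg f y - block_avg f x) / 2.
  apply: le_lt_trans hr; rewrite mulrAC -/(block_error r).
  apply: le_trans (block_mixing r f).
  by rewrite (bigD1 z) //= lerDl sumr_ge0.
have := iter_round_increasing r inner_edge fI xy.
have := hx x; have := hx y; rewrite !ltr_norml => /andP[? ?] /andP[? ?]; lra.
Qed.

End Blocks.

(** * Flipping matched positions of two blocks *)

Section Flips.
Variables (n m K : nat).
Hypothesis m0 : (0 < m)%N.
Hypothesis mK : (m * K <= n)%N.
Notation blk := (blk m K).
Notation block_perms := (block_perms n m K).

Lemma pos_proof (I : 'I_K) (l : 'I_m) : (I * m + l < n)%N.
Proof.
have := ltn_ord I; have := ltn_ord l => lm IK.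
have : (I.+1 * m <= K * m)%N by rewrite leq_mul2r IK orbT.
rewrite mulSn; lia.
Qed.

Definition pos (I : 'I_K) (l : 'I_m) : 'I_n := Ordinal (pos_proof I l).

Lemma blk_pos I l : blk (pos I l) = I.
Proof.
rewrite /blk /= divnMDl// divn_small// addn0.
by have := ltn_ord I; lia.
Qed.

Lemma pos_inj2 I l J k : pos I l = pos J k -> I = J /\ l = k.
Proof.
move=> e; have IJ : I = J by apply: val_inj; rewrite /= -(blk_pos I l) e blk_pos.
split => //; apply: val_inj; move/(congr1 val): e; rewrite /= IJ; lia.
Qed.

Lemma pos_surj (I : 'I_K) (p : 'I_n) : (I.+1 < K)%N -> blk p = I ->
  exists l, p = pos I l.
Proof.
move=> IK; rewrite /blk => pI.
have pm : (p %/ m)%N = I by lia.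
have lm : (p %% m < m)%N by rewrite ltn_mod.
exists (Ordinal lm); apply: val_inj => /=.
by rewrite {1}(divn_eq p m) pm.
Qed.

Variables I J : 'I_K.

Definition flipf (S : {set 'I_m}) (p : 'I_n) : 'I_n :=
  if [pick l | p == pos I l] is Some l then if l \in S then pos J l else p
  else if [pick l | p == pos J l] is Some l then if l \in S then pos I l else p
  else p.

Lemma flipf1 S l : flipf S (pos I l) = if l \in S then pos J l else pos I l.
Proof.
rewrite /flipf; case: pickP => [k /eqP/pos_inj2[_ <-]//|/(_ l)].
by rewrite eqxx.
Qed.

Lemma flipf2 S l : flipf S (pos J l) = if l \in S then pos I l else pos J l.
Proof.
rewrite /flipf; case: pickP => [k /eqP/pos_inj2[-> <-]//|_].
case: pickP => [k /eqP/pos_inj2[_ <-]//|/(_ l)].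
by rewrite eqxx.
Qed.

Definition lane_free (p : 'I_n) := forall l, p <> pos I l /\ p <> pos J l.

Lemma flipf3 S p : lane_free p -> flipf S p = p.
Proof.
move=> np; rewrite /flipf; case: pickP => [k /eqP|_]; first by have [] := np k.
by case: pickP => [k /eqP|//]; have [] := np k.
Qed.

Lemma lane_case p : [\/ exists l, p = pos I l, exists l, p = pos J l | lane_free p].
Proof.
case: (pickP (fun l => p == pos I l)) => [l /eqP->|h1]; first by constructor 1; exists l.
case: (pickP (fun l => p == pos J l)) => [l /eqP->|h2]; first by constructor 2; exists l.
by constructor 3 => l; split => e; [have := h1 l|have := h2 l]; rewrite e eqxx.
Qed.

Lemma flipfK S : involutive (flipf S).
Proof.
move=> p; case: (lane_case p) => [[l ->]|[l ->]|h]; last by rewrite !flipf3.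
  by rewrite flipf1; case: ifP => lS; rewrite ?flipf1 ?flipf2 lS.
by rewrite flipf2; case: ifP => lS; rewrite ?flipf1 ?flipf2 lS.
Qed.

Definition flip (S : {set 'I_m}) : 'S_n := perm (inv_inj (flipfK S)).

Definition symdiff (S S' : {set 'I_m}) : {set 'I_m} :=
  [set l | (l \in S) (+) (l \in S')].

Lemma in_symdiff S S' l : (l \in symdiff S S') = (l \in S) (+) (l \in S').
Proof. by rewrite inE. Qed.

Lemma symdiffK S : involutive (symdiff S).
Proof. by move=> S'; apply/setP => l; rewrite !inE addbA addbb. Qed.

Lemma symdiffC S S' : symdiff S S' = symdiff S' S.
Proof. by apply/setP => l; rewrite !inE addbC. Qed.

Lemma flip1 S l : flip S (pos I l) = if l \in S then pos J l else pos I l.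
Proof. by rewrite permE flipf1. Qed.

Lemma flip2 S l : flip S (pos J l) = if l \in S then pos I l else pos J l.
Proof. by rewrite permE flipf2. Qed.

Lemma flip3 S p : lane_free p -> flip S p = p.
Proof. by move=> h; rewrite permE flipf3. Qed.

Lemma flipM S S' : (flip S * flip S')%g = flip (symdiff S S').
Proof.
apply/permP => p; rewrite permM.
case: (lane_case p) => [[l ->]|[l ->]|h]; last by rewrite !flip3.
  rewrite !flip1 inE; case: (l \in S); rewrite /= ?flip1 ?flip2;
  by case: (l \in S').
rewrite !flip2 inE; case: (l \in S); rewrite /= ?flip1 ?flip2;
by case: (l \in S').
Qed.

Lemma flip0 : flip finset.set0 = 1%g.
Proof.
apply/permP => p; rewrite perm1.
case: (lane_case p) => [[l ->]|[l ->]|h]; last by rewrite flip3.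
  by rewrite flip1 inE.
by rewrite flip2 inE.
Qed.

Lemma flipK S : (flip S * flip S)%g = 1%g.
Proof.
rewrite flipM -flip0; congr flip; apply/setP => l.
by rewrite !inE addbb.
Qed.

Lemma flipKl S x : (flip S * (flip S * x))%g = x.
Proof. by rewrite mulgA flipK mul1g. Qed.

Lemma flipV S : (flip S)^-1%g = flip S.
Proof. by apply: (mulgI (flip S)); rewrite mulgV flipK. Qed.

Lemma flip_set1 l : flip [set l]%SET = tperm (pos I l) (pos J l).
Proof.
apply/permP => p; case: (lane_case p) => [[k ->]|[k ->]|h].
- rewrite flip1 inE; have [->|kl] := eqVneq k l; first by rewrite tpermL.
  by rewrite tpermD// eq_sym; apply/eqP => /pos_inj2[_ e]; rewrite e eqxx in kl.
- rewrite flip2 inE; have [->|kl] := eqVneq k l; first by rewrite tpermR.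
  by rewrite tpermD// eq_sym; apply/eqP => /pos_inj2[_ e]; rewrite e eqxx in kl.
rewrite flip3// tpermD// eq_sym; apply/eqP.
  by have [] := h l.
by have [] := h l.
Qed.

End Flips.

Section Tperm.
Variables (n : nat).

Lemma mul_tperm_left (s : 'S_n) (p q : 'I_n) :
  (s * tperm p q = tperm (s^-1 p) (s^-1 q) * s)%g.
Proof. by rewrite -tpermJ conjgE invgK -!mulgA mulVg mulg1. Qed.

Variable R : realType.
Implicit Types f : 'S_n -> R.

Definition tlip (L : R) f :=
  forall x (p q : 'I_n), `|f x - f (tperm p q * x)%g| <= L.

(** [n] transpositions lead from one arrangement to any other. *)
Lemma tlip_osc (L : R) f x y : 0 <= L -> tlip L f -> `|f x - f y| <= n%:R * L.
Proof.
move=> L0 fL.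
suff H k : forall x : 'S_n, (#|[set p : 'I_n | x p != y p]| <= k)%N -> `|f x - f y| <= k%:R * L.
  apply: le_trans (H _ _ (leqnn _)) _; rewrite ler_wpM2r// ler_nat.
  by rewrite -[leqRHS]card_ord max_card.
elim: k => [|k IHk] {}x hk.
  have -> : x = y.
    apply/permP => p; move: hk; rewrite leqn0 cards_eq0 => /eqP/setP/(_ p).
    by rewrite !inE => /negbT; rewrite negbK => /eqP.
  by rewrite subrr normr0 mul0r.
have [x0|/finset.set0Pn[p]] := eqVneq [set p : 'I_n | x p != y p] finset.set0.
  apply: le_trans (IHk x _) _; first by rewrite x0 cards0.
  by rewrite ler_wpM2r// ler_nat.
rewrite inE => xyp.
pose q := (x^-1)%g (y p); pose x' := (tperm p q * x)%g.
have x'p : x' p = y p by rewrite /x' permM tpermL /q permKV.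
have -> : f x - f y = (f x - f x') + (f x' - f y) by ring.
apply: le_trans (ler_normD _ _) _; rewrite -[k.+1%:R]natr1 mulrDl mul1r addrC.
apply: lerD (fL _ _ _); apply: IHk.
rewrite -ltnS; apply: leq_trans hk; apply: proper_card; apply/properP; split.
  apply/fintype.subsetP => r; rewrite !inE => h.
  have [e|rp] := eqVneq r p; first by rewrite e.
  have [rq|rq] := eqVneq r q.
    rewrite rq /q permKV; apply/eqP => /perm_inj e.
    by move: rp; rewrite rq /q -e eqxx.
  by move: h; rewrite /x' permM tpermD 1?eq_sym.
by exists p; rewrite !inE ?x'p ?eqxx.
Qed.

End Tperm.

Lemma blk_lt m K (p : nat) : (0 < K)%N -> (blk m K p < K)%N.
Proof. by rewrite /blk; lia. Qed.

(** * Contraction by flips and block shuffles *)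

Section Matching.
Variables (R : realType) (n m K : nat).
Hypothesis m0 : (0 < m)%N.
Hypothesis mK : (m * K <= n)%N.
Implicit Types (f g p phi : 'S_n -> R) (x y : 'S_n).
Notation blk := (blk m K).
Notation block_perms := (block_perms n m K).
Notation block_avg := (block_avg (R := R) (n := n) m K).

Definition block_inv f := forall h x, h \in block_perms -> f (h * x)%g = f x.

Definition match_avg (I J : 'I_K) f : 'S_n -> R :=
  fun x => (\sum_(S : {set 'I_m}) f (flip m0 mK I J S * x)%g) / 2 ^+ m.

Lemma card_sets : #|{set 'I_m}|%:R = 2 ^+ m :> R.
Proof.
have -> : #|{set 'I_m}| = #|powerset [set: 'I_m]%SET|.
  by apply: eq_card => S; rewrite !inE finset.subsetT.
by rewrite card_powerset finset.cardsT card_ord natrX.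
Qed.

Let two_m : 0 < 2 ^+ m :> R. Proof. by rewrite exprn_gt0. Qed.

Lemma avg_norm_le (T : finType) (A : pred T) (F : T -> R) (c L : R) :
  0 < c -> #|A|%:R = c ->
  (forall t, A t -> `|F t| <= L) -> `|(\sum_(t | A t) F t) / c| <= L.
Proof.
move=> c0 Ac FL; rewrite normrM [`|c^-1|]gtr0_norm ?invr_gt0// ler_pdivrMr//.
apply: le_trans (ler_norm_sum _ _ _) _.
apply: le_trans (ler_sum _ FL) _.
by rewrite sumr_const -Ac -[leLHS]mulr_natr.
Qed.

Lemma tlip_shift L f s x (p q : 'I_n) : tlip L f ->
  `|f (s * x)%g - f (s * (tperm p q * x))%g| <= L.
Proof. by move=> fL; rewrite mulgA mul_tperm_left -mulgA; apply: fL. Qed.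

Lemma match_avg_tlip (I J : 'I_K) L f : tlip L f ->
  tlip L (match_avg I J f).
Proof.
move=> fL x p q; rewrite /match_avg -mulrBl -sumrB.
apply: avg_norm_le => //; first exact: card_sets.
by move=> S _; apply: tlip_shift.
Qed.

Lemma block_avg_tlip L f : tlip L f -> tlip L (block_avg f).
Proof.
move=> fL x p q; rewrite /block_avg -mulrBl -sumrB.
apply: avg_norm_le => //; first exact: card_block_perms_gt0.
by move=> S _; apply: tlip_shift.
Qed.

(** When two decks differ by exchanging a card of block [I] with a card of
    block [J], half of the coins make both of these cards end in the same
    block, where the exchange is invisible. *)
Lemma match_avg_contract (I J : 'I_K) (IJ : (I < J)%N) L f x (p q : 'I_n) :
  tlip L f -> block_inv f -> blk p = I -> blk q = J ->
  `|match_avg I J f x - match_avg I J f (tperm p q * x)%g| <= L / 2.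
Proof.
move=> fL fi pI qJ.
have IK : (I.+1 < K)%N by have := ltn_ord J; lia.
have [l pl] := pos_surj m0 mK IK pI.
set F := flip m0 mK I J.
pose D S := f (F S * x)%g - f (F S * (tperm p q * x))%g.
have DE S : D S = f (F S * x)%g - f (tperm (F S p) (F S q) * (F S * x))%g.
  by rewrite /D (mulgA (F S)) mul_tperm_left flipV -mulgA.
have D0 S : blk (F S p) = blk (F S q) -> D S = 0.
  by move=> e; rewrite DE (fi (tperm _ _)) ?subrr//; apply: block_perms_tperm.
have DL S : `|D S| <= L by rewrite DE; apply: fL.
have L0 : 0 <= L := le_trans (normr_ge0 _) (DL finset.set0).
have tog S : F (symdiff S [set l]) = (F S * tperm p (pos m0 mK J l))%g.
  by rewrite /F -flipM flip_set1 pl.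
have D2 S : `|D S + D (symdiff S [set l])| <= L.
  have [ql|ql] := eqVneq q (pos m0 mK J l).
    have e2 : (F S * tperm p q * (tperm p q * x))%g = (F S * x)%g.
      by rewrite -mulgA (mulgA (tperm p q)) tperm2 mul1g.
    rewrite {2}/D tog -ql e2 /D mulgA addrC -opprB.
    by rewrite addNr normr0.
  have lm : l \in symdiff S [set l] = ~~ (l \in S) by rewrite !inE eqxx addbT.
  have qb S' : blk (F S' q) = I \/ blk (F S' q) = J.
    case: (lane_case m0 mK I J q) => [[k e]|[k e]|h].
    - by move: qJ; rewrite e blk_pos// => e'; move: IJ; rewrite e' ltnn.
    - by rewrite e /F flip2; case: ifP => _; rewrite blk_pos//; [left|right].
    - by rewrite /F flip3//; right.
  have qs : F (symdiff S [set l]) q = F S q.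
    rewrite tog permM; case: (lane_case m0 mK I J q) => [[k e]|[k e]|h].
    - by move: qJ; rewrite e blk_pos// => e'; move: IJ; rewrite e' ltnn.
    - have kl : k != l by apply: contraNneq ql => <-; rewrite e.
      rewrite e /F flip2 pl; case: ifP => _; rewrite tpermD//.
      + by apply/eqP => /pos_inj2[] // _ e'; rewrite e' eqxx in kl.
      + by apply/eqP => /pos_inj2[] // e'; move: IJ; rewrite e' ltnn.
      + by apply/eqP => /pos_inj2[] // e'; move: IJ; rewrite e' ltnn.
      + by apply/eqP => /pos_inj2[] // _ e'; rewrite e' eqxx in kl.
    - rewrite /F flip3// pl tpermD// eq_sym; apply/eqP.
        by have [] := h l.
      by have [] := h l.
  have pb S' : blk (F S' p) = if l \in S' then J : nat else I.
    by rewrite pl /F flip1; case: ifP => _; rewrite blk_pos.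
  case: (qb S) => qbS; case lS : (l \in S).
  - by rewrite (D0 (symdiff S [set l])) ?addr0// qs qbS pb lm lS.
  - by rewrite (D0 S) ?add0r// qbS pb lS.
  - by rewrite (D0 S) ?add0r// qbS pb lS.
  - by rewrite (D0 (symdiff S [set l])) ?addr0// qs qbS pb lm lS.
have -> : match_avg I J f x - match_avg I J f (tperm p q * x)%g
   = (\sum_S (D S + D (symdiff S [set l]))) / 2 ^+ m / 2.
  have e : \sum_S D (symdiff S [set l]) = \sum_S D S.
    rewrite [RHS](reindex_inj (inv_inj (symdiffK [set l]))).
    by apply: eq_bigr => S _; rewrite symdiffC.
  by rewrite big_split /= e /match_avg -mulrBl -sumrB /D -/F; field; rewrite gt_eqF.
rewrite normrM [`|2^-1|]gtr0_norm// ler_wpM2r//.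
by apply: avg_norm_le => //; exact: card_sets.
Qed.

Definition shuffle_blocks f : 'S_n -> R :=
  fun x => (\sum_(IJ : 'I_K * 'I_K) block_avg (match_avg IJ.1 IJ.2 f) x) / K%:R ^+ 2.

Lemma card_pairs : #|{: 'I_K * 'I_K}|%:R = K%:R ^+ 2 :> R.
Proof. by rewrite card_prod card_ord natrM expr2. Qed.

Hypothesis K0 : (0 < K)%N.
Let K2 : 0 < K%:R ^+ 2 :> R. Proof. by rewrite exprn_gt0// ltr0n. Qed.

Lemma shuffle_blocks_inv f : block_inv (shuffle_blocks f).
Proof.
move=> h x hB; rewrite /shuffle_blocks; congr (_ / _).
by apply: eq_bigr => IJ _; apply: block_avg_invl.
Qed.

Lemma shuffle_blocks_contract L f : tlip L f -> block_inv f ->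
  tlip (L * (1 - (2 * K%:R ^+ 2)^-1)) (shuffle_blocks f).
Proof.
move=> fL fi x p q.
have L0 : 0 <= L := le_trans (normr_ge0 _) (fL x p q).
have K1 : 1 <= K%:R ^+ 2 :> R by rewrite -natrX ler1n expn_gt0 K0.
have L1 : 0 <= L * (1 - (2 * K%:R ^+ 2)^-1).
  rewrite mulr_ge0// subr_ge0 invf_le1; last by rewrite mulr_gt0.
  lra.
wlog bpq : p q / (blk p <= blk q)%N => [H|].
  case: (leqP (blk p) (blk q)) => [|/ltnW]; first exact: H.
  by rewrite tpermC; apply: H.
have [e|pq] := eqVneq (blk p) (blk q).
  by rewrite shuffle_blocks_inv ?subrr ?normr0//; exact: block_perms_tperm.
pose I := Ordinal (blk_lt m p K0); pose J := Ordinal (blk_lt m q K0).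
have IJ : (I < J)%N by rewrite /= ltn_neqAle pq.
pose F (P : 'I_K * 'I_K) := block_avg (match_avg P.1 P.2 f) x
   - block_avg (match_avg P.1 P.2 f) (tperm p q * x)%g.
have FL P : `|F P| <= L by apply: block_avg_tlip; apply: match_avg_tlip.
have F2 : `|F (I, J)| <= L / 2.
  rewrite /F /block_avg -mulrBl -sumrB /=.
  apply: avg_norm_le; [exact: card_block_perms_gt0|by []|].
  move=> h hB; rewrite mulgA mul_tperm_left -mulgA.
  move/block_permsV/block_permsP: (hB) => hV.
  by apply: match_avg_contract => //; rewrite hV.
have -> : shuffle_blocks f x - shuffle_blocks f (tperm p q * x)%g
    = (\sum_P F P) / K%:R ^+ 2.
  by rewrite /shuffle_blocks -mulrBl -sumrB.
rewrite normrM [`|_^-1|]gtr0_norm ?invr_gt0// ler_pdivrMr//.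
apply: le_trans (ler_norm_sum _ _ _) _.
rewrite (bigD1 (I, J)) //=.
have -> : L * (1 - (2 * K%:R ^+ 2)^-1) * K%:R ^+ 2 = L / 2 + (K%:R ^+ 2 - 1) * L.
  by field; rewrite gt_eqF// ltr0n.
apply: lerD => //.
apply: le_trans (ler_sum _ (fun P _ => FL P)) _.
rewrite sumr_const -[leLHS]mulr_natl ler_wpM2r//.
have e : #|predC1 (I, J)| = (K * K).-1 by rewrite cardC1 card_prod card_ord.
rewrite (_ : #|_|%:R = K%:R ^+ 2 - 1)// -natrX -mulnn -[X in _ - X]/(1%:R) -natrB ?muln_gt0 ?K0//.
by rewrite subn1 -e; congr _%:R; apply: eq_card.
Qed.

End Matching.

Section Equilibrate.
Variables (R : realType) (n m K : nat).
Hypothesis m0 : (0 < m)%N.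
Hypothesis mK : (m * K <= n)%N.
Hypothesis K0 : (0 < K)%N.
Implicit Types (f g p phi : 'S_n -> R) (x y : 'S_n).
Notation block_perms := (block_perms n m K).
Notation block_avg := (block_avg (R := R) (n := n) m K).
Notation block_inv := (block_inv (R := R) (n := n) m K).
Notation match_avg := (match_avg (R := R) m0 mK).
Notation T := (shuffle_blocks (R := R) m0 mK).

Lemma l1_avg (I : finType) (A : pred I) (s : I -> 'S_n) (c : R) f :
  0 < c -> #|A|%:R = c ->
  \sum_x `|(\sum_(t | A t) f (s t * x)%g) / c| <= \sum_x `|f x|.
Proof.
move=> c0 Ac.
have h x : `|(\sum_(t | A t) f (s t * x)%g) / c|
    <= (\sum_(t | A t) `|f (s t * x)%g|) / c.
  rewrite normrM [`|c^-1|]gtr0_norm ?invr_gt0// ler_wpM2r ?invr_ge0 ?(ltW c0)//.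
  exact: ler_norm_sum.
apply: le_trans (ler_sum _ (fun x _ => h x)) _.
rewrite -mulr_suml exchange_big /= ler_pdivrMr//.
have e t : \sum_x `|f (s t * x)%g| = \sum_x `|f x|.
  by rewrite [RHS](reindex_inj (mulgI (s t))).
under eq_bigr do rewrite e.
by rewrite sumr_const -Ac -[leLHS]mulr_natr.
Qed.

Lemma match_avg_l1 I J f : \sum_x `|match_avg I J f x| <= \sum_x `|f x|.
Proof. by apply: l1_avg; [rewrite exprn_gt0|exact: card_sets]. Qed.

Lemma block_avg_l1 f : \sum_x `|block_avg f x| <= \sum_x `|f x|.
Proof. by apply: l1_avg; [exact: card_block_perms_gt0|]. Qed.

Lemma match_avgB I J f g x :
  match_avg I J (fun y => f y - g y) x = match_avg I J f x - match_avg I J g x.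
Proof. by rewrite /match_avg sumrB mulrBl. Qed.

Lemma block_avgB f g x :
  block_avg (fun y => f y - g y) x = block_avg f x - block_avg g x.
Proof. by rewrite /block_avg sumrB mulrBl. Qed.

Let K2 : 0 < K%:R ^+ 2 :> R. Proof. by rewrite exprn_gt0// ltr0n. Qed.

Lemma shuffle_blocksB f g x :
  T (fun y => f y - g y) x = T f x - T g x.
Proof.
rewrite /shuffle_blocks -mulrBl -sumrB; congr (_ / _); apply: eq_bigr => P _.
rewrite -block_avgB; congr (block_avg _ x); apply/funext => y.
exact: match_avgB.
Qed.

Lemma sum_pairs_l1 (F : 'I_K * 'I_K -> 'S_n -> R) (d : R) :
  (forall P, \sum_x `|F P x| <= d) ->
  \sum_x `|(\sum_P F P x) / K%:R ^+ 2| <= d.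
Proof.
move=> Fd.
have h x : `|(\sum_P F P x) / K%:R ^+ 2| <= (\sum_P `|F P x|) / K%:R ^+ 2.
  rewrite normrM [`|_^-1|]gtr0_norm ?invr_gt0// ler_wpM2r ?invr_ge0 ?(ltW K2)//.
  exact: ler_norm_sum.
apply: le_trans (ler_sum _ (fun x _ => h x)) _.
rewrite -mulr_suml exchange_big /= ler_pdivrMr//.
apply: le_trans (ler_sum _ (fun P _ => Fd P)) _.
by rewrite sumr_const -card_pairs -[leLHS]mulr_natr.
Qed.

Lemma shuffle_blocks_l1 f : \sum_x `|T f x| <= \sum_x `|f x|.
Proof.
apply: (@sum_pairs_l1 (fun P => block_avg (match_avg P.1 P.2 f))) => P.
by apply: le_trans (block_avg_l1 _) (match_avg_l1 _ _ _).
Qed.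

Lemma pairing_match_avg I J p f :
  pairing (match_avg I J p) f = pairing p (match_avg I J f).
Proof.
rewrite /pairing /match_avg.
transitivity ((\sum_S \sum_x p (flip m0 mK I J S * x)%g * f x) / 2 ^+ m).
  rewrite exchange_big mulr_suml; apply: eq_bigr => x _ /=.
  by rewrite -mulr_suml; ring.
transitivity ((\sum_S \sum_x p x * f (flip m0 mK I J S * x)%g) / 2 ^+ m).
  congr (_ / _); apply: eq_bigr => S _.
  rewrite (reindex_inj (mulgI (flip m0 mK I J S))); apply: eq_bigr => x _.
  by rewrite flipKl.
rewrite exchange_big mulr_suml; apply: eq_bigr => x _ /=.
by rewrite -mulr_sumr mulrA.
Qed.

Lemma pairing_suml (F : 'I_K * 'I_K -> 'S_n -> R) f :
  pairing (fun x => (\sum_P F P x) / K%:R ^+ 2) f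
  = (\sum_P pairing (F P) f) / K%:R ^+ 2.
Proof.
rewrite /pairing exchange_big mulr_suml; apply: eq_bigr => x _ /=.
by rewrite -mulr_suml; ring.
Qed.

Lemma pairing_shuffle_blocks p f : block_inv p -> block_inv f ->
  pairing (T p) f = pairing p (T f).
Proof.
move=> pI fI; rewrite /shuffle_blocks pairing_suml [RHS]pairingC pairing_suml.
congr (_ / _); apply: eq_bigr => P _.
rewrite pairing_block_avg (block_avg_id fI) pairing_match_avg.
by rewrite pairing_block_avg (block_avg_id pI) pairingC.
Qed.

Lemma iter_shuffle_inv N f : block_inv f -> block_inv (iter N T f).
Proof. by case: N => //= N _; apply: shuffle_blocks_inv. Qed.

Lemma pairing_iter_shuffle N p f : block_inv p -> block_inv f ->
  pairing (iter N T p) f = pairing p (iter N T f).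
Proof.
move=> pI; elim: N f => //= N IHN f fI.
rewrite pairing_shuffle_blocks//; last exact: iter_shuffle_inv.
rewrite IHN -?iterSr//; exact: shuffle_blocks_inv.
Qed.

Lemma iter_shuffle_tlip N (L : R) f : tlip L f -> block_inv f ->
  tlip (L * (1 - (2 * K%:R ^+ 2)^-1) ^+ N) (iter N T f).
Proof.
move=> fL fI; elim: N => [|N IHN]; first by rewrite mulr1.
rewrite exprSr mulrA; apply: shuffle_blocks_contract => //.
exact: iter_shuffle_inv.
Qed.

(** A density close to all its matched averages is close to uniform: few rounds
    of the block shuffle contract every test function, while they barely change
    the density. *)
Lemma near_uniform p (u d : R) N : block_inv p ->
  \sum_x (p x - u) = 0 -> \sum_x `|p x - u| <= 2 ->
  (forall I J, \sum_x `|p x - match_avg I J p x| <= d) ->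
  \sum_x `|p x - u| <= N%:R * d + 4 * n%:R * (1 - (2 * K%:R ^+ 2)^-1) ^+ N.
Proof.
move=> pI p0 p2 pd.
have step : \sum_x `|p x - T p x| <= d.
  have -> : \sum_x `|p x - T p x| = \sum_x `|(\sum_(P : 'I_K * 'I_K)
      block_avg (fun y => p y - match_avg P.1 P.2 p y) x) / K%:R ^+ 2|.
    apply: eq_bigr => x _; congr `|_|.
    under [in RHS]eq_bigr do rewrite block_avgB (block_avg_id pI).
    rewrite sumrB mulrBl sumr_const -[X in X / _ - _]mulr_natr card_pairs.
    by rewrite mulfK ?gt_eqF.
  apply: sum_pairs_l1 => P; apply: le_trans (block_avg_l1 _) _; exact: pd.
have drift k : \sum_x `|p x - iter k T p x| <= k%:R * d.
  elim: k => [|k IHk].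
    by rewrite mul0r big1// => x _; rewrite subrr normr0.
  apply: le_trans (_ : \sum_x `|p x - T p x|
     + \sum_x `|T (fun y => p y - iter k T p y) x| <= _).
    rewrite -big_split; apply: ler_sum => x _ /=; rewrite shuffle_blocksB.
    have -> : p x - T (iter k T p) x = (p x - T p x) + (T p x - T (iter k T p) x).
      by ring.
    exact: ler_normD.
  rewrite -[k.+1%:R]natr1 mulrDl mul1r addrC; apply: lerD => //.
  by apply: le_trans (shuffle_blocks_l1 _) IHk.
pose q := iter N T p.
have qI : block_inv q by apply: iter_shuffle_inv.
pose phi x : R := Num.sg (q x - u).
have phiI : block_inv phi by move=> h x hB; rewrite /phi qI.
have phi1 x : `|phi x| <= 1 by rewrite normr_sg; case: eqP.
have phiL : tlip 2 phi.
  move=> x a b; have := ler_normB (phi x) (phi (tperm a b * x)%g).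
  have := phi1 x; have := phi1 (tperm a b * x)%g; lra.
pose psi := iter N T phi.
have psiL := iter_shuffle_tlip N phiL phiI.
have psi0 : 0 <= 2 * (1 - (2 * K%:R ^+ 2)^-1) ^+ N :> R.
  have K2' : 0 < 2 * K%:R ^+ 2 :> R by rewrite pmulr_rgt0.
  rewrite mulr_ge0// exprn_ge0// subr_ge0 invf_le1//.
  have : 1 <= K%:R ^+ 2 :> R by rewrite -natrX ler1n expn_gt0 K0.
  lra.
have Tc : iter N T (fun=> 1) = fun=> 1.
  elim: (N) => //= k ->; apply/funext => x; rewrite /shuffle_blocks.
  rewrite (eq_bigr (fun=> 1)) => [|P _].
    by rewrite sumr_const card_pairs mulfV ?gt_eqF.
  have -> : match_avg P.1 P.2 (fun=> 1) = fun=> 1.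
    apply/funext => y; rewrite /match_avg sumr_const card_sets.
    by rewrite mulfV// gt_eqF// exprn_gt0.
  by rewrite /block_avg sumr_const mulfV// gt_eqF// card_block_perms_gt0.
have qu : \sum_x `|q x - u| <= 2 * (n%:R * (2 * (1 - (2 * K%:R ^+ 2)^-1) ^+ N)).
  have -> : \sum_x `|q x - u| = pairing q phi - u * pairing (fun=> 1) phi.
    rewrite /pairing mulr_sumr -sumrB; apply: eq_bigr => x _.
    by rewrite mul1r -mulrBl /phi mulrC -normrEsg.
  rewrite /q pairing_iter_shuffle// -Tc pairing_iter_shuffle//.
  have -> : pairing p (iter N T phi) - u * pairing (fun=> 1) (iter N T phi)
     = \sum_x (p x - u) * (psi x - psi 1%g).
    under [in RHS]eq_bigr do rewrite mulrBr.
    rewrite sumrB -mulr_suml p0 mul0r subr0 /pairing mulr_sumr -sumrB.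
    by apply: eq_bigr => x _; rewrite mul1r -mulrBl.
  apply: le_trans (_ : \sum_x `|p x - u|
     * (n%:R * (2 * (1 - (2 * K%:R ^+ 2)^-1) ^+ N)) <= _).
    apply: ler_sum => x _; apply: le_trans (ler_norm _) _.
    by rewrite normrM ler_wpM2l//; exact: (tlip_osc _ _ psi0 psiL).
  by rewrite -mulr_suml ler_wpM2r// mulr_ge0.
apply: le_trans (_ : \sum_x `|p x - q x| + \sum_x `|q x - u| <= _).
  rewrite -big_split; apply: ler_sum => x _ /=.
  have -> : p x - u = (p x - q x) + (q x - u) by ring.
  exact: ler_normD.
have := drift N; rewrite -/q; lra.
Qed.

End Equilibrate.

(** * An isoperimetric inequality for the binomial distribution *)

Section Binomial.
Variable R : realType.

Let b (d k : nat) : R := 'C(d, k)%:R.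

(** The flow [(d - j) C(d, j)] out of level [j] upwards equals the flow
    downwards out of the next level, so the sum of their differences
    telescopes. *)
Lemma binomial_drift d k :
  \sum_(0 <= j < k.+1) b d j * (d%:R - 2 * j%:R) = (d%:R - k%:R) * b d k.
Proof.
elim: k => [|k IHk]; first by rewrite big_nat1 mulr0 !subr0 mulrC.
rewrite big_nat_recr //= IHk.
have e : (d%:R - k%:R) * b d k = k.+1%:R * b d k.+1.
  have [kd|dk] := leqP k d.
    by rewrite /b -natrB// -!natrM mul_bin_left.
  by rewrite /b !bin_small// ?mulr0//; lia.
by rewrite e -[k.+1%:R]natr1; ring.
Qed.

Lemma sum_binomials d : \sum_(0 <= j < d.+1) b d j = 2 ^+ d.
Proof.
rewrite big_mkord -natrX -[2%N]/(1 + 1)%N expnDn natr_sum.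
by apply: eq_bigr => i _; rewrite !exp1n !muln1.
Qed.

(** Induction on the ratio of consecutive central coefficients. *)
Lemma central_binomial q : (0 < q)%N -> (16 ^ q <= 4 * q * 'C(q.*2, q) ^ 2)%N.
Proof.
case: q => // q _; elim: q => // q IHq.
have e : (q.+2 * 'C(q.+2.*2, q.+2) = 2 * (q.+1.*2).+1 * 'C(q.+1.*2, q.+1))%N.
  have h1 := mul_bin_down (q.+1.*2).+1 q.+1.
  have h2 := mul_bin_diag (q.+1.*2).+2 q.+1.
  have s1 : ((q.+1.*2).+1 - q.+1 = q.+2)%N by lia.
  rewrite /= s1 in h1; rewrite /= in h2.
  rewrite [in LHS]doubleS -h2 -mulnA h1 mulnA.
  by rewrite (_ : (q.+1.*2).+2 = 2 * q.+2)%N ?mulnA//; lia.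
set x := 'C(_, _) in IHq; rewrite -/x in e; set y := 'C(_, _) in e *.
have : (q.+2 ^ 2 * 16 ^ q.+2 <= q.+2 ^ 2 * (4 * q.+2 * y ^ 2))%N.
  have -> : (q.+2 ^ 2 * (4 * q.+2 * y ^ 2) = 4 * q.+2 * (q.+2 * y) ^ 2)%N by nia.
  rewrite e expnS.
  have -> : (4 * q.+2 * (2 * q.+1.*2.+1 * x) ^ 2
     = 16 * q.+2 * q.+1.*2.+1 ^ 2 * x ^ 2)%N by nia.
  apply: leq_trans (_ : q.+2 ^ 2 * (16 * (4 * q.+1 * x ^ 2)) <= _)%N.
    by rewrite !leq_mul2l IHq !orbT.
  have h : (4 * q.+1 * q.+2 <= q.+1.*2.+1 ^ 2)%N by lia.
  have -> : (q.+2 ^ 2 * (16 * (4 * q.+1 * x ^ 2))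
     = 16 * q.+2 * (4 * q.+1 * q.+2) * x ^ 2)%N by nia.
  by rewrite leq_mul2r leq_mul2l h !orbT.
by rewrite leq_pmul2l// expn_gt0.
Qed.

End Binomial.

Section BinomialL1.
Variable R : realType.

Let b (d k : nat) : R := 'C(d, k)%:R.
Let w (d k : nat) : R := (d%:R - k%:R) * b d k.

Let b_ge0 d k : 0 <= b d k. Proof. by rewrite ler0n. Qed.

Lemma central_drift d : (0 < d)%N ->
  Num.sqrt d%:R * 2 ^+ d / 4 <= w d d./2.
Proof.
move=> d0; have w0 : 0 <= w d d./2.
  by rewrite mulr_ge0// subr_ge0 ler_nat; lia.
have l0 : 0 <= Num.sqrt d%:R * 2 ^+ d / 4 :> R.
  by rewrite divr_ge0// mulr_ge0 ?sqrtr_ge0// exprn_ge0.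
rewrite -ler_sqr ?nnegrE//.
rewrite expr_div_n exprMn sqr_sqrtr// -exprM mulnC exprM.
have -> : 2 ^+ 2 = 4 :> R by ring.
have -> : 4 ^+ 2 = 16 :> R by ring.
have [q dq] : exists q, d = (q.*2)%N \/ d = (q.*2).+1.
  by exists d./2; have := odd_double_half d; case: (odd d) => /=; lia.
have e16 : (4 : R) ^+ q.*2 = 16 ^+ q.
  by rewrite -mul2n exprM; congr (_ ^+ _); ring.
have cb : (0 < q)%N -> (16 : R) ^+ q <= 4 * q%:R * b q.*2 q ^+ 2.
  by move=> q0; have := central_binomial q0; rewrite -(ler_nat R) !natrM !natrX.
case: dq => dq.
  have q0 : (0 < q)%N by lia.
  have dh : d./2 = q by rewrite dq doubleK.
  rewrite /w dh dq e16.
  have -> : (q.*2)%:R = 2 * q%:R :> R by rewrite -mul2n natrM.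
  have h := cb q0; set c := b _ _ in h *.
  have -> : ((2 * q%:R - q%:R) * c) ^+ 2 = q%:R * (q%:R * c ^+ 2) by ring.
  have -> : 2 * q%:R * 16 ^+ q / 16 = q%:R * (16 ^+ q / 8) :> R by field.
  rewrite ler_wpM2l//.
  have : 0 <= (16 : R) ^+ q by rewrite exprn_ge0.
  lra.
have dh : d./2 = q by rewrite dq /= uphalf_double.
have wE : w d d./2 = (2 * q%:R + 1) * b q.*2 q.
  have := mul_bin_down q.*2.+1 q; rewrite /= => /(congr1 (fun k => k%:R : R)).
  rewrite !natrM natrB; last by lia.
  rewrite /w dh dq /b => <-.
  by rewrite -[(q.*2.+1)%:R]natr1 -mul2n natrM.
rewrite wE dq exprS e16.
have -> : (q.*2.+1)%:R = 2 * q%:R + 1 :> R.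
  by rewrite -[(q.*2.+1)%:R]natr1 -mul2n natrM.
set c := b _ _; have x0 := ler0n R q.
have h : (16 : R) ^+ q / 4 <= (2 * q%:R + 1) * c ^+ 2.
  case: (posnP q) => [q0|q0].
    by rewrite /c /b q0 /= bin0 expr0 mulr0 add0r expr1n; lra.
  have := cb q0; rewrite -/c; have := sqr_ge0 c; nra.
have -> : ((2 * q%:R + 1) * c) ^+ 2 = (2 * q%:R + 1) * ((2 * q%:R + 1) * c ^+ 2).
  by ring.
have -> : (2 * q%:R + 1) * (4 * 16 ^+ q) / 16 = (2 * q%:R + 1) * (16 ^+ q / 4) :> R.
  by field.
by rewrite ler_wpM2l//; lra.
Qed.

Let P d k : R := \sum_(0 <= j < k.+1) b d j.

(** The drift [d - 2 * j] decreases with [j], so its mean over the first terms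
    is at least its mean over the whole lower half. *)
Lemma lower_tail d k : (0 < d)%N -> (k.*2 <= d)%N ->
  Num.sqrt d%:R * P d k <= 8 * w d k.
Proof.
move=> d0 kd; set s := Num.sqrt _.
have s0 : 0 <= s by apply: sqrtr_ge0.
have wE j : w d j = \sum_(0 <= i < j.+1) b d i * (d%:R - 2 * i%:R).
  by rewrite binomial_drift.
have P0 : 0 <= P d k by apply: sumr_ge0.
have k2 : 2 * k%:R <= d%:R :> R by rewrite -natrM ler_nat mul2n.
have [far|near] := leP (s / 8) (d%:R - 2 * k%:R).
  have : (d%:R - 2 * k%:R) * P d k <= w d k.
    rewrite wE /P mulr_sumr; apply: ler_sum_nat => i /andP[_ ik].
    rewrite mulrC ler_wpM2l// lerD2l lerN2 ler_wpM2l// ler_nat; lia.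
  have : s / 8 * P d k <= (d%:R - 2 * k%:R) * P d k by rewrite ler_wpM2r.
  lra.
have top := central_drift d0; rewrite -/s in top.
have Pd : P d k <= 2 ^+ d.
  rewrite -(sum_binomials R d) /P (@big_cat_nat _ _ _ k.+1 0 d.+1)//=; last by lia.
  by rewrite lerDl sumr_ge0.
have diff : w d d./2 - w d k <= s / 8 * 2 ^+ d.
  rewrite !wE (@big_cat_nat _ _ _ k.+1 0 d./2.+1)//=; last by lia.
  rewrite addrAC subrr add0r -(sum_binomials R d) mulr_sumr.
  rewrite [leRHS](@big_cat_nat _ _ _ k.+1)//=; last by lia.
  rewrite [X in _ <= _ + X](@big_cat_nat _ _ _ d./2.+1)//=; try lia.
  rewrite addrCA; apply: ler_wpDr.
    by rewrite addr_ge0// sumr_ge0// => i _; rewrite mulr_ge0// divr_ge0.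
  apply: ler_sum_nat => i /andP[ki _]; rewrite mulrC ler_wpM2r//.
  apply: le_trans (ltW near); rewrite lerD2l lerN2 ler_wpM2l// ler_nat; lia.
have : s * P d k <= s * 2 ^+ d by rewrite ler_wpM2l.
lra.
Qed.

Lemma tails d k : (k < d)%N ->
  Num.sqrt d%:R * (P d k * (2 ^+ d - P d k)) <= 8 * 2 ^+ d * w d k.
Proof.
move=> kd; have d0 : (0 < d)%N by lia.
set s := Num.sqrt _; have s0 : 0 <= s by apply: sqrtr_ge0.
have P0 j : 0 <= P d j by apply: sumr_ge0.
have two0 : 0 < (2 : R) ^+ d by rewrite exprn_gt0.
have Q : 2 ^+ d - P d k = P d (d - k.+1).
  rewrite -(sum_binomials R d) (@big_cat_nat _ _ _ k.+1 0 d.+1)//=; last by lia.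
  rewrite addrAC subrr add0r /P [in RHS]big_nat_rev /= add0n.
  rewrite -[k.+1 in LHS]add0n (_ : d.+1 = (d - k.+1).+1 + k.+1)%N; last by lia.
  rewrite big_addn addnK; apply: eq_big_nat => i /andP[_ ik].
  rewrite subSS /b -[in RHS]bin_sub; last by lia.
  by congr ('C(_, _)%:R); lia.
have wS : w d (d - k.+1) = w d k.
  rewrite /w natrB// opprB addrCA subrr addr0 /b bin_sub//.
  rewrite -natrB 1?ltnW// -!natrM; congr _%:R.
  by rewrite mul_bin_left mulnC mulnC.
have Pd j : (j <= d)%N -> P d j <= 2 ^+ d.
  move=> jd; rewrite -(sum_binomials R d) /P (@big_cat_nat _ _ _ j.+1 0 d.+1)//=.
  by rewrite lerDl sumr_ge0.
have [k2|k2] := leqP k.*2 d.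
  have h := lower_tail d0 k2; rewrite -/s in h.
  have q1 : 2 ^+ d - P d k <= 2 ^+ d by have := P0 k; lra.
  have q0 : 0 <= 2 ^+ d - P d k by rewrite subr_ge0; apply: Pd; lia.
  have w0 : 0 <= w d k by have := mulr_ge0 s0 (P0 k); lra.
  have h1 : s * P d k * (2 ^+ d - P d k) <= 8 * w d k * (2 ^+ d - P d k).
    by rewrite ler_wpM2r.
  have h2 : w d k * (2 ^+ d - P d k) <= w d k * 2 ^+ d by rewrite ler_wpM2l.
  lra.
have k2' : ((d - k.+1).*2 <= d)%N by lia.
have h := lower_tail d0 k2'; rewrite -/s wS in h.
rewrite Q.
have w0 : 0 <= w d k by have := mulr_ge0 s0 (P0 (d - k.+1)%N); lra.
have pk : P d k <= 2 ^+ d by apply: Pd; lia.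
have h1 : s * P d (d - k.+1) * P d k <= 8 * w d k * P d k by rewrite ler_wpM2r.
have h2 : w d k * P d k <= w d k * 2 ^+ d by rewrite ler_wpM2l.
lra.
Qed.

(** Cheeger's inequality for the binomial distribution; the factor [sqrt d] is
    of the order of its standard deviation. *)
Lemma binomial_l1 d (r : nat -> R) : (0 < d)%N ->
  Num.sqrt d%:R * \sum_(i < d.+1) \sum_(j < d.+1) b d i * b d j * `|r i - r j|
  <= 16 * 2 ^+ d * \sum_(k < d) w d k * `|r k.+1 - r k|.
Proof.
move=> d0.
pose De k := `|r k.+1 - r k|.
pose c (i j k : nat) : R := ((i <= k < j)%N : nat)%:R.
have c0 i j k : 0 <= c i j k by rewrite ler0n.
have De0 k : 0 <= De k by rewrite normr_ge0.
have path i j : (i <= j <= d)%N -> `|r j - r i| <= \sum_(k < d) c i j k * De k.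
  move=> /andP[ij jd].
  rewrite -(big_mkord xpredT (fun k => c i j k * De k)).
  rewrite (@big_cat_nat _ _ _ i)//=; last by lia.
  rewrite (@big_cat_nat _ _ _ j i d)//=.
  have e : \sum_(i <= k < j) c i j k * De k = \sum_(i <= k < j) De k.
    by apply: eq_big_nat => k kij; rewrite /c kij mul1r.
  rewrite e.
  have : `|r j - r i| <= \sum_(i <= k < j) De k.
    by rewrite -(telescope_sumr r ij); apply: ler_norm_sum.
  have h A B : 0 <= \sum_(A <= k < B) c i j k * De k.
    by apply: sumr_ge0 => k _; rewrite mulr_ge0.
  have := h 0%N i; have := h j d; lra.
have path2 (i j : 'I_d.+1) : `|r i - r j| <= \sum_(k < d) (c i j k + c j i k) * De k.
  have [ij|/ltnW ij] := leqP i j.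
    rewrite distrC; apply: le_trans (path i j _) _.
      by rewrite ij -ltnS ltn_ord.
    by apply: ler_sum => k _; rewrite ler_wpM2r// lerDl.
  apply: le_trans (path j i _) _; first by rewrite ij -ltnS ltn_ord.
  by apply: ler_sum => k _; rewrite ler_wpM2r// lerDr.
have step1 : \sum_(i < d.+1) \sum_(j < d.+1) b d i * b d j * `|r i - r j|
    <= \sum_(k < d) 2 * (P d k * (2 ^+ d - P d k)) * De k.
  apply: le_trans (_ : \sum_(i < d.+1) \sum_(j < d.+1) \sum_(k < d)
     b d i * b d j * ((c i j k + c j i k) * De k) <= _).
    apply: ler_sum => i _; apply: ler_sum => j _.
    by rewrite -mulr_sumr ler_wpM2l// mulr_ge0.
  under eq_bigr do rewrite exchange_big.
  rewrite exchange_big /=; apply: ler_sum => k _.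
  have cE (i j : nat) : c i j k = ((i <= k)%N : nat)%:R * ((k < j)%N : nat)%:R.
    by rewrite /c -natrM mulnb.
  pose A := \sum_(i < d.+1) b d i * ((i <= k)%N : nat)%:R.
  pose B := \sum_(i < d.+1) b d i * ((k < i)%N : nat)%:R.
  have AE : A = P d k.
    rewrite /A -(big_mkord xpredT (fun i => b d i * ((i <= k)%N : nat)%:R)).
    have kd := ltn_ord k.
    rewrite (@big_cat_nat _ _ _ k.+1)//=; last by lia.
    rewrite [X in _ + X]big_nat_cond [X in _ + X]big1 ?addr0.
      by apply: eq_big_nat => i /andP[_ ik]; rewrite -ltnS ik mulr1.
    by move=> i /andP[/andP[ki _] _]; rewrite leqNgt ki mulr0.
  have BE : B = 2 ^+ d - P d k.
    rewrite -AE -(sum_binomials R d) big_mkord /A /B -sumrB.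
    apply: eq_bigr => i _; rewrite -/(b d i) ltnNge.
    by case: (i <= k)%N; rewrite /= ?mulr0 ?mulr1 ?subrr ?subr0.
  rewrite -BE -AE le_eqVlt; apply/orP; left; apply/eqP.
  transitivity ((\sum_(i < d.+1) \sum_(j < d.+1)
     (b d i * ((i <= k)%N : nat)%:R * (b d j * ((k < j)%N : nat)%:R)
      + b d i * ((k < i)%N : nat)%:R * (b d j * ((j <= k)%N : nat)%:R))) * De k).
    rewrite mulr_suml; apply: eq_bigr => i _; rewrite mulr_suml.
    by apply: eq_bigr => j _; rewrite !cE; ring.
  congr (_ * _); under eq_bigr do rewrite big_split /= -!mulr_sumr -/A -/B.
  by rewrite big_split /= -!mulr_suml -/A -/B; ring.
apply: le_trans (ler_wpM2l (sqrtr_ge0 _) step1) _.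
rewrite !mulr_sumr; apply: ler_sum => k _.
have := ler_wpM2r (normr_ge0 (r k.+1 - r k)) (tails (ltn_ord k)); rewrite -/(De k).
lra.
Qed.

End BinomialL1.

Section Cube.
Variables (R : realType) (m : nat).
Implicit Types (G W A : {set 'I_m}).

Lemma card_setI_fiber G A : A \subset G ->
  #|[set W : {set 'I_m} | W :&: G == A]%SET| = (2 ^ (m - #|G|))%N.
Proof.
move=> AG; have -> : (m - #|G|)%N = #|~: G| by have := cardsC G; rewrite card_ord; lia.
rewrite -card_powerset.
have -> : [set W : {set 'I_m} | W :&: G == A]%SET
    = [set A :|: B | B in powerset (~: G)]%SET.
  apply/setP => W; rewrite inE; apply/eqP/imsetP => [WA|[B]].
    exists (W :\: G); first by rewrite powersetE finset.subsetDr.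
    by rewrite -WA finset.setID.
  rewrite powersetE => BG ->; rewrite finset.setIUl.
  have -> : B :&: G = finset.set0.
    by apply/eqP; rewrite finset.setI_eq0 finset.disjoints_subset.
  by rewrite finset.setU0; apply/finset.setIidPl.
apply: card_in_imset => B B'; rewrite !powersetE => BG B'G e.
have h (C : {set 'I_m}) : C \subset ~: G -> (A :|: C) :\: G = C.
  move=> CG; rewrite finset.setDUl.
  have -> : A :\: G = finset.set0 by apply/eqP; rewrite finset.setD_eq0.
  by rewrite finset.set0U finset.setDE; apply/finset.setIidPl.
by rewrite -(h B)// e h.
Qed.

Lemma sum_setI G (phi : nat -> R) :
  \sum_(W : {set 'I_m}) phi #|W :&: G|
  = 2 ^+ (m - #|G|) * \sum_(k < #|G|.+1) 'C(#|G|, k)%:R * phi k.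
Proof.
rewrite (partition_big (fun W : {set 'I_m} => W :&: G)
  (fun A : {set 'I_m} => A \subset G)) /=; last first.
  by move=> W _; exact: finset.subsetIr.
have -> : \sum_(A : {set 'I_m} | A \subset G) \sum_(W : {set 'I_m} | W :&: G == A) phi #|W :&: G|
   = \sum_(A : {set 'I_m} | A \subset G) 2 ^+ (m - #|G|) * phi #|A|.
  apply: eq_bigr => A AG.
  rewrite (eq_bigr (fun=> phi #|A|)) => [|W /eqP ->//].
  rewrite sumr_const -[LHS]mulr_natl; congr (_ * _).
  by rewrite -natrX -(card_setI_fiber AG); congr _%:R; apply: eq_card => W; rewrite !inE.
rewrite -mulr_sumr; congr (_ * _).
have cG (A : {set 'I_m}) : A \subset G -> (#|A| < #|G|.+1)%N.
  by rewrite ltnS; apply: subset_leq_card.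
rewrite (partition_big (fun A : {set 'I_m} => inord #|A| : 'I_#|G|.+1) xpredT) //=.
apply: eq_bigr => k _.
rewrite (eq_bigr (fun=> phi k)) => [|A /andP[AG /eqP <-]]; last first.
  by rewrite inordK ?cG.
rewrite sumr_const -[LHS]mulr_natl; congr (_ * _).
rewrite -(cards_draws G k); congr _%:R; apply: eq_card => A; rewrite !inE.
rewrite unfold_in /=; case: (boolP (A \subset G)) => //= AG.
by rewrite -val_eqE /= inordK ?cG.
Qed.

End Cube.

Section CubeL1.
Variables (R : realType) (m : nat).
Implicit Types (G W A : {set 'I_m}).

Lemma cube_l1 G (F : {set 'I_m} -> R) : (0 < #|G|)%N ->
  (forall W W', #|W :&: G| = #|W' :&: G| -> F W = F W') ->
  Num.sqrt #|G|%:R * \sum_W \sum_W' `|F W - F W'|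
  <= 16 * 2 ^+ m * \sum_W \sum_(l in G) `|F (symdiff W [set l]%SET) - F W|.
Proof.
move=> G0 FG; set d := #|G|.
pose r k : R := if [pick W | #|(W : {set 'I_m}) :&: G| == k] is Some W then F W else 0.
have Fr W : F W = r #|W :&: G|.
  rewrite /r; case: pickP => [W' /eqP e|/(_ W)]; first exact: FG.
  by rewrite eqxx.
have dm : (d <= m)%N by rewrite -[leqRHS](card_ord m) max_card.
have lhs : \sum_W \sum_W' `|F W - F W'| = (2 ^+ (m - d)) ^+ 2
   * \sum_(i < d.+1) \sum_(j < d.+1) 'C(d, i)%:R * 'C(d, j)%:R * `|r i - r j|.
  pose Phi k := \sum_(W' : {set 'I_m}) `|r k - r #|W' :&: G| |.
  transitivity (\sum_(W : {set 'I_m}) Phi #|W :&: G|).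
    by apply: eq_bigr => W _; apply: eq_bigr => W' _; rewrite !Fr.
  rewrite (sum_setI G Phi) expr2 -mulrA; congr (_ * _); rewrite mulr_sumr.
  apply: eq_bigr => i _; rewrite /Phi.
  rewrite (sum_setI G (fun k' => `|r i - r k'|)) mulrCA; congr (_ * _).
  by rewrite mulr_sumr; apply: eq_bigr => j _; rewrite mulrA.
have rhs : 2 ^+ (m - d) * \sum_(k < d) ((d%:R - k%:R) * 'C(d, k)%:R) * `|r k.+1 - r k|
   <= \sum_W \sum_(l in G) `|F (symdiff W [set l]%SET) - F W|.
  pose Phi (k : nat) : R := (d%:R - k%:R) * `|r k.+1 - r k|.
  apply: le_trans (_ : \sum_(W : {set 'I_m}) Phi #|W :&: G| <= _).
    rewrite (sum_setI G Phi) /Phi big_ord_recr /= -/d subrr mul0r mulr0 addr0.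
    rewrite le_eqVlt; apply/orP; left; apply/eqP; congr (_ * _).
    by apply: eq_bigr => k _; ring.
  apply: ler_sum => W _; rewrite (bigID (mem W)) /= addrC -[leLHS]addr0.
  apply: lerD; last exact: sumr_ge0.
  have e l : (l \in G) && (l \notin W) ->
      `|F (symdiff W [set l]%SET) - F W| = `|r #|W :&: G|.+1 - r #|W :&: G| |.
    move=> /andP[lG lW]; rewrite !Fr; congr `|r _ - _|.
    have -> : symdiff W [set l]%SET :&: G = l |: (W :&: G).
      apply/setP => k; rewrite !inE; have [->|_] := eqVneq k l.
        by rewrite lG addbT lW.
      by rewrite addbF.
    by rewrite cardsU1 !inE (negbTE lW) /=.
  rewrite (eq_bigr _ e) sumr_const -[leRHS]mulr_natl ler_wpM2r//.
  have -> : #|[pred l | (l \in G) && (l \notin W)]| = (d - #|W :&: G|)%N.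
    have := cardsID W G; rewrite finset.setIC -/d => h.
    have -> : #|[pred l | (l \in G) && (l \notin W)]| = #|G :\: W|.
      by apply: eq_card => l; rewrite !inE andbC.
    lia.
  by rewrite natrB// subset_leq_card// finset.subsetIr.
have bl := binomial_l1 r G0; rewrite -/d in bl.
rewrite lhs.
apply: le_trans (_ : 16 * 2 ^+ m * (2 ^+ (m - d) * \sum_(k < d)
  ((d%:R - k%:R) * 'C(d, k)%:R) * `|r k.+1 - r k|) <= _); last first.
  by rewrite ler_wpM2l// mulr_ge0// exprn_ge0.
have -> : (2 : R) ^+ m = 2 ^+ (m - d) * 2 ^+ d by rewrite -exprD subnK.
have t0 : 0 <= (2 ^+ (m - d)) ^+ 2 :> R by rewrite sqr_ge0.
have := ler_wpM2l t0 bl; lra.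
Qed.

(** Any two sets of the same cardinality are related by exchanges of single
    elements. *)
Lemma exchange_card G (F : {set 'I_m} -> R) :
  (forall W, F W = F (W :&: G)) ->
  (forall W a b, a \in G -> b \in G -> a \in W -> b \notin W ->
     F (symdiff W [set a; b]%SET) = F W) ->
  forall W W', #|W :&: G| = #|W' :&: G| -> F W = F W'.
Proof.
move=> FG Fx W W'; rewrite FG (FG W').
have := finset.subsetIr W G; have := finset.subsetIr W' G.
move: (W :&: G) (W' :&: G) => {W W'}; move=> W W' W'G WG.
have [k] := ubnP #|W :\: W'|; elim: k W WG => // k IHk W WG; rewrite ltnS => hk e.
have [/eqP WW'|/finset.set0Pn[a]] := eqVneq (W :\: W') finset.set0.
  congr F; apply/eqP; rewrite eqEcard e leqnn andbT.
  by rewrite -finset.setD_eq0.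
rewrite inE => /andP[aW' aW].
have [b] : exists b, b \in W' :\: W.
  apply/finset.set0Pn; rewrite -card_gt0.
  have := cardsID W W'; have := cardsID W' W; rewrite finset.setIC => h1 h2.
  have : (0 < #|W :\: W'|)%N by apply/card_gt0P; exists a; rewrite inE aW'.
  lia.
rewrite inE => /andP[bW bW'].
have aG : a \in G by apply: (fintype.subsetP WG).
have bG : b \in G by apply: (fintype.subsetP W'G).
have ab : a != b by apply: contraNneq bW => <-.
rewrite -(Fx W a b)//; set V := symdiff _ _.
have VE : V = b |: (W :\ a).
  apply/setP => c; rewrite !inE.
  have [->|ca] := eqVneq c a; first by rewrite (negbTE ab) aW.
  have [->|cb] := eqVneq c b; first by rewrite (negbTE bW).
  by rewrite addbF.
apply: IHk.
- rewrite VE; apply/fintype.subsetP => c; rewrite !inE => /orP[/eqP->//|/andP[_]].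
  exact: (fintype.subsetP WG).
- apply: leq_trans hk; apply: proper_card; apply/properP; split.
    apply/fintype.subsetP => c; rewrite VE !inE.
    by have [->|cb] := eqVneq c b; rewrite ?bW' //= => /and3P[-> _ ->].
  by exists a; rewrite ?VE !inE ?aW ?aW' ?eqxx ?(negbTE ab).
- rewrite VE cardsU1 !inE (negbTE bW) andbF add1n -e.
  by rewrite (cardsD1 a W) aW.
Qed.

End CubeL1.

(** * The cost of flipping a matching *)

Section Cost.
Variables (R : realType) (n m K : nat).
Hypothesis m0 : (0 < m)%N.
Hypothesis mK : (m * K <= n)%N.
Hypothesis K0 : (0 < K)%N.
Implicit Types (x y : 'S_n).
Notation blk := (blk m K).
Notation block_perms := (block_perms n m K).
Notation pos := (pos m0 mK).

Variable p : 'S_n -> R.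
Hypothesis p_ge0 : forall x, 0 <= p x.
Hypothesis p_left : forall h x, h \in block_perms -> p (h * x)%g = p x.
Hypothesis p_right : forall x k, k \in block_perms -> p (x * k)%g = p x.

Lemma same_types x y : (forall i, blk (x i) = blk (y i)) -> p x = p y.
Proof.
move=> xy; have -> : y = (x * (x^-1 * y))%g by rewrite mulKVg.
rewrite p_right//; apply/block_permsP => c.
by rewrite permM -xy permKV.
Qed.

Variables I J : 'I_K.
Notation flip := (flip m0 mK I J).

Definition card_type (c : 'I_n) : 'I_K := Ordinal (blk_lt m c K0).

Definition lane_code x l : 'I_K * 'I_K :=
  let a := card_type (x (pos I l)) in let b := card_type (x (pos J l)) in
  if (a <= b)%N then (a, b) else (b, a).

Definition lanes x (gs : seq ('I_K * 'I_K)) : {set 'I_m} :=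
  [set l | lane_code x l \in gs]%SET.

Lemma lane_code_flip S x l : lane_code (flip S * x)%g l = lane_code x l.
Proof.
rewrite /lane_code !permM flip1 flip2; case: (l \in S) => //.
set a := card_type _; set b := card_type _.
by have [//|//|ab] := ltngtP a b; rewrite (val_inj ab).
Qed.

Lemma lanes_flip S x gs : lanes (flip S * x)%g gs = lanes x gs.
Proof. by apply/setP => l; rewrite !inE lane_code_flip. Qed.

Definition part_flip gs S x : 'S_n := (flip (S :&: lanes x gs) * x)%g.

Lemma part_flipK gs S : involutive (part_flip gs S).
Proof. by move=> x; rewrite /part_flip lanes_flip flipKl. Qed.

Lemma part_flipM gs S S' x :
  part_flip gs S (part_flip gs S' x) = part_flip gs (symdiff S S') x.
Proof.
rewrite /part_flip lanes_flip mulgA flipM; congr (flip _ * _)%g.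
by apply/setP => l; rewrite !inE; case: (l \in S); case: (l \in S'); case: (_ \in _).
Qed.

Lemma lanes_part_flip gs gs' S x : lanes (part_flip gs S x) gs' = lanes x gs'.
Proof. exact: lanes_flip. Qed.

Definition cost g := \sum_S \sum_x `|p (part_flip [:: g] S x) - p x|.

(** Flips of lanes of different types commute, and flipping one more type
    costs the same from any starting point already flipped. *)
Lemma cost_telescope gs : uniq gs ->
  \sum_S \sum_x `|p (part_flip gs S x) - p x| <= \sum_(g <- gs) cost g.
Proof.
elim: gs => [_|g gs IH /= /andP[ggs ugs]].
  rewrite big_nil big1// => S _; apply: big1 => x _.
  have -> : part_flip [::] S x = x.
    rewrite /part_flip (_ : S :&: _ = finset.set0) ?flip0 ?mul1g//.
    by apply/setP => l; rewrite !inE andbF.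
  by rewrite subrr normr0.
rewrite big_cons; apply: le_trans (lerD (lexx _) (IH ugs)).
rewrite -big_split; apply: ler_sum => S _ /=.
apply: le_trans (_ : \sum_x (`|p (part_flip [:: g] S (part_flip gs S x))
    - p (part_flip gs S x)| + `|p (part_flip gs S x) - p x|) <= _).
  apply: ler_sum => x _.
  have -> : part_flip (g :: gs) S x = part_flip [:: g] S (part_flip gs S x).
    rewrite {1 2}/part_flip lanes_part_flip mulgA flipM; congr (flip _ * _)%g.
    apply/setP => l; rewrite !inE; case: (l \in S) => //=.
    by have [->|_] := eqVneq (lane_code x l) g; rewrite ?(negbTE ggs).
  exact: ler_distD.
rewrite big_split /= lerD2r.
by rewrite [leRHS](reindex_inj (inv_inj (part_flipK gs S))).
Qed.

(** Every lane has a type, so flipping the chosen lanes of all types is the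
    whole flip. *)
Lemma match_avg_cost :
  \sum_x `|p x - match_avg m0 mK I J p x| <= (\sum_g cost g) / 2 ^+ m.
Proof.
have two0 : 0 < 2 ^+ m :> R by rewrite exprn_gt0.
have h x : `|p x - match_avg m0 mK I J p x|
    <= (\sum_S `|p (part_flip (enum [set: 'I_K * 'I_K]%SET) S x) - p x|) / 2 ^+ m.
  have -> : p x - match_avg m0 mK I J p x
     = (\sum_(S : {set 'I_m}) (p x - p (flip S * x)%g)) / 2 ^+ m.
    rewrite sumrB sumr_const mulrBl -[X in X / _ - _]mulr_natr card_sets mulfK//.
  rewrite normrM [`|_^-1|]gtr0_norm ?invr_gt0// ler_wpM2r ?invr_ge0 ?(ltW two0)//.
  apply: le_trans (ler_norm_sum _ _ _) _; apply: ler_sum => S _.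
  rewrite distrC le_eqVlt; apply/orP; left; apply/eqP.
  congr `|p _ - _|; congr (flip _ * _)%g.
  by apply/setP => l; rewrite !inE mem_enum inE andbT.
apply: le_trans (ler_sum _ (fun x _ => h x)) _.
rewrite -mulr_suml exchange_big /= ler_wpM2r ?invr_ge0 ?(ltW two0)//.
apply: le_trans (cost_telescope (enum_uniq _)) _.
by rewrite big_enum /=; under eq_bigl do rewrite inE.
Qed.

Lemma lane_code_type x l (j j' : 'I_K) : lane_code x l = (j, j') ->
  (card_type (x (pos I l)) = j /\ card_type (x (pos J l)) = j')
  \/ (card_type (x (pos I l)) = j' /\ card_type (x (pos J l)) = j).
Proof. by rewrite /lane_code; case: ifP => _ [<- <-]; [left|right]. Qed.

Definition swap_cost : R :=
  \sum_(l < m) \sum_x `|p (tperm (pos I l) (pos J l) * x)%g - p x|.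

(** Two lanes of the same code that carry their two types in opposite orders
    can both be flipped: the result is also obtained by exchanging cards inside
    blocks and cards of the same type. *)
Lemma flip_two_lanes x (a b : 'I_m) (j j' : 'I_K) : I != J ->
  card_type (x (pos I a)) = j -> card_type (x (pos J a)) = j' ->
  card_type (x (pos I b)) = j' -> card_type (x (pos J b)) = j ->
  p (flip [set a; b]%SET * x)%g = p x.
Proof.
move=> IJ xIa xJa xIb xJb.
have [ab|ab] := eqVneq a b.
  apply: same_types => i; rewrite permM.
  have jj : j = j' by rewrite -xIa ab xIb.
  have tv c k : card_type c = k -> blk c = k by move=> <-.
  case: (lane_case m0 mK I J i) => [[l ->]|[l ->]|h]; last by rewrite flip3.
    rewrite flip1 !inE ab orbb; case: eqP => [->|//].
    by rewrite (tv _ _ xJb) (tv _ _ xIb) jj.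
  rewrite flip2 !inE ab orbb; case: eqP => [->|//].
  by rewrite (tv _ _ xJb) (tv _ _ xIb) jj.
pose h := (tperm (pos I a) (pos I b) * tperm (pos J a) (pos J b))%g.
have hB : h \in block_perms.
  by apply: block_permsM; apply: block_perms_tperm; rewrite !blk_pos.
rewrite -[LHS](p_left _ hB); apply: same_types => i.
have nIJ l l' : pos I l == pos J l' = false.
  by apply/eqP => /pos_inj2[e _]; rewrite e eqxx in IJ.
have nJI l l' : pos J l == pos I l' = false by rewrite eq_sym nIJ.
have nab (L : 'I_K) : (pos L a == pos L b) = false.
  by apply/eqP => /pos_inj2[_ e]; rewrite e eqxx in ab.
have nba (L : 'I_K) : (pos L b == pos L a) = false by rewrite eq_sym nab.
have tv c k : card_type c = k -> blk c = k by move=> <-.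
rewrite !permM.
have [->|ia] := eqVneq i (pos I a).
  rewrite tpermL tpermD ?nJI// flip1 !inE eqxx orbT.
  by rewrite (tv _ _ xJb) (tv _ _ xIa).
have [->|ib] := eqVneq i (pos I b).
  rewrite tpermR tpermD ?nJI// flip1 !inE eqxx.
  by rewrite (tv _ _ xJa) (tv _ _ xIb).
rewrite (@tpermD _ (pos I a) (pos I b)) 1?eq_sym//.
have [->|ja] := eqVneq i (pos J a).
  rewrite tpermL flip2 !inE eqxx orbT.
  by rewrite (tv _ _ xIb) (tv _ _ xJa).
have [->|jb] := eqVneq i (pos J b).
  rewrite tpermR flip2 !inE eqxx.
  by rewrite (tv _ _ xIa) (tv _ _ xJb).
rewrite tpermD 1?eq_sym//.
case: (lane_case m0 mK I J i) => [[l e]|[l e]|hf]; last by rewrite flip3.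
  rewrite e flip1 !inE; have [la|_] := eqVneq l a; first by rewrite e la eqxx in ia.
  by have [lb|_] := eqVneq l b; first by rewrite e lb eqxx in ib.
rewrite e flip2 !inE; have [la|_] := eqVneq l a; first by rewrite e la eqxx in ja.
by have [lb|_] := eqVneq l b; first by rewrite e lb eqxx in jb.
Qed.

(** A code is an ordered pair of types, and flipping a lane with two cards of
    the same type changes no type. *)
Lemma cost_trivial (j j' : 'I_K) : (j' <= j)%N -> cost (j, j') = 0.
Proof.
move=> jj; rewrite /cost big1// => S _; apply: big1 => x _.
rewrite (_ : p (part_flip _ S x) = p x) ?subrr ?normr0//.
apply: same_types => i; rewrite /part_flip permM.
have H l : l \in lanes x [:: (j, j')] ->
    blk (x (pos I l)) = blk (x (pos J l)).
  rewrite inE mem_seq1 /lane_code; case: leqP => ab /eqP[e1 e2].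
    by move/(congr1 val): e1; move/(congr1 val): e2; move: ab => /=; lia.
  by move/(congr1 val): e1; move/(congr1 val): e2; move: ab => /=; lia.
case: (lane_case m0 mK I J i) => [[l ->]|[l ->]|h]; last by rewrite flip3.
  by rewrite flip1 finset.in_setI; case: ifP => // /andP[_ /H].
by rewrite flip2 finset.in_setI; case: ifP => // /andP[_ /H].
Qed.

(** By invariance the density depends only on the number of lanes of the given
    type that are flipped, so the isoperimetric inequality applies; it gains
    the square root of the number of lanes, except on arrangements with few of
    them. *)
Lemma cost_bound (j j' : 'I_K) (d0 : nat) : I != J -> (j < j')%N -> (0 < d0)%N ->
  cost (j, j') / 2 ^+ m <= 16 / Num.sqrt d0%:R * swap_cost
    + 2 * \sum_(x | (#|lanes x [:: (j, j')]| < d0)%N) p x.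
Proof.
move=> IJ jj d00; set g := [:: (j, j')].
have two0 : 0 < 2 ^+ m :> R by rewrite exprn_gt0.
have sd0 : 0 < Num.sqrt d0%:R :> R by rewrite sqrtr_gt0 ltr0n.
pose G x := lanes x g.
have inner x : (d0 <= #|G x|)%N ->
    \sum_S \sum_S' `|p (part_flip g S x) - p (part_flip g S' x)|
    <= 16 * 2 ^+ m / Num.sqrt d0%:R * \sum_S \sum_(l in G x)
      `|p (tperm (pos I l) (pos J l) * part_flip g S x)%g - p (part_flip g S x)|.
  move=> dG; pose U := [set l | card_type (x (pos I l)) == j]%SET.
  pose F W := p (part_flip g (symdiff W U) x).
  have tlane W l : l \in G x ->
      card_type (part_flip g (symdiff W U) x (pos I l)) = (if l \in W then j else j')
   /\ card_type (part_flip g (symdiff W U) x (pos J l)) = (if l \in W then j' else j).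
    move=> lG; have := lG; rewrite inE mem_seq1 => /eqP/lane_code_type h.
    rewrite /part_flip !permM flip1 flip2 !finset.in_setI lG andbT !inE.
    have jn : (j' == j) = false by rewrite -val_eqE /= gtn_eqF.
    by case: h => [[h1 h2]|[h1 h2]]; rewrite h1 ?eqxx ?jn; case: (l \in W);
      rewrite /= ?h1 ?h2.
  have addl W l : l \in G x ->
      part_flip g (symdiff W [set l]%SET) x
      = (tperm (pos I l) (pos J l) * part_flip g W x)%g.
    move=> lG; rewrite symdiffC -part_flipM {1}/part_flip lanes_part_flip.
    have -> : [set l]%SET :&: lanes x g = [set l]%SET.
      by apply/finset.setIidPl; rewrite finset.sub1set.
    by rewrite flip_set1.
  have FG W : F W = F (W :&: G x).
    rewrite /F /part_flip; congr (p (flip _ * x)%g); apply/setP => l.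
    rewrite /G !(finset.in_setI, in_symdiff).
    by case: (l \in lanes x g); rewrite ?andbF ?andbT.
  have Fx (W : {set 'I_m}) a b : a \in G x -> b \in G x -> a \in W -> b \notin W ->
      F (symdiff W [set a; b]%SET) = F W.
    move=> aG bG aW bW.
    have [Ia Ja] := tlane W _ aG; have [Ib Jb] := tlane W _ bG.
    rewrite aW in Ia Ja; rewrite (negbTE bW) in Ib Jb.
    rewrite /F -(flip_two_lanes IJ Ia Ja Ib Jb); congr p.
    have -> : symdiff (symdiff W [set a; b]%SET) U
        = symdiff [set a; b]%SET (symdiff W U).
      apply/setP => l; rewrite !in_symdiff; case: (l \in W); case: (l \in U);
        by case: (l \in _).
    rewrite -part_flipM {1}/part_flip lanes_part_flip.
    congr (flip _ * _)%g; apply/finset.setIidPl/fintype.subsetP => l.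
    by rewrite finset.in_set2 => /orP[/eqP->|/eqP->].
  have Fc := exchange_card FG Fx.
  have G0 : (0 < #|G x|)%N by lia.
  have := cube_l1 G0 Fc.
  have shift (H : {set 'I_m} -> R) : \sum_S H (symdiff S U) = \sum_S H S.
    rewrite [RHS](reindex_inj (inv_inj (symdiffK U))).
    by apply: eq_bigr => S _; rewrite symdiffC.
  have -> : \sum_W \sum_W' `|F W - F W'|
     = \sum_S \sum_S' `|p (part_flip g S x) - p (part_flip g S' x)|.
    rewrite (shift (fun W => \sum_W' `|p (part_flip g W x) - F W'|)).
    apply: eq_bigr => S _.
    exact: (shift (fun W' => `|p (part_flip g S x) - p (part_flip g W' x)|)).
  have -> : \sum_W \sum_(l in G x) `|F (symdiff W [set l]%SET) - F W|
     = \sum_S \sum_(l in G x) `|p (tperm (pos I l) (pos J l) * part_flip g S x)%g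
          - p (part_flip g S x)|.
    rewrite -(shift (fun S => \sum_(l in G x)
      `|p (tperm (pos I l) (pos J l) * part_flip g S x)%g - p (part_flip g S x)|)).
    apply: eq_bigr => W _; apply: eq_bigr => l lG; rewrite /F -addl//.
    congr `|p (part_flip g _ x) - _|.
    apply/setP => k; rewrite !in_symdiff; case: (k \in W); case: (k \in U);
      by case: (k \in _).
  set A := \sum_S _; set B := \sum_S _ => h.
  rewrite mulrAC ler_pdivlMr// mulrC; apply: le_trans h.
  rewrite ler_wpM2r//; first by apply: sumr_ge0 => S _; apply: sumr_ge0.
  by rewrite ler_sqrt ?ler_nat// ltr0n.
(* averaging the starting point over the flips changes nothing, by invariance *)
have avg : 2 ^+ m * cost (j, j')
    = \sum_x \sum_S \sum_S' `|p (part_flip g S x) - p (part_flip g S' x)|.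
  rewrite -card_sets mulr_natl -sumr_const.
  rewrite [RHS]exchange_big /=.
  under [RHS]eq_bigr do rewrite exchange_big.
  rewrite [RHS]exchange_big /=; apply: eq_bigr => S' _.
  rewrite /cost.
  transitivity (\sum_S \sum_x `|p (part_flip g S (part_flip g S' x))
      - p (part_flip g S' x)|).
    apply: eq_bigr => S _.
    by rewrite [LHS](reindex_inj (inv_inj (part_flipK g S'))).
  rewrite [RHS](reindex_inj (inv_inj (symdiffK S'))).
  apply: eq_bigr => S _; apply: eq_bigr => x _.
  by rewrite part_flipM symdiffC.
have good : \sum_(x | (d0 <= #|G x|)%N) \sum_S \sum_(l in G x)
    `|p (tperm (pos I l) (pos J l) * part_flip g S x)%g - p (part_flip g S x)|
    <= 2 ^+ m * swap_cost.
  apply: le_trans (_ : \sum_x \sum_S \sum_(l in G x)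
    `|p (tperm (pos I l) (pos J l) * part_flip g S x)%g - p (part_flip g S x)| <= _).
    rewrite [leRHS](bigID (fun x => (d0 <= #|G x|)%N)) /= lerDl.
    by apply: sumr_ge0 => x _; apply: sumr_ge0 => S _; apply: sumr_ge0.
  rewrite exchange_big /= -card_sets mulr_natl -sumr_const; apply: ler_sum => S _.
  apply: le_trans (_ : \sum_x \sum_(l in G x)
    `|p (tperm (pos I l) (pos J l) * x)%g - p x| <= _).
    rewrite [leRHS](reindex_inj (inv_inj (part_flipK g S))) /=.
    by apply: ler_sum => x _; rewrite /G lanes_part_flip.
  rewrite /swap_cost exchange_big /=; apply: ler_sum => x _.
  by rewrite [leRHS](bigID (mem (G x))) /= lerDl sumr_ge0.
have bad : \sum_(x | ~~ (d0 <= #|G x|)%N) \sum_S \sum_S'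
    `|p (part_flip g S x) - p (part_flip g S' x)|
    <= 2 * (2 ^+ m) ^+ 2 * \sum_(x | (#|lanes x g| < d0)%N) p x.
  pose B := \sum_(x | (#|lanes x g| < d0)%N) p x.
  have e S : \sum_(x | ~~ (d0 <= #|G x|)%N) p (part_flip g S x) = B.
    rewrite /B (reindex_inj (inv_inj (part_flipK g S))) /=; apply: eq_big => x.
      by rewrite /G lanes_part_flip ltnNge.
    by rewrite part_flipK.
  apply: le_trans (_ : \sum_(x | ~~ (d0 <= #|G x|)%N) \sum_S \sum_S'
     (p (part_flip g S x) + p (part_flip g S' x)) <= _).
    apply: ler_sum => x _; apply: ler_sum => S _; apply: ler_sum => S' _.
    by apply: le_trans (ler_normB _ _) _; rewrite !ger0_norm.
  rewrite exchange_big /=.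
  under eq_bigr do rewrite exchange_big /=.
  under eq_bigr do under eq_bigr do rewrite big_split /= !e.
  under eq_bigr do rewrite sumr_const -[_ *+ _]mulr_natl card_sets.
  rewrite sumr_const -[leLHS]mulr_natl card_sets.
  by rewrite le_eqVlt; apply/orP; left; apply/eqP; rewrite /B; ring.
rewrite ler_pdivrMr// -(ler_pM2l two0) avg.
rewrite (bigID (fun x => (d0 <= #|G x|)%N)) /=.
apply: le_trans (lerD (ler_sum _ inner) bad) _.
rewrite -mulr_sumr.
have c0 : 0 <= 16 * 2 ^+ m / Num.sqrt d0%:R :> R.
  by rewrite divr_ge0 ?sqrtr_ge0// mulr_ge0// ltW.
have := ler_wpM2l c0 good; lra.
Qed.

End Cost.

(** * Laws of decks shuffled inside blocks *)

Section RightInvariance.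
Variables (R : realType) (n m K : nat).
Implicit Types (f g : 'S_n -> R) (x y h k : 'S_n).
Notation block_perms := (block_perms n m K).
Notation block_avg := (block_avg (R := R) (n := n) m K).

(** Only the types of the cards matter, that is the block numbers of their
    final positions. *)
Definition type_inv f := forall x k, k \in block_perms -> f (x * k)%g = f x.

Lemma sweep_type_inv es f : type_inv f -> type_inv (sweep es f).
Proof.
move=> fT; elim: es => //= e es IH x k kB.
by rewrite /lazy_flip mulgA (IH x k kB) (IH (_ * x)%g k kB).
Qed.

Lemma round_type_inv S s f : type_inv f -> type_inv (round S s f).
Proof. by move=> fT x k kB; rewrite /round !sweep_type_inv. Qed.

Lemma iter_round_type_inv r S s f : type_inv f -> type_inv (iter r (round S s) f).
Proof. by move=> fT; elim: r => //= r; exact: round_type_inv. Qed.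

Lemma block_avg_type_inv f : type_inv f -> type_inv (block_avg f).
Proof.
move=> fT x k kB; rewrite /block_avg; congr (_ / _).
by apply: eq_bigr => h _; rewrite mulgA fT.
Qed.

Lemma point_mass_type_inv : type_inv (block_avg (@point_mass R n)).
Proof.
move=> x k kB; rewrite /block_avg; congr (_ / _).
rewrite -(sum_block_perms_mull (fun h => point_mass R (h * x)%g) kB).
apply: eq_bigr => h _; rewrite /point_mass; congr ((_ : bool) : nat)%:R.
by rewrite mulgA -eq_invg_mul eq_sym eq_mulgV1 invgK mulgA.
Qed.

Variable r : nat.

(** Law after an initial exact shuffle of every block and [r] rounds, then
    after one more exact shuffle of every block. *)
Definition mid_law : 'S_n -> R :=
  iter r (round predT n.-1) (block_avg (@point_mass R n)).
Definition block_law : 'S_n -> R := block_avg mid_law.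

Lemma block_avg_ge0 f : (forall x, 0 <= f x) -> forall x, 0 <= block_avg f x.
Proof. by move=> f0 x; rewrite /block_avg divr_ge0// sumr_ge0. Qed.

Lemma mid_law_ge0 x : 0 <= mid_law x.
Proof.
apply: iter_round_ge0 => y; apply: block_avg_ge0 => z.
by rewrite /point_mass ler0n.
Qed.

Lemma block_law_ge0 x : 0 <= block_law x.
Proof. by apply: block_avg_ge0; exact: mid_law_ge0. Qed.

Lemma block_avg_const (c : R) : block_avg (fun=> c) = fun=> c.
Proof. by apply: block_avg_id. Qed.

Lemma pairing_mid_law f : pairing mid_law f
  = block_avg (iter r (round predT n.-1) f) 1%g.
Proof.
by rewrite /mid_law pairing_iter_round pairing_block_avg pairing_point_mass.
Qed.

Lemma pairing1 (f : 'S_n -> R) : pairing f (fun=> 1) = \sum_x f x.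
Proof. by apply: eq_bigr => x _; rewrite mulr1. Qed.


Lemma sum_mid_law : \sum_x mid_law x = 1.
Proof. by rewrite -pairing1 pairing_mid_law iter_round_const block_avg_const. Qed.

Lemma sum_block_law : \sum_x block_law x = 1.
Proof. by rewrite -pairing1 pairing_block_avg block_avg_const pairing1 sum_mid_law. Qed.

Lemma block_law_left : block_inv m K block_law.
Proof. by move=> h x hB; apply: block_avg_invl. Qed.

Lemma block_law_right : type_inv block_law.
Proof.
by apply: block_avg_type_inv; apply: iter_round_type_inv; exact: point_mass_type_inv.
Qed.

Lemma pairing_mid_law_type f : type_inv f ->
  pairing mid_law f = iter r (round predT n.-1) f 1%g.
Proof.
move=> fT; rewrite pairing_mid_law /block_avg.
rewrite (eq_bigr (fun=> iter r (round predT n.-1) f 1%g)) => [|h hB].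
  by rewrite sumr_const -[X in X / _]mulr_natr mulfK// gt_eqF// card_block_perms_gt0.
by rewrite mulg1 -[h]mul1g iter_round_type_inv.
Qed.

Definition blkR (i : nat) : R := (blk m K i)%:R.
Definition blkc (i : nat) : R := blkR i - (\sum_(k < n) blkR k) / n%:R.

Lemma blkc_mean0 : (0 < n)%N -> dot n (fun=> 1) blkc = 0.
Proof.
move=> n0; rewrite /dot; under eq_bigr do rewrite mul1r.
rewrite sumrB sumr_const card_ord -[_ *+ n]mulr_natr divfK ?subrr//.
by rewrite pnatr_eq0; lia.
Qed.

(** Starting from the identity, the types and the positions agree, and the
    exact shuffles leave both weights unchanged. *)
Lemma pairing_block_law_addstat : (0 < n)%N ->
  pairing block_law (addstat blkc blkR)
  = dot n blkR (iter r (round1 n predT n.-1) blkc).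
Proof.
move=> n0; rewrite pairing_block_avg pairing_mid_law.
have FI : block_inv m K (addstat blkc blkR : 'S_n -> R).
  move=> h x hB; rewrite /addstat [RHS](reindex_inj (@perm_inj _ h)).
  apply: eq_bigr => i _; rewrite permM.
  by move/block_permsP: hB => hB; rewrite /blkc /blkR hB.
rewrite (block_avg_id FI) iter_round_addstat /block_avg.
set g := iter _ _ _.
rewrite (eq_bigr (fun=> dot n blkR g)) => [|h hB].
  by rewrite sumr_const -[X in X / _]mulr_natr mulfK// gt_eqF// card_block_perms_gt0.
rewrite mulg1 /addstat; apply: eq_bigr => i _.
by move/block_permsP: hB => hB; rewrite /blkR hB mulrC.
Qed.

Lemma block_statistic_decay al : (1 < n)%N -> (0 < K)%N -> 0 < al ->
  al <= cos (al * n%:R / 2) -> al * n%:R / 2 <= pi -> 0 <= cos al ->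
  pairing block_law (addstat blkc blkR) <= n%:R * K%:R ^+ 2 * wave_rate al ^+ r.
Proof.
move=> n1 K0 a0 ab bpi ca; have n0 := ltnW n1.
have np : 0 < n%:R :> R by rewrite ltr0n.
rewrite pairing_block_law_addstat//.
have w0 := wave_rate_ge0 ca.
have rhs0 : 0 <= n%:R * K%:R ^+ 2 * wave_rate al ^+ r.
  by rewrite !mulr_ge0 ?exprn_ge0.
set D := dot n _ _; apply: le_trans (ler_norm _) _.
rewrite -ler_sqr ?nnegrE// real_normK ?num_real//.
apply: le_trans (spectral_gap r blkR n1 a0 ab bpi ca (blkc_mean0 n0)) _.
have bK (i : nat) : 0 <= blkR i <= K%:R by rewrite /blkR ler0n ler_nat /= /blk; lia.
have mK' : 0 <= (\sum_(k < n) blkR k) / n%:R <= K%:R.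
  rewrite divr_ge0//=; last by apply: sumr_ge0 => i _; have /andP[] := bK i.
  rewrite ler_pdivrMr//.
  apply: le_trans (_ : \sum_(k < n) (K%:R : R) <= _).
    by apply: ler_sum => i _; have /andP[] := bK i.
  by rewrite sumr_const card_ord -[leLHS]mulr_natr.
have sq (g : nat -> R) : (forall i, `|g i| <= K%:R) -> dot n g g <= n%:R * K%:R ^+ 2 :> R.
  move=> gK; apply: (@le_trans _ _ (\sum_(k < n) (K%:R ^+ 2 : R))).
    apply: ler_sum => i _; rewrite -expr2 -[leLHS]real_normK ?num_real//.
    by rewrite lerXn2r ?nnegrE.
  by rewrite sumr_const card_ord -[leLHS]mulr_natl.
have s1 : dot n blkR blkR <= n%:R * K%:R ^+ 2.
  by apply: sq => i; have /andP[? ?] := bK i; rewrite ger0_norm.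
have s2 : dot n blkc blkc <= n%:R * K%:R ^+ 2.
  apply: sq => i; rewrite /blkc ler_norml; have /andP[? ?] := bK i.
  by move/andP: mK' => [? ?]; apply/andP; split; lra.
have -> : (n%:R * K%:R ^+ 2 * wave_rate al ^+ r) ^+ 2
  = (n%:R * K%:R ^+ 2) * (wave_rate al ^+ (2 * r) * (n%:R * K%:R ^+ 2)).
  by rewrite mulnC exprM; ring.
apply: ler_pM => //; rewrite ?dot_ge0//.
  by rewrite mulr_ge0 ?dot_ge0// exprn_ge0.
by rewrite ler_wpM2l// exprn_ge0.
Qed.

End RightInvariance.

(** * Exchanging cards of two different blocks *)

Section SwapCost.
Variables (R : realType) (n m K : nat).
Hypothesis m0 : (0 < m)%N.
Hypothesis mK : (m * K <= n)%N.
Hypothesis K0 : (0 < K)%N.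
Notation blk := (blk m K).
Notation pos := (pos m0 mK).

Variable p : 'S_n -> R.
Hypothesis p_left : block_inv m K p.
Hypothesis p_right : type_inv m K p.
Hypothesis p_incr : increasing p.

Variables I J : 'I_K.
Hypothesis IJ : I != J.

Let swap_term (l l' : 'I_m) : R :=
  \sum_x `|p (tperm (pos I l) (pos J l') * x)%g - p x|.

Lemma swap_term_eq l l' : swap_term l l' = swap_term l l.
Proof.
have [->//|ll] := eqVneq l' l.
pose h := tperm (pos J l') (pos J l).
have hB : h \in block_perms n m K by apply: block_perms_tperm; rewrite !blk_pos.
have hh : (h * h = 1)%g by rewrite tperm2.
rewrite /swap_term (reindex_inj (mulgI h)); apply: eq_bigr => x _ /=.
rewrite (p_left _ hB) -[p (tperm (pos I l) (pos J l') * _)%g](p_left _ hB) !mulgA.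
congr `|p (_ * _)%g - _|.
have -> : (h * tperm (pos I l) (pos J l') * h
  = tperm (h^-1 (pos I l)) (h^-1 (pos J l')))%g.
  by rewrite (mul_tperm_left h (pos I l)) -mulgA hh mulg1.
rewrite tpermV tpermL tpermD//.
  by apply/eqP => /pos_inj2[e _]; move: (IJ); rewrite e eqxx.
by apply/eqP => /pos_inj2[e _]; move: (IJ); rewrite e eqxx.
Qed.

(** For an increasing density every term of the Dirichlet form of the block
    statistic is nonnegative, so each pair of positions in different blocks
    can be kept separately; all matchings of two blocks contribute equally. *)
Lemma swap_cost_bound : (0 < n)%N ->
  m%:R * swap_cost m0 mK p I J
  <= 4 * n%:R * pairing p (addstat (blkc R n m K) (blkR R m K)).
Proof.
move=> n0; rewrite (addstat_dirichlet p (blkR R m K) (blkc_mean0 R m K n0)).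
pose D (a b : 'I_n) x : R := (p x - p (tperm a b * x)%g) *
  ((blkc R n m K a - blkc R n m K b) * (blkR R m K (x a) - blkR R m K (x b))).
have cc (a b : 'I_n) : blkc R n m K a - blkc R n m K b = (blk a)%:R - (blk b)%:R.
  by rewrite /blkc /blkR; ring.
have DE (a b : 'I_n) x : D a b x = `|p x - p (tperm a b * x)%g|
     * (`|(blk a)%:R - (blk b)%:R| * `|(blk (x a))%:R - (blk (x b))%:R|).
  rewrite /D cc /blkR.
  wlog ab : a b / (a < b)%N => [H|].
    case: (ltngtP a b) => [|ba|/val_inj ->]; first exact: H.
      have := H b a ba; rewrite (tpermC b a) [`|(blk b)%:R - _|]distrC.
      rewrite [`|(blk (x b))%:R - _|]distrC => <-.
      by congr (_ * _); rewrite -mulrNN !opprB.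
    by rewrite !subrr !normr0 mul0r !mulr0.
  have kab : (blk a)%:R - (blk b)%:R <= 0 :> R.
    by rewrite subr_le0 ler_nat blk_mono// ltnW.
  have xab : (x a != x b :> nat).
    by rewrite val_eqE (inj_eq perm_inj) -val_eqE /=; lia.
  rewrite (ler0_norm kab).
  have [h|h] : (x a < x b)%N \/ (x b < x a)%N by lia.
    have k' : (blk (x a))%:R - (blk (x b))%:R <= 0 :> R.
      by rewrite subr_le0 ler_nat blk_mono// ltnW.
    rewrite (ler0_norm k') ger0_norm ?mulrNN//.
    rewrite subr_ge0; apply: p_incr.
    have tt : (tperm a b * (tperm a b * x) = x)%g by rewrite mulgA tperm2 mul1g.
    rewrite -{1}tt; apply: above_tperm => //.
    by rewrite !permM tpermL tpermR.
  have k' : 0 <= (blk (x a))%:R - (blk (x b))%:R :> R.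
    by rewrite subr_ge0 ler_nat blk_mono// ltnW.
  have px : p x - p (tperm a b * x)%g <= 0.
    by rewrite subr_le0; apply: p_incr; exact: above_tperm.
  by rewrite (ger0_norm k') (ler0_norm px) -[LHS]mulrNN -mulNr.
have D0 (a b : 'I_n) x : 0 <= D a b x by rewrite DE !mulr_ge0.
apply: le_trans (_ : \sum_(l < m) \sum_(l' < m) \sum_x D (pos I l) (pos J l') x <= _).
  have -> : m%:R * swap_cost m0 mK p I J = \sum_(l < m) \sum_(l' < m) swap_term l l'.
    rewrite /swap_cost mulr_sumr; apply: eq_bigr => l _.
    under [RHS]eq_bigr do rewrite swap_term_eq.
    by rewrite sumr_const card_ord -[RHS]mulr_natl.
  apply: ler_sum => l _; apply: ler_sum => l' _; apply: ler_sum => x _.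
  rewrite DE distrC !blk_pos//.
  have gap (u v : nat) : u != v -> 1 <= `|u%:R - v%:R| :> R.
    move=> uv; have [h|h] : (u < v)%N \/ (v < u)%N by lia.
      rewrite distrC ger0_norm ?subr_ge0 ?ler_nat 1?ltnW//.
      by rewrite -natrB 1?ltnW// ler1n subn_gt0.
    rewrite ger0_norm ?subr_ge0 ?ler_nat 1?ltnW//.
    by rewrite -natrB 1?ltnW// ler1n subn_gt0.
  have [e|ne] := eqVneq (blk (x (pos I l))) (blk (x (pos J l'))).
    rewrite (_ : p (tperm _ _ * x)%g = p x) ?subrr ?normr0 ?mul0r//.
    apply: (same_types p_right) => i; rewrite permM.
    by case: tpermP => [->|->|].
  rewrite ler_peMr// -[leLHS]mulr1 ler_pM//; exact: gap.
rewrite /D; pose f (a b : 'I_n) := \sum_x D a b x.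
have f0 a b : 0 <= f a b by apply: sumr_ge0.
have sub (L : 'I_K) (F : 'I_n -> R) : (forall a, 0 <= F a) ->
    \sum_(l < m) F (pos L l) <= \sum_a F a.
  move=> F0.
  have inj : injective (pos L) by move=> l l' /pos_inj2[].
  rewrite -(big_imset F (h := pos L) (A := predT)) /=; last by move=> ? ? _ _ /inj.
  rewrite [leRHS](bigID (mem (pos L @: predT)%SET)) /= lerDl.
  exact: sumr_ge0.
apply: le_trans (_ : \sum_(l < m) \sum_b f (pos I l) b <= _).
  by apply: ler_sum => l _; apply: (sub J (f (pos I l))).
by apply: (sub I (fun a => \sum_b f a b)) => a; apply: sumr_ge0.
Qed.

End SwapCost.

(** * Sampling inside a block *)

Section Sampling.
Variables (R : realType) (n m K : nat).
Implicit Types (h k x : 'S_n) (w : 'I_n -> R) (Y : 'S_n -> R).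
Notation blk := (blk m K).
Notation block_perms := (block_perms n m K).

Variable c : nat.
Notation in_c := [pred i : 'I_n | blk i == c].
Let b : R := #|in_c|%:R.

Lemma sum_block_comp w h : h \in block_perms ->
  \sum_(i in in_c) w (h i) = \sum_(i in in_c) w i.
Proof.
move=> /block_permsP hB; rewrite [RHS](reindex_inj (@perm_inj _ h)).
by apply: eq_bigl => i; rewrite !inE hB.
Qed.

Definition blind Y := forall (p q : 'I_n) h, blk p = c -> blk q = c ->
  Y (tperm p q * h)%g = Y h.

(** All the positions of the block play the same part, and the total weight
    found there does not depend on the shuffle. *)
Lemma sample_one Y w (i : 'I_n) : blind Y -> blk i = c ->
  b * (\sum_(h in block_perms) Y h * w (h i))
  = (\sum_(i' in in_c) w i') * \sum_(h in block_perms) Y h.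
Proof.
move=> Yb ic.
transitivity (\sum_(i' in in_c) \sum_(h in block_perms) Y h * w (h i')).
  rewrite /b mulr_natl -sumr_const; apply: eq_bigr => i'; rewrite inE => /eqP i'c.
  have tB : tperm i i' \in block_perms by apply: block_perms_tperm; rewrite ic i'c.
  rewrite -(sum_block_perms_mull (fun h => Y h * w (h i')) tB).
  by apply: eq_bigr => h _; rewrite Yb// permM tpermR.
rewrite exchange_big mulr_sumr; apply: eq_bigr => h hB /=.
by rewrite -mulr_sumr sum_block_comp// mulrC.
Qed.

(** As for one position, among the remaining positions of the block. Since [w]
    only takes the values 0 and 1, the sum over them is the total minus one
    whenever the first position counts. *)
Lemma sample_two Y w (i k : 'I_n) : blind Y -> blk i = c -> blk k = c -> k != i ->
  (forall t, w t * w t = w t) ->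
  (b - 1) * (\sum_(h in block_perms) Y h * (w (h i) * w (h k)))
  = ((\sum_(i' in in_c) w i') - 1) * \sum_(h in block_perms) Y h * w (h i).
Proof.
move=> Yb ic kc ki w2.
have b1 : b - 1 = #|[pred k' in in_c | k' != i]|%:R.
  rewrite /b (cardD1 i) inE ic eqxx natrD [true%:R]/(1%:R) addrC addKr.
  by congr _%:R; apply: eq_card => k'; rewrite !inE andbC.
transitivity (\sum_(k' in [pred k' in in_c | k' != i])
    \sum_(h in block_perms) Y h * (w (h i) * w (h k'))).
  rewrite b1 mulr_natl -sumr_const; apply: eq_bigr => k'.
  rewrite !inE => /andP[/eqP k'c k'i].
  have tB : tperm k k' \in block_perms by apply: block_perms_tperm; rewrite kc k'c.
  rewrite -(sum_block_perms_mull (fun h => Y h * (w (h i) * w (h k'))) tB).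
  apply: eq_bigr => h _; rewrite Yb// !permM tpermR tpermD//.
rewrite exchange_big mulr_sumr; apply: eq_bigr => h hB /=.
rewrite -(sum_block_comp w hB) [in RHS](bigD1 i) ?inE ?ic//=.
rewrite -mulr_sumr -mulr_sumr.
set s' := \sum_(k' | _) _.
have := w2 (h i); set t := w (h i) => t2.
have -> : (t + s' - 1) * (Y h * t) = Y h * (t * t + s' * t - t) by ring.
by rewrite t2; ring.
Qed.

End Sampling.

Section Concentration.
Variables (R : realType) (n m K : nat).
Hypothesis m0 : (0 < m)%N.
Hypothesis mK : (m * K <= n)%N.
Hypothesis K0 : (0 < K)%N.
Notation blk := (blk m K).
Notation block_perms := (block_perms n m K).
Notation pos := (pos m0 mK).

Definition count_type (x : 'S_n) (I j : 'I_K) : nat :=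
  #|[set l | blk (x (pos I l)) == j]|.

Section FixedDeck.
Variables (x : 'S_n) (I J j j' : 'I_K).
Hypothesis IJ : (I < J)%N.
Hypothesis jj : (j < j')%N.

Let Z (h : 'S_n) (l : 'I_m) : R := (blk (x (h (pos I l))) == j)%:R.
Let w (i : 'I_n) : R := (blk (x i) == j')%:R.
Let X (h : 'S_n) : R := \sum_l Z h l * w (h (pos J l)).
Let B : R := #|block_perms|%:R.
Let b : R := #|[pred i : 'I_n | blk i == J]|%:R.
Let u : R := (count_type x I j)%:R.
Let v : R := \sum_(i in [pred i : 'I_n | blk i == J]) w i.

Let b0 : 0 < b.
Proof.
rewrite ltr0n; apply/card_gt0P; exists (pos J (Ordinal m0)).
by rewrite inE blk_pos.
Qed.
Let B0 : 0 < B. Proof. exact: card_block_perms_gt0. Qed.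

Let v0 : 0 <= v. Proof. by apply: sumr_ge0 => i _; rewrite ler0n. Qed.
Let u0 : 0 <= u. Proof. by rewrite ler0n. Qed.

Let vb : v <= b.
Proof.
rewrite /v /b -sum1_card natr_sum; apply: ler_sum => i _.
by rewrite ler_nat leq_b1.
Qed.

Let Z2 h l : Z h l * Z h l = Z h l.
Proof. by rewrite /Z -natrM mulnb andbb. Qed.
Let w2 i : w i * w i = w i.
Proof. by rewrite /w -natrM mulnb andbb. Qed.

Let IK : (I.+1 < K)%N. Proof. by have := ltn_ord J; lia. Qed.

Let sumZ h : h \in block_perms -> \sum_l Z h l = u.
Proof.
move=> hB; pose F (i : 'I_n) : R := (blk (x i) == j)%:R.
have inj : injective (pos I) by move=> l l' /pos_inj2[].
have red (G : 'I_n -> R) : \sum_l G (pos I l) = \sum_(i in [pred i : 'I_n | blk i == I]) G i.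
  rewrite -(big_imset G (h := pos I) (A := predT)) /=; last by move=> ? ? _ _ /inj.
  apply: eq_bigl => i; rewrite inE; apply/imsetP/eqP => [[l _ ->]|iI].
    by rewrite blk_pos.
  by have [l ->] := pos_surj m0 mK IK iI; exists l.
rewrite (red (fun i => F (h i))) sum_block_comp// -red /u /count_type -sum1_card natr_sum.
rewrite [RHS]big_mkcond; apply: eq_bigr => l _ /=; rewrite /F inE.
by case: ifP.
Qed.

Let Zblind l : blind m K J (fun h => Z h l).
Proof.
move=> p q h pJ qJ; rewrite /Z permM tpermD//.
  by apply: contraTneq IJ => e; rewrite -pJ e blk_pos ltnn.
by apply: contraTneq IJ => e; rewrite -qJ e blk_pos ltnn.
Qed.

Let ZZblind l l' : blind m K J (fun h => Z h l * Z h l').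
Proof. by move=> p q h pJ qJ; rewrite !(@Zblind _ p q h pJ qJ). Qed.

Let S1 : \sum_(h in block_perms) X h = u * v / b * B.
Proof.
have -> : \sum_(h in block_perms) X h = \sum_l v / b * \sum_(h in block_perms) Z h l.
  rewrite exchange_big; apply: eq_bigr => l _ /=.
  have := sample_one w (@Zblind l) (blk_pos m0 mK J l); rewrite -/b -/v => e.
  apply: (mulfI (lt0r_neq0 b0)); rewrite e; field; exact: lt0r_neq0.
rewrite -mulr_sumr exchange_big /= (eq_bigr _ sumZ) sumr_const -/B -[_ *+ _]mulr_natr.
by rewrite -/B; ring.
Qed.

Let S2 : \sum_(h in block_perms) X h ^+ 2 <= u * v / b * B + (u * v / b) ^+ 2 * B.
Proof.
pose r := v / b.
have r0 : 0 <= r by rewrite divr_ge0// ltW.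
have D l l' : \sum_(h in block_perms)
     (Z h l * w (h (pos J l))) * (Z h l' * w (h (pos J l')))
   <= (if l' == l then \sum_(h in block_perms) Z h l * w (h (pos J l)) else 0)
      + r ^+ 2 * \sum_(h in block_perms) Z h l * Z h l'.
  have [->|ll] := eqVneq l' l.
    rewrite -[leLHS]addr0; apply: lerD.
      rewrite le_eqVlt; apply/orP; left; apply/eqP; apply: eq_bigr => h _.
      by rewrite mulrACA Z2 w2.
    rewrite mulr_ge0 ?sqr_ge0//; apply: sumr_ge0 => h _.
    by rewrite /Z mulr_ge0.
  rewrite add0r.
  have pp : pos J l' != pos J l.
    by apply: contraNneq ll => /pos_inj2[_ ->].
  have e1 := sample_one w (@ZZblind l l') (blk_pos m0 mK J l).
  have e2 := sample_two (@ZZblind l l') (blk_pos m0 mK J l) (blk_pos m0 mK J l') pp w2.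
  rewrite -/b -/v in e1 e2.
  set A := \sum_(h in _) _; set C := \sum_(h in _) _.
  set D := \sum_(h in _) _ in e1 e2.
  have AE : A = \sum_(h in block_perms) Z h l * Z h l' * (w (h (pos J l)) * w (h (pos J l'))).
    by apply: eq_bigr => h _; rewrite mulrACA.
  rewrite -AE in e2; rewrite -/C in e1.
  have C0 : 0 <= C by apply: sumr_ge0 => h _; rewrite /Z mulr_ge0.
  have b2 : 2 <= b.
    rewrite ler_nat (cardD1 (pos J l)) (cardD1 (pos J l')) !inE !blk_pos eqxx.
    by rewrite pp.
  have DE : D = r * C.
    rewrite /r; apply: (mulfI (lt0r_neq0 b0)); rewrite e1; field.
    exact: lt0r_neq0.
  have b1 : 0 < b - 1 by lra.
  rewrite -(ler_pM2l b1) e2 DE.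
  have -> : (b - 1) * (r ^+ 2 * C) = (b - 1) * r * (r * C) by ring.
  apply: ler_wpM2r; first by apply: mulr_ge0.
  have -> : (b - 1) * r = (b - 1) * v / b by rewrite /r mulrA.
  by rewrite ler_pdivlMr//; have := vb; lra.
have XE h : X h ^+ 2 = \sum_l \sum_l' (Z h l * w (h (pos J l))) * (Z h l' * w (h (pos J l'))).
  by rewrite expr2 /X mulr_suml; apply: eq_bigr => l _; rewrite mulr_sumr.
under eq_bigr do rewrite XE.
rewrite exchange_big /=; under eq_bigr do rewrite exchange_big /=.
apply: le_trans (ler_sum _ (fun l _ => ler_sum _ (fun l' _ => D l l'))) _.
under eq_bigr do rewrite big_split /=.
rewrite big_split /=; apply: lerD.
  rewrite -S1 [leRHS]exchange_big /= le_eqVlt; apply/orP; left; apply/eqP.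
  by apply: eq_bigr => l _; rewrite -big_mkcond /= big_pred1_eq.
under eq_bigr do rewrite -mulr_sumr exchange_big /=.
rewrite -mulr_sumr exchange_big /= (eq_bigr (fun=> u ^+ 2)) => [|h hB].
  rewrite sumr_const -/B -[_ *+ _]mulr_natr -/B /r.
  by rewrite le_eqVlt; apply/orP; left; apply/eqP; ring.
by under eq_bigr do rewrite -mulr_sumr sumZ//; rewrite -mulr_suml sumZ// expr2.
Qed.

Let lanes_ge h : X h <= #|lanes m0 mK K0 I J (h * x)%g [:: (j, j')]|%:R.
Proof.
rewrite -sum1_card natr_sum [leRHS]big_mkcond /=; apply: ler_sum => l _.
rewrite !inE /Z /w -natrM mulnb; case: ifP => [_|]; first by rewrite ler_nat leq_b1.
rewrite /lane_code /card_type !permM => /negbT h1.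
case: andP => // -[/eqP e1 /eqP e2]; case/negP: h1.
have -> : Ordinal (blk_lt m (x (h (pos I l))) K0) = j by apply: val_inj.
have -> : Ordinal (blk_lt m (x (h (pos J l))) K0) = j' by apply: val_inj.
by rewrite ltnW.
Qed.

(** The number of lanes with types [j] and [j'] has a hypergeometric law,
    whose variance is at most its mean; the conclusion is Chebyshev's
    inequality. *)
Lemma few_lanes (d0 : nat) : (0 < d0)%N -> 2 * d0%:R <= u * v / b ->
  block_avg m K (fun y => (#|lanes m0 mK K0 I J y [:: (j, j')]| < d0)%:R : R) x
  <= 2 / d0%:R.
Proof.
move=> d00 hd; set mu := u * v / b in hd.
have d0R : 0 < d0%:R :> R by rewrite ltr0n.
have mu0 : 0 < mu by lra.
rewrite /block_avg ler_pdivrMr// -/B.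
pose bad (y : 'S_n) : R := (#|lanes m0 mK K0 I J y [:: (j, j')]| < d0)%:R.
rewrite -[X in X <= _]/(\sum_(h in block_perms) bad (h * x)%g).
have C h : bad (h * x)%g * (mu / 2) ^+ 2 <= X h ^+ 2 - 2 * mu * X h + mu ^+ 2.
  have -> : X h ^+ 2 - 2 * mu * X h + mu ^+ 2 = (mu - X h) ^+ 2 by ring.
  rewrite /bad; case: ltnP => hl; last by rewrite mul0r sqr_ge0.
  rewrite mul1r; have := lanes_ge h => h1.
  have h2 : #|lanes m0 mK K0 I J (h * x)%g [:: (j, j')]|%:R <= d0%:R :> R.
    by rewrite ler_nat ltnW.
  rewrite lerXn2r ?nnegrE; lra.
have : (\sum_(h in block_perms) bad (h * x)%g) * (mu / 2) ^+ 2 <= mu * B.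
  rewrite mulr_suml; apply: le_trans (ler_sum _ (fun h _ => C h)) _.
  rewrite big_split sumrB /= -mulr_sumr S1 sumr_const -/B -[_ *+ _]mulr_natr -/B -/mu.
  by have := S2; rewrite -/mu => h; lra.
set s := \sum_(h in _) _ => hs.
have s0 : 0 <= s by apply: sumr_ge0 => h _; rewrite /bad.
have : s * mu <= 4 * B.
  rewrite -(ler_pM2r mu0).
  have -> : s * mu * mu = 4 * (s * (mu / 2) ^+ 2) by field.
  have -> : 4 * B * mu = 4 * (mu * B) by ring.
  by rewrite ler_pM2l.
rewrite mulrAC ler_pdivlMr// => h4.
have := ler_wpM2l s0 hd; lra.
Qed.

Lemma count_type_le_v : (count_type x J j')%:R <= v.
Proof.
have inj : injective (pos J) by move=> l l' /pos_inj2[].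
rewrite /count_type -sum1_card natr_sum /v.
apply: le_trans (_ : \sum_(i in (pos J @: predT)%SET) w i <= _).
  rewrite (big_imset w (h := pos J) (A := predT)) /=; last by move=> ? ? _ _ /inj.
  rewrite [leLHS]big_mkcond /=; apply: ler_sum => l _; rewrite !inE /w.
  by case: ifP.
rewrite [leRHS](bigID (mem (pos J @: predT)%SET)) /= -[leLHS]addr0.
apply: lerD; last by apply: sumr_ge0 => i _; rewrite ler0n.
rewrite le_eqVlt; apply/orP; left; apply/eqP; apply: eq_bigl => i.
rewrite inE; apply/idP/andP => [|[]//] iI; split=> //.
by case/imsetP: iI => l _ ->; rewrite blk_pos.
Qed.

Lemma few_lanes_count (d0 N : nat) (tau : R) : (0 < d0)%N -> 0 <= tau ->
  (#|[pred i : 'I_n | blk i == J]| <= N)%N -> 2 * d0%:R * N%:R <= tau ^+ 2 ->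
  tau <= (count_type x I j)%:R -> tau <= (count_type x J j')%:R ->
  block_avg m K (fun y => (#|lanes m0 mK K0 I J y [:: (j, j')]| < d0)%:R : R) x
  <= 2 / d0%:R.
Proof.
move=> d00 t0 bN htau tu tv; apply: few_lanes => //.
rewrite ler_pdivlMr//.
have bN' : b <= N%:R by rewrite ler_nat.
apply: le_trans (_ : 2 * d0%:R * N%:R <= _); first by rewrite ler_wpM2l// mulr_ge0.
apply: le_trans htau _; rewrite expr2.
apply: ler_pM => //; apply: le_trans tv _; exact: count_type_le_v.
Qed.

End FixedDeck.


Definition bad_lanes (I J j j' : 'I_K) (d0 : nat) (y : 'S_n) : R :=
  (#|lanes m0 mK K0 I J y [:: (j, j')]| < d0)%:R.
Definition low_count (I j : 'I_K) (tau : R) (y : 'S_n) : R :=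
  ((count_type y I j)%:R < tau)%R%:R.

(** Conditioning on the arrangement before the last shuffle of the blocks: few
    lanes occur either because a type is rare in its block, or by bad luck in
    the shuffle. *)
Lemma bad_lanes_le (r : nat) (I J j j' : 'I_K) (d0 N : nat) (tau : R) :
  (I < J)%N -> (j < j')%N -> (0 < d0)%N -> 0 <= tau ->
  (#|[pred i : 'I_n | blk i == J]| <= N)%N -> 2 * d0%:R * N%:R <= tau ^+ 2 ->
  \sum_(x | (#|lanes m0 mK K0 I J x [:: (j, j')]| < d0)%N) block_law R m K r x
  <= 2 / d0%:R + pairing (mid_law R m K r) (low_count I j tau)
     + pairing (mid_law R m K r) (low_count J j' tau).
Proof.
move=> IJ jj d00 t0 bN htau.
have -> : \sum_(x | (#|lanes m0 mK K0 I J x [:: (j, j')]| < d0)%N) block_law R m K r x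
  = pairing (mid_law R m K r) (block_avg m K (bad_lanes I J j j' d0)).
  rewrite -pairing_block_avg -/(block_law R m K r) /pairing big_mkcond /=.
  apply: eq_bigr => x _; rewrite /bad_lanes.
  by case: ifP; rewrite ?mulr1 ?mulr0.
have -> : 2 / d0%:R + pairing (mid_law R m K r) (low_count I j tau)
     + pairing (mid_law R m K r) (low_count J j' tau)
  = pairing (mid_law R m K r)
     (fun x => 2 / d0%:R + low_count I j tau x + low_count J j' tau x).
  have e : 2 / d0%:R = \sum_(x : 'S_n) mid_law R m K r x * (2 / d0%:R) :> R.
    by rewrite -mulr_suml sum_mid_law mul1r.
  rewrite [in LHS]e /pairing -!big_split /=.
  by apply: eq_bigr => x _; rewrite !mulrDr.
apply: ler_sum => x _; apply: ler_wpM2l; first exact: mid_law_ge0.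
have b1 : block_avg m K (bad_lanes I J j j' d0) x <= 1.
  rewrite /block_avg ler_pdivrMr ?card_block_perms_gt0// mul1r -sum1_card natr_sum.
  by apply: ler_sum => h _; rewrite /bad_lanes ler_nat leq_b1.
have d1 : 0 <= 2 / d0%:R :> R by rewrite divr_ge0.
rewrite /low_count; case: ltP => hu.
  by case: ltP => hv /=; lra.
case: ltP => hv; first by rewrite /=; lra.
rewrite /= !addr0; exact: few_lanes_count bN htau hu hv.
Qed.

End Concentration.

(** * Concentration of the type counts *)

Section Bump.
Variables (R : realType) (n m : nat).
Hypothesis m2 : (2 <= m)%N.

(** A parabola on the [m] sites starting at [o]; both truncated subtractions
    make it vanish elsewhere. *)
Definition bump (o i : nat) : R := ((i - o) * (m - (i - o)))%:R / m%:R ^+ 2.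

Let mp : 0 < m%:R :> R. Proof. by rewrite ltr0n; lia. Qed.

Lemma bump_ge0 o i : 0 <= bump o i.
Proof. by rewrite divr_ge0 ?exprn_ge0. Qed.

Lemma bump_le1 o i : bump o i <= 1.
Proof.
rewrite ler_pdivrMr ?exprn_gt0// mul1r -natrX ler_nat -mulnn.
have [h|h] := leqP (i - o) m; last by rewrite (_ : (m - (i - o)) = 0)%N ?muln0//; lia.
by apply: leq_mul => //; lia.
Qed.

Lemma bump_out o i : ~~ ((o <= i) && (i < o + m))%N -> bump o i = 0.
Proof.
move=> h; rewrite /bump (_ : ((i - o) * (m - (i - o)) = 0)%N) ?mul0r//.
have [->//|h2] : (i - o = 0)%N \/ (m - (i - o) = 0)%N by lia.
by rewrite h2 muln0.
Qed.

Lemma bump_lip o : lip n (m%:R^-1) (bump o).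
Proof.
move=> e en; rewrite /grad /bump -mulrBl normrM [`|_^-1|]gtr0_norm ?invr_gt0 ?exprn_gt0//.
have -> : m%:R^-1 = m%:R / m%:R ^+ 2 :> R by field; exact: lt0r_neq0.
apply: ler_wpM2r; first by rewrite invr_ge0 exprn_ge0.
rewrite ler_norml.
set A := ((e.+1 - o) * _)%N; set B := ((e - o) * _)%N.
have [h1 h2] : (A <= B + m)%N /\ (B <= A + m)%N.
  rewrite /A /B; have [h|h] := leqP o e; last first.
    have -> : (e - o = 0)%N by apply/eqP; rewrite subn_eq0 ltnW.
    have -> : (e.+1 - o = 0)%N by apply/eqP; rewrite subn_eq0.
    by rewrite !mul0n leq0n.
  rewrite subSn//; set y := (e - o)%N.
  have [hy|hy] := leqP m y.
    have -> : (m - y = 0)%N by apply/eqP; rewrite subn_eq0.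
    have -> : (m - y.+1 = 0)%N by apply/eqP; rewrite subn_eq0 ltnW.
    by rewrite !muln0 leq0n.
  have -> : (m - y = (m - y.+1).+1)%N by rewrite -subSn// subSS.
  set z := (m - y.+1)%N.
  have ym : (y <= m)%N by exact: ltnW.
  have zm : (z <= m)%N by exact: leq_subr.
  rewrite mulSn mulnS; clearbody y z; split.
    by rewrite addnC -addnA addnCA leq_add2l; apply: leq_trans zm (leq_addl _ _).
  by rewrite addnC leq_add// leq_addl.
apply/andP; split; first by rewrite lerBrDr addrC lerBlDr -natrD ler_nat.
by rewrite lerBlDr -natrD ler_nat addnC.
Qed.

(** The sum is [(m ^ 2 - 1) / (6 * m)]. *)
Lemma sum_bump o : (o + m <= n)%N -> m%:R / 8 <= \sum_(i < n) bump o i.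
Proof.
move=> omn.
have inj : injective (fun l : 'I_m =>
    Ordinal (leq_trans (ltac:(by rewrite ltn_add2l) : (o + l < o + m)%N) omn)).
  by move=> l l' /(congr1 val)/= /addnI /val_inj.
move: inj; set q := (fun l : 'I_m => _) => inj.
apply: le_trans (_ : \sum_(l < m) bump o (q l) <= _); last first.
  rewrite -(big_imset (fun i : 'I_n => bump o i) (h := q) (A := predT)) /=;
    last by move=> ? ? _ _ /inj.
  rewrite [leRHS](bigID (mem (q @: predT)%SET)) /= lerDl.
  by apply: sumr_ge0 => i _; exact: bump_ge0.
have E k : (k <= m)%N ->
    6 * \sum_(l < k) (l * (m - l))%:R = k%:R * (k%:R - 1) * (3 * m%:R - 2 * k%:R + 1) :> R.
  elim: k => [|k IH] km; first by rewrite big_ord0 !mul0r mulr0.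
  rewrite big_ord_recr /= mulrDr IH ?(ltnW km)// natrM natrB ?(ltnW km)//.
  by rewrite -[k.+1%:R]natr1; ring.
have -> : \sum_(l < m) bump o (q l) = (\sum_(l < m) (l * (m - l))%:R) / m%:R ^+ 2.
  by rewrite mulr_suml; apply: eq_bigr => l _; rewrite /bump /= addKn.
rewrite ler_pdivlMr ?exprn_gt0//.
have e := E m (leqnn _).
have m2R : 2 <= m%:R :> R by rewrite ler_nat.
rewrite -(@ler_pM2l _ 6)// e.
have -> : m%:R * (m%:R - 1) * (3 * m%:R - 2 * m%:R + 1) = m%:R * (m%:R ^+ 2 - 1) :> R by ring.
have -> : 6 * (m%:R / 8 * m%:R ^+ 2) = m%:R * (3 / 4 * m%:R ^+ 2) :> R by field.
rewrite ler_pM2l//.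
have : 2 ^+ 2 <= m%:R ^+ 2 :> R by rewrite lerXn2r ?nnegrE.
lra.
Qed.

End Bump.

Lemma round0 (R : realType) n (f : 'S_n -> R) : round predT 0 f = f.
Proof. by apply/funext => x; rewrite /round /=; lra. Qed.

Lemma round1_0 (R : realType) n (g : nat -> R) : round1 n predT 0 g = g.
Proof. by apply/funext => x; rewrite /round1 /=; lra. Qed.

(** Subtracting the mean leaves a function to which the spectral gap applies. *)
Lemma dot_equidist (R : realType) n al r (a f : nat -> R) : (1 < n)%N -> 0 < al ->
  al <= cos (al * n%:R / 2) -> al * n%:R / 2 <= pi -> 0 <= cos al ->
  (forall i, 0 <= a i <= 1) -> (forall i, 0 <= f i <= 1) ->
  (\sum_(i < n) f i) * (\sum_(i < n) a i) / n%:R - n%:R * wave_rate al ^+ r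
  <= dot n a (iter r (round1 n predT n.-1) f).
Proof.
move=> n1 a0 ab bpi ca a01 f01.
have np : 0 < n%:R :> R by rewrite ltr0n ltnW.
set fb := (\sum_(i < n) f i) / n%:R.
have fb01 : 0 <= fb <= 1.
  rewrite /fb divr_ge0//=; last by apply: sumr_ge0 => i _; have /andP[] := f01 i.
  rewrite ler_pdivrMr// mul1r; apply: le_trans (_ : \sum_(i < n) (1 : R) <= _).
    by apply: ler_sum => i _; have /andP[] := f01 i.
  by rewrite sumr_const card_ord.
pose g i := f i - fb.
have g0 : dot n (fun=> 1) g = 0.
  rewrite /dot; under eq_bigr do rewrite mul1r.
  rewrite sumrB sumr_const card_ord -[_ *+ n]mulr_natr divfK ?subrr//.
  exact: lt0r_neq0.
have fE : f = fun i => 1 * g i + fb by apply/funext => i; rewrite /g; ring.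
have -> : dot n a (iter r (round1 n predT n.-1) f)
  = dot n a (iter r (round1 n predT n.-1) g) + fb * \sum_(i < n) a i.
  rewrite {1}fE iter_round1_lin iter_round1_const dot_lin mul1r; congr (_ + _).
  by rewrite /dot mulr_sumr; apply: eq_bigr => i _; rewrite mulrC.
have H := spectral_gap r a n1 a0 ab bpi ca g0.
set D := dot n a _ in H *.
suff : `|D| <= n%:R * wave_rate al ^+ r.
  by rewrite ler_norml => /andP[h _]; rewrite /fb mulrAC; lra.
have w0 := wave_rate_ge0 ca.
rewrite -ler_sqr ?nnegrE//; last by rewrite mulr_ge0 ?exprn_ge0.
rewrite real_normK ?num_real//; apply: le_trans H _.
have sq (b : nat -> R) : (forall i, `|b i| <= 1) -> dot n b b <= n%:R.
  move=> b1; apply: le_trans (_ : \sum_(i < n) (1 : R) <= _); last first.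
    by rewrite sumr_const card_ord.
  by apply: ler_sum => i _; rewrite -expr2 -real_normK ?num_real// expr_le1.
have s1 : dot n a a <= n%:R.
  by apply: sq => i; have /andP[? ?] := a01 i; rewrite ger0_norm.
have s2 : dot n g g <= n%:R.
  apply: sq => i; rewrite /g ler_norml; have /andP[? ?] := f01 i.
  by move/andP: fb01 => [? ?]; apply/andP; split; lra.
have -> : (n%:R * wave_rate al ^+ r) ^+ 2 = n%:R * (wave_rate al ^+ (2 * r) * n%:R).
  by rewrite mulnC exprM; ring.
apply: ler_pM => //; rewrite ?dot_ge0//.
  by rewrite mulr_ge0 ?dot_ge0// exprn_ge0.
by rewrite ler_wpM2l// exprn_ge0.
Qed.

Section Tail.
Variables (R : realType) (n m K : nat).
Hypothesis m2 : (2 <= m)%N.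
Hypothesis m0 : (0 < m)%N.
Hypothesis mK : (m * K <= n)%N.
Hypothesis K0 : (0 < K)%N.

(** Comparison with the smooth statistic that weighs positions and types by
    bumps, whose variance is controlled. *)
Lemma low_count_le (r : nat) (al tau : R) (I j : 'I_K) : 0 < al -> (1 < n)%N ->
  al <= cos (al * n%:R / 2) -> al * n%:R / 2 <= pi -> 0 <= cos al ->
  n%:R * wave_rate al ^+ r <= m%:R ^+ 2 / (128 * n%:R) ->
  tau = m%:R ^+ 2 / (256 * n%:R) ->
  pairing (mid_law R m K r) (low_count m0 mK I j tau) * tau ^+ 2
  <= r.+1%:R * (16 * n%:R / m%:R ^+ 2 + 4 * n%:R ^+ 2 / m%:R ^+ 4).
Proof.
move=> a0 n1 ab bpi ca hw tauE.
have mp : 0 < m%:R :> R by rewrite ltr0n.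
have np : 0 < n%:R :> R by rewrite ltr0n ltnW.
have c256 : 0 < 256 :> R by rewrite ltr0n.
have tau0 : 0 < tau.
  by rewrite tauE; exact: (divr_gt0 (exprn_gt0 2 mp) (mulr_gt0 c256 np)).
pose f := bump R m (I * m); pose a := bump R m (j * m).
have b01 o i : 0 <= bump R m o i <= 1 by rewrite bump_ge0 bump_le1.
have om (L : 'I_K) : (L * m + m <= n)%N.
  have := ltn_ord L => h; have : (L.+1 * m <= K * m)%N by rewrite leq_mul2r h orbT.
  by rewrite mulSn; lia.
set phi := addstat f a : 'S_n -> R.
have phi_le x : phi x <= (count_type m0 mK x I j)%:R.
  rewrite /count_type -sum1_card natr_sum.
  have inj : injective (pos m0 mK I) by move=> l l' /pos_inj2[].
  apply: le_trans (_ : \sum_(i in (pos m0 mK I @: predT)%SET) f i * a (x i) <= _).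
    rewrite /phi /addstat [leRHS]big_mkcond; apply: ler_sum => i _.
    case: ifPn => // hi; rewrite /f bump_out ?mul0r//.
    apply: contra hi => /andP[h1 h2]; have lm : (i - I * m < m)%N by lia.
    by apply/imsetP; exists (Ordinal lm) => //; apply: val_inj => /=; lia.
  rewrite (big_imset (fun i : 'I_n => f i * a (x i)) (h := pos m0 mK I)
    (A := predT)) /=; last by move=> ? ? _ _ /inj.
  rewrite [leRHS]big_mkcond /=; apply: ler_sum => l _; rewrite inE.
  case: ifPn => [_|hx].
    by rewrite -[leRHS]mulr1 ler_pM ?bump_ge0 ?bump_le1.
  rewrite /a bump_out ?mulr0//; apply: contra hx => /andP[h1 h2].
  rewrite /blk; have jK := ltn_ord j.
  have -> : (x (pos m0 mK I l) %/ m = j)%N.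
    have -> : (x (pos m0 mK I l) = j * m + (x (pos m0 mK I l) - j * m) :> nat)%N by lia.
    by rewrite divnMDl// divn_small ?addn0//; lia.
  by apply/eqP; lia.
(* each bump has mass at least [m / 8], so the mean is at least [m ^ 2 / (64 n)];
   half of it covers the distance to equilibrium, and half of the rest is the
   margin used in Chebyshev's inequality *)
pose mu := dot n a (iter r (round1 n predT n.-1) f).
have mu_ge : 2 * tau <= mu.
  apply: le_trans (dot_equidist r n1 a0 ab bpi ca (b01 _) (b01 _)).
  have s1 := sum_bump R m2 (om I); have s2 := sum_bump R m2 (om j).
  set sf := \sum_(i < n) _ in s1 *; set sa := \sum_(i < n) _ in s2 *.
  have h : (m%:R / 8) * (m%:R / 8) / n%:R <= sf * sa / n%:R.
    by rewrite ler_wpM2r ?invr_ge0 ?(ltW np)// ler_pM// divr_ge0.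
  have e1 : m%:R / 8 * (m%:R / 8) / n%:R = 4 * tau by rewrite tauE; field; exact: lt0r_neq0.
  have e2 : m%:R ^+ 2 / (128 * n%:R) = 2 * tau by rewrite tauE; field; exact: lt0r_neq0.
  by rewrite e1 in h; rewrite e2 in hw; lra.
have lowT : type_inv m K (low_count m0 mK I j tau).
  move=> x k /block_permsP kB; rewrite /low_count /count_type.
  congr ((_%:R < _)%R : nat)%:R; apply: eq_card => l; by rewrite !inE permM kB.
rewrite pairing_mid_law_type//.
pose q x := tau ^+ 2 * low_count m0 mK I j tau x + 0.
have -> : iter r (round predT n.-1) (low_count m0 mK I j tau) 1%g * tau ^+ 2
  = iter r (round predT n.-1) q 1%g.
  by rewrite /q iter_round_lin iter_round_const addr0 mulrC.
have qle x : q x <= 1 * (phi x ^+ 2) + (- (2 * mu) * phi x + mu ^+ 2).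
  have -> : 1 * (phi x ^+ 2) + (- (2 * mu) * phi x + mu ^+ 2) = (mu - phi x) ^+ 2 by ring.
  rewrite /q addr0 /low_count; case: ltP => h; last by rewrite mulr0 sqr_ge0.
  rewrite mulr1 lerXn2r ?nnegrE//; have := phi_le x; lra.
apply: le_trans (iter_round_le r predT n.-1 qle _) _.
rewrite iter_round_lin mul1r iter_round_lin iter_round_const iter_round_addstat addstat1 -/mu.
have ip : 0 <= m%:R^-1 :> R by rewrite invr_ge0 ltW.
have := @addstat_variance R n r 0 f a m%:R^-1 m%:R^-1 (leq0n _) ip ip
  (bump_lip R m2 _) (bump_lip R m2 _).
rewrite round0 round1_0 -/mu -/phi => H.
have {}H := H (fun i => _).
apply: le_trans (_ : mu ^+ 2 + r.+1%:R * (16 * n%:R * m%:R^-1 ^+ 2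
  + 4 * (n%:R * (m%:R^-1 * m%:R^-1)) ^+ 2) + (- (2 * mu) * mu + mu ^+ 2) <= _).
  rewrite lerD2r; apply: H => i.
  by rewrite ger0_norm ?bump_ge0// bump_le1.
rewrite le_eqVlt; apply/orP; left; apply/eqP; field; exact: lt0r_neq0.
Qed.

End Tail.

(** * Three phases *)

Section DeckLaw.
Variables (R : realType) (n : nat).
Implicit Types (f p : 'S_n -> R).
Notation M := (round (R := R) (n := n) predT n.-1).
Notation u := (#|{perm 'I_n}|%:R^-1 : R).

(** A round is an average of permutations of the arrangements. *)
Lemma iter_round_l1 r S f :
  \sum_x `|iter r (round S n.-1) f x| <= \sum_x `|f x|.
Proof.
pose s x : R := Num.sg (iter r (round S n.-1) f x).
have s1 x : `|iter r (round S n.-1) s x| <= 1.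
  have h1 y : s y <= 1 by apply: le_trans (ler_norm _) _; rewrite normr_sg; case: eqP.
  have h2 y : - 1 <= s y.
    by rewrite lerNl; apply: le_trans (ler_norm _) _; rewrite normrN normr_sg; case: eqP.
  have := iter_round_le r S n.-1 h1 x; have := iter_round_le r S n.-1 h2 x.
  by rewrite !iter_round_const ler_norml => -> ->.
have -> : \sum_x `|iter r (round S n.-1) f x| = pairing f (iter r (round S n.-1) s).
  by rewrite -pairing_iter_round; apply: eq_bigr => x _; rewrite normrEsg mulrC.
apply: ler_sum => x _; apply: le_trans (ler_norm _) _.
by rewrite normrM ler_piMr.
Qed.

Lemma iter_roundB r S f g x :
  iter r (round S n.-1) (fun y => f y - g y) x
  = iter r (round S n.-1) f x - iter r (round S n.-1) g x.
Proof.
have -> : (fun y => f y - g y) = fun y => (-1) * g y + f y.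
  by apply/funext => y; rewrite mulN1r addrC.
by rewrite iter_round_lin mulN1r addrC.
Qed.

Lemma sum_iter_round r S f :
  \sum_x iter r (round S n.-1) f x = \sum_x f x.
Proof. by rewrite -!pairing1 pairing_iter_round iter_round_const. Qed.

Lemma sum_point_mass : \sum_x point_mass R (n := n) x = 1.
Proof. by rewrite -pairing1 pairing_point_mass. Qed.

Lemma sum_uniform : \sum_(x : 'S_n) u = 1.
Proof.
rewrite sumr_const -[_ *+ _]mulr_natl divff// pnatr_eq0 -lt0n.
by apply/card_gt0P; exists 1%g.
Qed.

Lemma sum_sub_uniform p : \sum_x p x = 1 -> \sum_x (p x - u) = 0.
Proof. by move=> p1; rewrite sumrB p1 sum_uniform subrr. Qed.

Lemma cat_max_dist_rounds t : (1 < n)%N -> (0 < t)%N ->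
  cat_max_dist R n (t * n.-1)
  = 2^-1 * \sum_x `|iter t M (point_mass R (n := n)) x - u|.
Proof.
move=> n1 t0; rewrite cat_max_distE /cat_dist /tv_dist; congr (_ * _).
apply: eq_bigr => y _; congr `|_ - _|.
pose f (z : 'S_n) : R := (z == y)%:R.
have pick (F : 'S_n -> R) : \sum_z F z * f z = F y.
  rewrite (bigD1 y) //= /f eqxx mulr1 big1 ?addr0// => z /negbTE ->.
  by rewrite mulr0.
have n0 : (0 < n.-1 <= n.-1)%N by lia.
have := sum_cat_prob_round 1%g t.-1 f n1 n0.
rewrite pick -iterSr prednK// -(pairing_point_mass (iter t M f)).
rewrite -pairing_iter_round /pairing pick => <-.
by rewrite -mulSnr prednK.
Qed.

End DeckLaw.

Section Phases.
Variables (R : realType) (n m K N : nat).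
Hypothesis n1 : (1 < n)%N.
Hypothesis m2 : (2 <= m)%N.
Hypothesis m0 : (0 < m)%N.
Hypothesis mK : (m * K <= n)%N.
Hypothesis K0 : (0 < K)%N.
Hypothesis N4 : (4 <= N)%N.
Hypothesis blk_len : forall p, (p < n)%N -> (p - blk m K p * m < N)%N.
Notation M := (round (R := R) (n := n) predT n.-1).
Notation u := (#|{perm 'I_n}|%:R^-1 : R).
Notation delta := (@point_mass R n).
Notation block_law := (@block_law R n m K).

Lemma block_law_increasing r : increasing (block_law r).
Proof.
apply: (block_avg_increasing N4 blk_len); apply: iter_round_increasing.
by apply: (block_avg_increasing N4 blk_len); exact: point_mass_increasing.
Qed.

(** Letting only the edges inside the blocks act at the beginning and at the
    end slows mixing down, and amounts to shuffling every block exactly. *)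
Lemma three_phases a b :
  \sum_x `|iter (a + (b + a)) M delta x - u|
  <= \sum_x `|block_law b x - u| + 2 * block_error R n N a.
Proof.
pose MS := round (R := R) (n := n) (inner_edge m K) n.-1.
pose f1 := iter a MS delta; pose g1 := block_avg m K delta.
pose p := iter a MS (iter b M f1).
apply: le_trans (_ : \sum_x `|p x - u| <= _).
  apply: increasing_l1_le.
  - by apply: iter_round_increasing; exact: point_mass_increasing.
  - by apply: sum_sub_uniform; rewrite sum_iter_round sum_point_mass.
  - by apply: sum_sub_uniform; rewrite !sum_iter_round sum_point_mass.
  - by move=> f; exact: censored_phases.
have be := block_mixing N4 blk_len (R := R) a.
have h1 : \sum_x `|f1 x - g1 x| <= block_error R n N a.
  apply: le_trans (be delta) _.
  rewrite (eq_bigr delta) => [|x _]; last by rewrite ger0_norm// /point_mass ler0n.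
  by rewrite sum_point_mass mulr1.
have h2 : \sum_x `|p x - iter a MS (mid_law R m K b) x| <= block_error R n N a.
  apply: le_trans h1.
  rewrite (eq_bigr (fun x => `|iter a MS (iter b M (fun y => f1 y - g1 y)) x|)).
    by apply: le_trans (iter_round_l1 _ _ _) _; exact: iter_round_l1.
  move=> x _; congr `|_|; rewrite -iter_roundB; congr (iter a MS _ _).
  by apply/funext => y; rewrite iter_roundB.
have h3 : \sum_x `|iter a MS (mid_law R m K b) x - block_law b x| <= block_error R n N a.
  apply: le_trans (be _) _.
  rewrite (eq_bigr (mid_law R m K b)) => [|x _]; last by rewrite ger0_norm// mid_law_ge0.
  by rewrite sum_mid_law mulr1.
apply: le_trans (_ : \sum_x (`|p x - iter a MS (mid_law R m K b) x|
  + `|iter a MS (mid_law R m K b) x - block_law b x| + `|block_law b x - u|) <= _).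
  apply: ler_sum => x _; set A := p x; set B := iter a MS _ x; set C := block_law b x.
  have -> : A - u = (A - B) + (B - C) + (C - u) by ring.
  by apply: le_trans (ler_normD _ _) _; rewrite lerD2r ler_normD.
by rewrite !big_split /=; lra.
Qed.

Lemma match_avgC (I J : 'I_K) (f : 'S_n -> R) :
  match_avg m0 mK I J f = match_avg m0 mK J I f.
Proof.
apply/funext => x; rewrite /match_avg; congr (_ / _); apply: eq_bigr => S _.
congr (f (_ * _)%g); apply/permP => i.
case: (lane_case m0 mK I J i) => [[l ->]|[l ->]|h].
- by rewrite flip1 flip2.
- by rewrite flip1 flip2.
by rewrite !flip3// => l; have [? ?] := h l.
Qed.

Lemma match_avg_id (I : 'I_K) (f : 'S_n -> R) : match_avg m0 mK I I f = f.
Proof.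
apply/funext => x; rewrite /match_avg.
rewrite (eq_bigr (fun=> f x)) => [|S _].
  by rewrite sumr_const -[_ *+ _]mulr_natr card_sets mulfK// expf_neq0.
congr f; rewrite -[RHS]mul1g; congr (_ * _)%g; apply/permP => i; rewrite perm1.
case: (lane_case m0 mK I I i) => [[l ->]|[l ->]|h].
- by rewrite flip1; case: ifP.
- by rewrite flip1; case: ifP.
by rewrite flip3.
Qed.

Variables (al T : R) (r d0 : nat).
Hypothesis al0 : 0 < al.
Hypothesis al_cos : al <= cos (al * n%:R / 2).
Hypothesis al_pi : al * n%:R / 2 <= pi.
Hypothesis cos_al : 0 <= cos al.
Let tau : R := m%:R ^+ 2 / (256 * n%:R).
Hypothesis rate_small :
  n%:R * wave_rate al ^+ r <= m%:R ^+ 2 / (128 * n%:R).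
Hypothesis d00 : (0 < d0)%N.
Hypothesis d0_small : 2 * d0%:R * n%:R <= tau ^+ 2.
Hypothesis T_large : r.+1%:R * (16 * n%:R / m%:R ^+ 2 + 4 * n%:R ^+ 2 / m%:R ^+ 4)
  <= T * tau ^+ 2.

Definition match_error : R := K%:R ^+ 2 *
  (16 / Num.sqrt d0%:R * (4 * n%:R / m%:R * (n%:R * K%:R ^+ 2 * wave_rate al ^+ r))
   + 2 * (2 / d0%:R + T + T)).

Let np : 0 < n%:R :> R. Proof. by rewrite ltr0n ltnW. Qed.
Let mp : 0 < m%:R :> R. Proof. by rewrite ltr0n. Qed.
Let tau0 : 0 < tau.
Proof.
have c : 0 < 256 :> R by rewrite ltr0n.
exact: (divr_gt0 (exprn_gt0 2 mp) (mulr_gt0 c np)).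
Qed.

Lemma low_count_T (I j : 'I_K) :
  pairing (mid_law R m K r) (low_count m0 mK I j tau) <= T.
Proof.
have h := low_count_le m2 m0 mK K0 I j al0 n1 al_cos al_pi cos_al rate_small erefl.
have t2 : 0 < tau ^+ 2 by rewrite exprn_gt0.
by rewrite -(ler_pM2r t2); apply: le_trans h T_large.
Qed.

Let T0 : 0 <= T.
Proof.
have I0 : 'I_K := Ordinal K0.
apply: le_trans (low_count_T I0 I0); apply: sumr_ge0 => x _.
by rewrite mulr_ge0 ?mid_law_ge0// /low_count ler0n.
Qed.

(** The difference of a density and its matched average is paid by exchanging
    two cards of different blocks, at a cost controlled by the decay of the
    block statistic, and by arrangements with few lanes. *)
Lemma match_error_pair (I J : 'I_K) :
  \sum_x `|block_law r x - match_avg m0 mK I J (block_law r) x| <= match_error.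
Proof.
have sd : 0 <= 16 / Num.sqrt d0%:R :> R by rewrite divr_ge0// sqrtr_ge0.
have lam0 : 0 <= wave_rate al ^+ r by rewrite exprn_ge0// wave_rate_ge0.
pose Q := 4 * n%:R / m%:R * (n%:R * K%:R ^+ 2 * wave_rate al ^+ r).
have Q0 : 0 <= Q.
  apply: mulr_ge0; first by rewrite divr_ge0 ?mulr_ge0// ltW.
  by apply: mulr_ge0 => //; rewrite mulr_ge0 ?(ltW np)// exprn_ge0.
pose beta := 2 / d0%:R + T + T.
have beta0 : 0 <= beta by rewrite !addr_ge0// divr_ge0.
have err0 : 0 <= 16 / Num.sqrt d0%:R * Q + 2 * beta by rewrite addr_ge0// mulr_ge0.
wlog IJ : I J / (I < J)%N => [H|].
  case: (ltngtP I J) => [|JI|/val_inj ->]; first exact: H.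
    by rewrite match_avgC; exact: H.
  rewrite match_avg_id big1 => [|x _]; last by rewrite subrr normr0.
  by apply: mulr_ge0 => //; rewrite exprn_ge0.
have nIJ : I != J by rewrite -val_eqE /= ltn_eqF.
have left_inv := @block_law_left R n m K r.
have right_inv := @block_law_right R n m K r.
apply: le_trans (match_avg_cost m0 mK K0 (block_law r) I J) _.
rewrite mulr_suml.
apply: le_trans (_ : \sum_(g : 'I_K * 'I_K) (16 / Num.sqrt d0%:R * Q + 2 * beta) <= _);
  last by rewrite sumr_const -[leLHS]mulr_natl card_pairs.
apply: ler_sum => -[j j'] _.
have [jj|jj] := leqP j' j; first by rewrite cost_trivial// mul0r.
apply: le_trans (cost_bound m0 mK K0 (@block_law_ge0 R n m K r) left_inv right_inv nIJ jj d00) _.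
apply: lerD.
  apply: ler_wpM2l => //.
  have sc := swap_cost_bound m0 mK K0 left_inv right_inv (@block_law_increasing r)
    nIJ (ltnW n1).
  have dec := block_statistic_decay m r n1 K0 al0 al_cos al_pi cos_al.
  have n4 : 0 <= 4 * n%:R :> R by rewrite mulr_ge0// ltW.
  have := le_trans sc (ler_wpM2l n4 dec).
  by rewrite mulrC -ler_pdivlMr// => h; apply: le_trans h _; rewrite /Q mulrAC.
rewrite ler_pM2l//.
apply: le_trans (bad_lanes_le m0 mK K0 r IJ jj d00 (ltW tau0) _ d0_small) _.
  by rewrite -[leqRHS]card_ord max_card.
by rewrite /beta; apply: lerD; [apply: lerD|]; rewrite ?low_count_T.
Qed.

(** The number [s] of block shuffles is free: more of them contract better,
    but accumulate more error. *)
Lemma block_law_near_uniform (s : nat) :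
  \sum_x `|block_law r x - u|
  <= s%:R * match_error + 4 * n%:R * (1 - (2 * K%:R ^+ 2)^-1) ^+ s.
Proof.
apply: (near_uniform K0 s (@block_law_left R n m K r)).
- by apply: sum_sub_uniform; exact: sum_block_law.
- have -> : 2 = \sum_(x : 'S_n) (block_law r x + u).
    by rewrite big_split /= sum_block_law sum_uniform.
  apply: ler_sum => x _; apply: le_trans (ler_normB _ _) _.
  by rewrite !ger0_norm// ?invr_ge0// block_law_ge0.
exact: match_error_pair.
Qed.

End Phases.

(** * Choice of the parameters *)

Lemma nat_above (R : realType) (x : R) : 0 <= x ->
  exists2 k : nat, x <= k%:R & k%:R <= x + 1.
Proof.
move=> x0; have /andP[h1 h2] := truncn_itv x0.
exists (Num.truncn x).+1; first exact: ltW.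
by rewrite -[_.+1%:R]natr1 lerD2r.
Qed.

Lemma pow_le_expR (R : realType) (q c : R) (r : nat) : 0 <= q -> q <= 1 - c ->
  q ^+ r <= expR (- (c * r%:R)).
Proof.
move=> q0 qc; rewrite -mulNr expRM_natr lerXn2r ?nnegrE ?expR_ge0//.
by apply: le_trans qc (expR_ge1Dx _).
Qed.

Lemma block_sizes (n K m : nat) : m = (n %/ K)%N -> (0 < K)%N -> (4 * K ^ 2 <= n)%N ->
  [/\ (m * K <= n)%N, (4 * K <= m)%N, (2 <= m)%N, (4 <= 2 * m)%N & (n <= 2 * m * K)%N].
Proof.
move=> mE K0 nK.
have Km : (4 * K <= m)%N by rewrite mE leq_divRL// -mulnA mulnn.
have dn := divn_eq n K; have rn := ltn_pmod n K0; rewrite -mE in dn.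
have mk : (K <= m * K)%N by rewrite leq_pmull//; lia.
split; [by rewrite mE leq_divM|by []|lia|lia|by rewrite -mulnA; lia].
Qed.

Lemma block_len (n K m : nat) p : m = (n %/ K)%N -> (0 < K)%N -> (K <= m)%N ->
  (p < n)%N -> (p - blk m K p * m < 2 * m)%N.
Proof.
move=> mE K0 Km pn; have m0 : (0 < m)%N by lia.
have dp := divn_eq p m; have rp := ltn_pmod p m0.
have dn := divn_eq n K; have rn := ltn_pmod n K0; rewrite -mE in dn.
have e1 : (m * K = K.-1 * m + m)%N.
  by rewrite mulnC -{1}(prednK K0) mulSn addnC.
rewrite /blk; have [e|e] := leqP (p %/ m) K.-1.
  by rewrite {1}dp addKn; apply: leq_trans rp _; rewrite leq_pmull.
by lia.
Qed.

Section LargeDeck.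
Variables (R : realType) (n K : nat) (dl : R).
Notation k := (K%:R : R).
Notation L := (ln (n%:R : R)).
Hypothesis dl01 : 0 < dl <= 1.
Hypothesis K_large : 2 ^+ 13 / dl <= k.
Let eta := dl / 16.
Hypothesis L4 : 4 <= L.
Hypothesis Lk : 2 ^+ 22 * k ^+ 4 <= L.
Hypothesis Lcos : 4 / cos ((1 - eta) * pi / 2) <= L.
Hypothesis Ldl : 2 ^+ 10 / dl <= L.

Let m := (n %/ K)%N.
Let N := (2 * m)%N.
Let al : R := (1 - eta) * pi / n%:R.
(** The first factor is n^-1/2 and the second one the gain over it. *)
Let h : R := expR (- (L / 2)).
Let E : R := expR (- (dl / 16 * L)).

Let dl0 : 0 < dl. Proof. by case/andP: dl01. Qed.
Let dl1 : dl <= 1. Proof. by case/andP: dl01. Qed.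

Let eta0 : 0 < eta. Proof. by rewrite /eta divr_gt0. Qed.
Let eta1 : eta < 1. Proof. by rewrite /eta; have := dl1; lra. Qed.

Let n0 : (0 < n)%N.
Proof. by rewrite lt0n; apply: contraTneq L4 => ->; rewrite ln0// -ltNge. Qed.
Let np : 0 < n%:R :> R. Proof. by rewrite ltr0n. Qed.

Let nL : 1 + L <= n%:R.
Proof. by rewrite -[leRHS]lnK ?posrE// expR_ge1Dx. Qed.

Let k_ge : 2 ^+ 13 <= k.
Proof. by apply: le_trans K_large; rewrite ler_pdivlMr// ler_piMr ?exprn_ge0. Qed.
Let k1 : 1 <= k. Proof. by apply: le_trans k_ge; rewrite exprn_ege1// ler1n. Qed.
Let kp : 0 < k. Proof. by apply: lt_le_trans k1. Qed.
Let K0 : (0 < K)%N. Proof. by rewrite -(ltr0n R). Qed.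
Let k24 : k ^+ 2 <= k ^+ 4. Proof. by apply: ler_weXn2l. Qed.

Let hh : h ^+ 2 * n%:R = 1.
Proof.
rewrite /h -expRM_natl -{2}[n%:R]lnK ?posrE// -expRD.
by rewrite (_ : _ + _ = 0) ?expR0//; field.
Qed.
Let h0 : 0 < h. Proof. exact: expR_gt0. Qed.
Let E0 : 0 < E. Proof. exact: expR_gt0. Qed.
Let E1 : E <= 1.
Proof.
rewrite /E -[leRHS]expR0 ler_expR oppr_le0 mulr_ge0//; first by rewrite divr_ge0// ltW.
by apply: le_trans L4.
Qed.

Let nK : (4 * K ^ 2 <= n)%N.
Proof.
rewrite -(ler_nat R) natrM natrX; have : 0 <= k ^+ 4 by rewrite exprn_ge0// ltW.
have := k24; have := nL; have := Lk.
have : 4 * k ^+ 4 <= 2 ^+ 22 * k ^+ 4.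
  rewrite ler_wpM2r ?exprn_ge0 ?(ltW kp)//.
  have -> : 4 = 2 ^+ 2 :> R by ring.
  by apply: ler_weXn2l => //; rewrite ler1n.
lra.
Qed.

Let sizes := block_sizes (erefl m) K0 nK.
Let mK : (m * K <= n)%N. Proof. by case: sizes. Qed.
Let Km : (4 * K <= m)%N. Proof. by case: sizes. Qed.
Let m2 : (2 <= m)%N. Proof. by case: sizes. Qed.
Let m0 : (0 < m)%N. Proof. exact: ltnW. Qed.
Let N4 : (4 <= N)%N. Proof. by case: sizes. Qed.

Let blk_len p : (p < n)%N -> (p - blk m K p * m < N)%N.
Proof. by apply: block_len => //; apply: leq_trans Km; rewrite leq_pmull. Qed.

Let mp : 0 < m%:R :> R. Proof. by rewrite ltr0n. Qed.
Let m_le : m%:R * k <= n%:R. Proof. by rewrite -natrM ler_nat. Qed.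
Let m_ge : n%:R <= 2 * m%:R * k.
Proof. by rewrite -!natrM ler_nat; case: sizes. Qed.

Let al0 : 0 < al.
Proof. by rewrite /al divr_gt0// mulr_gt0 ?pi_gt0 ?subr_gt0. Qed.

Let al_le : al <= 4 / n%:R.
Proof.
rewrite ler_wpM2r ?invr_ge0 ?(ltW np)//.
have p0 := pi_ge0 R; have e0 := ltW eta0.
by apply: le_trans (pi_le4 R); rewrite ler_piMl// gerBl.
Qed.

Let al_n : al * n%:R / 2 = (1 - eta) * pi / 2.
Proof. by rewrite /al; field; exact: lt0r_neq0. Qed.

Let al_pi : al * n%:R / 2 <= pi.
Proof.
rewrite al_n; have p0 := pi_ge0 R; have e0 := ltW eta0.
have : (1 - eta) * pi <= pi by rewrite ler_piMl// gerBl.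
lra.
Qed.

Let cos_pos : 0 < cos ((1 - eta) * pi / 2).
Proof.
have pp := pi_gt0 R; have e0 : 0 < eta * pi by rewrite mulr_gt0.
have e1 : eta * pi < pi by rewrite gtr_pMl.
by apply: cos_gt0_pihalf; apply/andP; split; lra.
Qed.

Let al_cos : al <= cos (al * n%:R / 2).
Proof.
rewrite al_n; apply: le_trans al_le _.
rewrite ler_pdivrMr// mulrC -ler_pdivrMr//; apply: le_trans Lcos _.
by have := nL; lra.
Qed.

Let al_sq : al ^+ 2 <= dl / 64.
Proof.
have a4 := al_le.
have f0 : 0 <= 4 / n%:R :> R by rewrite divr_ge0.
have h1 : al ^+ 2 <= (4 / n%:R) ^+ 2 by rewrite lerXn2r ?nnegrE// ltW.
apply: le_trans h1 _.
rewrite expr_div_n ler_pdivrMr ?exprn_gt0//.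
have n1 : 2 ^+ 10 <= dl * n%:R.
  by rewrite mulrC -ler_pdivrMr//; have := nL; have := Ldl; lra.
have n2 : 1 <= n%:R :> R by rewrite ler1n.
have : dl * n%:R <= dl * n%:R ^+ 2.
  by rewrite ler_pM2l// expr2 ler_peMl// ltW.
have -> : 4 ^+ 2 = 2 ^+ 10 / 64 :> R by field.
lra.
Qed.

Let al1 : al <= 1.
Proof.
apply: le_trans al_le _; rewrite ler_pdivrMr// mul1r; have := nL; have := L4; lra.
Qed.

Let cos_al : 0 <= cos al.
Proof.
apply: le_trans (cos_ge al); have := al_sq; have := dl1; lra.
Qed.

Variables a b s d0 : nat.
Hypothesis a_ge : 6 * N%:R ^+ 2 * L <= a%:R.
Hypothesis a_le : a%:R <= 6 * N%:R ^+ 2 * L + 1.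
Hypothesis b_ge : (1 + dl / 2) * (n%:R ^+ 2 / (2 * pi ^+ 2)) * L <= b%:R.
Hypothesis b_le : b%:R <= (1 + dl / 2) * (n%:R ^+ 2 / (2 * pi ^+ 2)) * L + 1.
Hypothesis s_ge : 4 * k ^+ 2 * L <= s%:R.
Hypothesis s_le : s%:R <= 4 * k ^+ 2 * L + 1.
Hypothesis d0_le : d0%:R <= n%:R / (2 ^+ 21 * k ^+ 4).
Hypothesis d0_ge : n%:R / (2 ^+ 21 * k ^+ 4) <= d0%:R + 1.

Let L0 : 0 < L. Proof. by apply: lt_le_trans L4. Qed.

(** The time [b] exceeds the cutoff by a proportion [dl / 2], and the
    frequency [al] is smaller than pi / n by a proportion [dl / 16]; together
    they leave a gain [dl / 16] in the exponent. *)
Lemma rate_gain : wave_rate al ^+ b <= h * E.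
Proof.
have pp := pi_gt0 R.
have w := wave_rate_le (ltW al0) al1.
have w0 := wave_rate_ge0 cos_al.
apply: le_trans (pow_le_expR b w0 w) _.
rewrite /h /E -expRD ler_expR -opprD lerN2.
set z := 1 - 4 * al ^+ 2.
have z1 : 1 - dl / 16 <= z by rewrite /z; have := al_sq; lra.
have z0 : 0 <= z by have := dl1; lra.
have az : 0 <= al ^+ 2 * z by rewrite mulr_ge0 ?sqr_ge0.
apply: le_trans (ler_wpM2l az b_ge).
have -> : al ^+ 2 * z * ((1 + dl / 2) * (n%:R ^+ 2 / (2 * pi ^+ 2)) * L)
  = (1 - eta) ^+ 2 * z * (1 + dl / 2) / 2 * L.
  have aE : al ^+ 2 * n%:R ^+ 2 = (1 - eta) ^+ 2 * pi ^+ 2.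
    by rewrite -!exprMn /al divfK// lt0r_neq0.
  transitivity ((al ^+ 2 * n%:R ^+ 2) * (z * (1 + dl / 2) * L) / (2 * pi ^+ 2)).
    by ring.
  rewrite aE; clearbody z.
  have := lt0r_neq0 (exprn_gt0 2 pp); move: (pi ^+ 2 : R) => q q0.
  by field.
rewrite -[L / 2]mulrC -mulrDl ler_pM2r//.
have e1 : 1 - dl / 8 <= (1 - eta) ^+ 2.
  have -> : (1 - eta) ^+ 2 = 1 - dl / 8 + (dl / 16) ^+ 2 by rewrite /eta; field.
  by rewrite lerDl sqr_ge0.
have d0' := dl0; have d1' := dl1.
have e2 : (1 - dl / 8) * (1 - dl / 16) <= (1 - eta) ^+ 2 * z by apply: ler_pM => //; lra.
have p1 : 0 <= 1 + dl / 2 by lra.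
have := ler_wpM2r p1 e2.
have : 0 <= dl * dl by rewrite mulr_ge0 ?(ltW d0').
have : dl * dl <= dl by rewrite ler_piMl// ltW.
have : 0 <= dl * dl * dl by rewrite !mulr_ge0 ?(ltW d0').
have -> : (1 - dl / 8) * (1 - dl / 16) * (1 + dl / 2)
  = 1 + 5 / 16 * dl - 11 / 128 * (dl * dl) + (dl * dl * dl) / 256 by field.
lra.
Qed.

Let hpow j : h ^+ j = expR (- (j%:R / 2 * L)).
Proof. by rewrite /h -expRM_natl; congr expR; field. Qed.

Let h1 : h <= 1.
Proof. by rewrite /h -[leRHS]expR0 ler_expR oppr_le0 divr_ge0// ltW. Qed.

Let hE_le : h ^+ 2 <= E.
Proof.
rewrite hpow /E ler_expR lerN2 divff// ler_pM2r//; have := dl1; lra.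
Qed.

Let m_le_n : m%:R <= n%:R :> R.
Proof. by apply: le_trans m_le; rewrite ler_peMr. Qed.

Lemma block_error_small : block_error R n N a <= 8 * h ^+ 2.
Proof.
have Np : 0 < N%:R :> R by rewrite ltr0n; apply: leq_trans N4.
have w := wave_rate_block R N4; have w0 := wave_rate_ge0 (cos_al_ge0 R N4).
rewrite /block_error.
have wa : wave_rate N%:R^-1 ^+ a <= h ^+ 6.
  apply: le_trans (pow_le_expR a w0 w) _.
  rewrite hpow ler_expR lerN2.
  have N2 : 0 < N%:R ^+ 2 :> R by rewrite exprn_gt0.
  have -> : N%:R^-1 ^+ 2 / 2 * a%:R = a%:R / (2 * N%:R ^+ 2) :> R.
    by field; exact: lt0r_neq0.
  rewrite ler_pdivlMr ?mulr_gt0//; apply: le_trans a_ge.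
  by rewrite le_eqVlt; apply/orP; left; apply/eqP; field.
have Nn : N%:R <= 2 * n%:R :> R by rewrite /N natrM ler_pM2l.
have h6 : 0 <= h ^+ 6 by rewrite exprn_ge0// ltW.
apply: le_trans (_ : 4 * n%:R * (2 * n%:R) * h ^+ 6 <= _).
  by apply: ler_pM => //; rewrite ?mulr_ge0 ?exprn_ge0// ?(ltW np)// ler_wpM2l// mulr_ge0// ltW.
have -> : 4 * n%:R * (2 * n%:R) * h ^+ 6 = 8 * ((h ^+ 2 * n%:R) ^+ 2 * h ^+ 2) by ring.
by rewrite hh expr1n mul1r.
Qed.

Lemma contraction_small : 4 * n%:R * (1 - (2 * k ^+ 2)^-1) ^+ s <= 4 * h ^+ 2.
Proof.
have k2 : 0 < 2 * k ^+ 2 by rewrite mulr_gt0 ?exprn_gt0.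
have q0 : 0 <= 1 - (2 * k ^+ 2)^-1.
  rewrite subr_ge0 invf_le1//; have : 1 <= k ^+ 2 by rewrite exprn_ege1.
  lra.
have ws : (1 - (2 * k ^+ 2)^-1) ^+ s <= h ^+ 4.
  apply: le_trans (pow_le_expR s q0 (lexx _)) _.
  rewrite hpow ler_expR lerN2 [_^-1 * _]mulrC ler_pdivlMr//; apply: le_trans s_ge.
  by rewrite le_eqVlt; apply/orP; left; apply/eqP; field.
have n4 : 0 <= 4 * n%:R :> R by rewrite mulr_ge0// ltW.
apply: le_trans (ler_wpM2l n4 ws) _.
have -> : 4 * n%:R * h ^+ 4 = 4 * ((h ^+ 2 * n%:R) * h ^+ 2) by ring.
by rewrite hh mul1r.
Qed.

Let k4p : 0 < k ^+ 4. Proof. by rewrite exprn_gt0. Qed.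

Let n_large : 2 ^+ 22 * k ^+ 4 <= n%:R.
Proof. by have := nL; have := Lk; lra. Qed.

Let d0_half : n%:R / (2 ^+ 22 * k ^+ 4) <= d0%:R.
Proof.
set y := n%:R / (2 ^+ 22 * k ^+ 4).
have y1 : 1 <= y by rewrite ler_pdivlMr ?mulr_gt0 ?exprn_gt0// mul1r.
have -> : y = n%:R / (2 ^+ 21 * k ^+ 4) / 2.
  by rewrite /y; field; exact: lt0r_neq0.
move: y1; rewrite /y.
have -> : n%:R / (2 ^+ 22 * k ^+ 4) = n%:R / (2 ^+ 21 * k ^+ 4) / 2.
  by field; exact: lt0r_neq0.
have := d0_ge; set q := n%:R / _; lra.
Qed.

Let d00 : (0 < d0)%N.
Proof.
rewrite -(ltr0n R); apply: lt_le_trans d0_half.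
by rewrite divr_gt0 ?mulr_gt0 ?exprn_gt0.
Qed.

Let inv_sqrt_d0 : 16 / Num.sqrt d0%:R <= 2 ^+ 15 * k ^+ 2 * h.
Proof.
pose v : R := (2 ^+ 11 * k ^+ 2 * h)^-1.
have v0 : 0 < v by rewrite invr_gt0 !mulr_gt0 ?exprn_gt0.
have vE : v ^+ 2 = n%:R / (2 ^+ 22 * k ^+ 4).
  transitivity ((h ^+ 2 * n%:R) * v ^+ 2); first by rewrite hh mul1r.
  by rewrite /v; field; rewrite (lt0r_neq0 kp) (lt0r_neq0 h0).
have vs : v <= Num.sqrt d0%:R.
  rewrite -[leLHS]ger0_norm; last exact: ltW.
  by rewrite -sqrtr_sqr vE ler_wsqrtr.
have s0 : 0 < Num.sqrt d0%:R :> R by apply: lt_le_trans vs.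
rewrite ler_pdivrMr//; apply: le_trans (_ : 2 ^+ 15 * k ^+ 2 * h * v <= _).
  rewrite /v le_eqVlt; apply/orP; left; apply/eqP.
  by field; rewrite (lt0r_neq0 kp) (lt0r_neq0 h0).
by rewrite ler_pM2l// !mulr_gt0 ?exprn_gt0.
Qed.

(** Bound on the probability that a type is rare in a block. *)
Let T : R := 2 ^+ 27 * k ^+ 8 * L / n%:R.

(** The cost of the exchanges is of order n^1/2 times [E], and the
    isoperimetric inequality divides it by the square root of a number of
    lanes of order [n]. *)
Lemma match_error_small :
  match_error n m K al T b d0 <= 2 ^+ 30 * k ^+ 10 * (L * E).
Proof.
have w0 := wave_rate_ge0 cos_al.
have wb : 0 <= wave_rate al ^+ b by rewrite exprn_ge0.
have L1 : 1 <= L by apply: le_trans L4; rewrite ler1n.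
have kpow i j : (i <= j)%N -> k ^+ i <= k ^+ j by move=> ij; rewrite ler_weXn2l.
have EL : E <= L * E by rewrite ler_peMl// ltW.
have LE0 : 0 <= L * E by rewrite mulr_ge0// ltW.
rewrite /match_error.
have i1 : 4 * n%:R / m%:R <= 8 * k.
  by rewrite ler_pdivrMr//; have := m_ge; lra.
have i2 : n%:R * k ^+ 2 * wave_rate al ^+ b <= n%:R * k ^+ 2 * (h * E).
  by rewrite ler_wpM2l ?rate_gain// mulr_ge0 ?exprn_ge0 ?(ltW np)// ltW.
have i3 : 16 / Num.sqrt d0%:R * (4 * n%:R / m%:R * (n%:R * k ^+ 2 * wave_rate al ^+ b))
   <= 2 ^+ 15 * k ^+ 2 * h * (8 * k * (n%:R * k ^+ 2 * (h * E))).
  have nn : 0 <= 4 * n%:R / m%:R :> R by rewrite divr_ge0// mulr_ge0// ltW.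
  have nw : 0 <= n%:R * k ^+ 2 * wave_rate al ^+ b.
    by rewrite mulr_ge0// mulr_ge0 ?exprn_ge0 ?(ltW np)// ltW.
  apply: ler_pM; [by rewrite divr_ge0// sqrtr_ge0| |exact: inv_sqrt_d0|].
    exact: mulr_ge0.
  exact: ler_pM.
have e3 : 2 ^+ 15 * k ^+ 2 * h * (8 * k * (n%:R * k ^+ 2 * (h * E))) = 2 ^+ 18 * k ^+ 5 * E.
  transitivity (2 ^+ 18 * k ^+ 5 * E * (h ^+ 2 * n%:R)); first by ring.
  by rewrite hh mulr1.
have i4 : 2 / d0%:R <= 2 ^+ 23 * k ^+ 4 * h ^+ 2.
  have d0p : 0 < d0%:R :> R by rewrite ltr0n.
  rewrite ler_pdivrMr//.
  have c0 : 0 <= 2 ^+ 23 * k ^+ 4 * h ^+ 2.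
    by rewrite !mulr_ge0 ?exprn_ge0 ?(ltW kp)// ltW.
  apply: le_trans (ler_wpM2l c0 d0_half).
  have -> : 2 ^+ 23 * k ^+ 4 * h ^+ 2 * (n%:R / (2 ^+ 22 * k ^+ 4)) = 2 * (h ^+ 2 * n%:R).
    by field; exact: lt0r_neq0.
  by rewrite hh mulr1.
have e4 : T = 2 ^+ 27 * k ^+ 8 * (L * h ^+ 2).
  have -> : h ^+ 2 = n%:R^-1.
    by apply: (mulIf (lt0r_neq0 np)); rewrite hh mulVf// lt0r_neq0.
  by rewrite /T !mulrA.
have i5 : L * h ^+ 2 <= L * E by rewrite ler_pM2l.
have h2L : h ^+ 2 <= L * E by apply: le_trans EL.
rewrite e3 in i3; rewrite e4.
apply: le_trans (_ : k ^+ 2 * (2 ^+ 18 * k ^+ 8 * (L * E) + 2 * (2 ^+ 23 * k ^+ 8 * (L * E)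
  + 2 ^+ 27 * k ^+ 8 * (L * E) + 2 ^+ 27 * k ^+ 8 * (L * E))) <= _); last first.
  have -> : k ^+ 2 * (2 ^+ 18 * k ^+ 8 * (L * E) + 2 * (2 ^+ 23 * k ^+ 8 * (L * E)
    + 2 ^+ 27 * k ^+ 8 * (L * E) + 2 ^+ 27 * k ^+ 8 * (L * E)))
    = (2 ^+ 18 + 2 ^+ 24 + 2 ^+ 29) * (k ^+ 10 * (L * E)) by ring.
  rewrite -[leRHS]mulrA; apply: ler_wpM2r.
    by apply: mulr_ge0 => //; rewrite exprn_ge0// ltW.
  have c18 : 0 <= 2 ^+ 18 :> R by rewrite exprn_ge0.
  have -> : 2 ^+ 18 + 2 ^+ 24 + 2 ^+ 29 = 2 ^+ 18 * (1 + 2 ^+ 6 + 2 ^+ 11) :> R by ring.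
  have -> : 2 ^+ 30 = 2 ^+ 18 * 2 ^+ 12 :> R by ring.
  apply: ler_wpM2l => //; lra.
apply: ler_wpM2l; first by rewrite exprn_ge0// ltW.
have c k' : 0 <= 2 ^+ k' :> R by rewrite exprn_ge0.
have mono p q j : q <= L * E -> (p <= 8)%N -> 2 ^+ j * k ^+ p * q <= 2 ^+ j * k ^+ 8 * (L * E).
  move=> qL p8; apply: le_trans (_ : 2 ^+ j * k ^+ p * (L * E) <= _).
    by rewrite ler_wpM2l// mulr_ge0// exprn_ge0// ltW.
  by rewrite ler_wpM2r// ler_wpM2l// kpow.
apply: lerD; first by apply: le_trans i3 _; apply: mono.
rewrite ler_pM2l//; apply: lerD; [apply: lerD|]; last by apply: mono.
  by apply: le_trans i4 _; apply: mono.
by apply: mono.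
Qed.

Let tau : R := m%:R ^+ 2 / (256 * n%:R).

Let m_sq : n%:R ^+ 2 <= 4 * k ^+ 2 * m%:R ^+ 2.
Proof.
have -> : 4 * k ^+ 2 * m%:R ^+ 2 = (2 * m%:R * k) ^+ 2 by ring.
by rewrite lerXn2r ?nnegrE ?mulr_ge0 ?(ltW kp) ?(ltW mp) ?(ltW np).
Qed.

Let tau_ge : n%:R / (2 ^+ 10 * k ^+ 2) <= tau.
Proof.
have k2 : 0 < 2 ^+ 10 * k ^+ 2 by rewrite mulr_gt0 ?exprn_gt0.
rewrite /tau ler_pdivlMr; last by rewrite mulr_gt0 ?ltr0n.
have -> : n%:R / (2 ^+ 10 * k ^+ 2) * (256 * n%:R) = n%:R ^+ 2 / (4 * k ^+ 2).
  by field; exact: lt0r_neq0.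
have k4' : 0 < 4 * k ^+ 2 by rewrite mulr_gt0 ?exprn_gt0.
by rewrite ler_pdivrMr// mulrC.
Qed.

Let tau_sq : n%:R ^+ 2 / (2 ^+ 20 * k ^+ 4) <= tau ^+ 2.
Proof.
have -> : n%:R ^+ 2 / (2 ^+ 20 * k ^+ 4) = (n%:R / (2 ^+ 10 * k ^+ 2)) ^+ 2.
  by field; exact: lt0r_neq0.
have q0 : 0 <= n%:R / (2 ^+ 10 * k ^+ 2).
  by rewrite divr_ge0 ?mulr_ge0 ?exprn_ge0// ltW.
by rewrite lerXn2r ?nnegrE//; apply: le_trans tau_ge.
Qed.

Let d0_small : 2 * d0%:R * n%:R <= tau ^+ 2.
Proof.
apply: le_trans tau_sq; have n2 : 0 <= 2 * n%:R :> R by rewrite mulr_ge0// ltW.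
have := ler_wpM2l n2 d0_le.
have -> : 2 * n%:R * (n%:R / (2 ^+ 21 * k ^+ 4)) = n%:R ^+ 2 / (2 ^+ 20 * k ^+ 4).
  by field; exact: lt0r_neq0.
by rewrite mulrAC.
Qed.

Let rate_small : n%:R * wave_rate al ^+ b <= m%:R ^+ 2 / (128 * n%:R).
Proof.
have -> : m%:R ^+ 2 / (128 * n%:R) = 2 * tau.
  by rewrite /tau; field; exact: lt0r_neq0.
have q0 : 0 < 2 ^+ 10 * k ^+ 2 by rewrite mulr_gt0 ?exprn_gt0.
have hs : h <= (2 ^+ 10 * k ^+ 2)^-1.
  rewrite -ler_sqr ?nnegrE ?invr_ge0 ?(ltW h0) ?(ltW q0)//.
  have -> : h ^+ 2 = n%:R^-1.
    by apply: (mulIf (lt0r_neq0 np)); rewrite hh mulVf// lt0r_neq0.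
  have -> : (2 ^+ 10 * k ^+ 2)^-1 ^+ 2 = (2 ^+ 20 * k ^+ 4)^-1.
    by field; exact: lt0r_neq0.
  rewrite lef_pV2 ?posrE ?mulr_gt0 ?exprn_gt0//; apply: le_trans n_large.
  by rewrite ler_wpM2r ?(ltW k4p)// ler_weXn2l// ler1n.
have hn : wave_rate al ^+ b <= (2 ^+ 10 * k ^+ 2)^-1.
  apply: le_trans rate_gain _; apply: le_trans hs.
  by rewrite ler_piMr// ltW.
apply: le_trans (ler_wpM2l (ltW np) hn) _; apply: le_trans tau_ge _.
have t0 : 0 <= tau by apply: le_trans tau_ge; rewrite divr_ge0 ?(ltW np) ?(ltW q0).
by rewrite ler_peMl// ler1n.
Qed.

Let pi2_ge : 4 <= pi ^+ 2 :> R.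
Proof.
have -> : 4 = 2 ^+ 2 :> R by ring.
by rewrite lerXn2r ?nnegrE ?pi_ge0 ?pi_ge2.
Qed.

Let b_small : b.+1%:R <= n%:R ^+ 2 * L.
Proof.
have n4 : 4 <= n%:R :> R by have := nL; have := L4; lra.
have nL2 : 16 * 4 <= n%:R ^+ 2 * L.
  apply: ler_pM => //; have -> : 16 = 4 ^+ 2 :> R by ring.
  by rewrite lerXn2r ?nnegrE// ltW.
have p2 : 0 < 2 * pi ^+ 2 :> R by rewrite mulr_gt0// exprn_gt0// pi_gt0.
have q : (1 + dl / 2) * (n%:R ^+ 2 / (2 * pi ^+ 2)) * L <= (n%:R ^+ 2 * L) / 4.
  have -> : (1 + dl / 2) * (n%:R ^+ 2 / (2 * pi ^+ 2)) * L
    = (1 + dl / 2) * (n%:R ^+ 2 * L) / (2 * pi ^+ 2) by ring.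
  rewrite ler_pdivrMr//.
  have nL0 : 0 <= n%:R ^+ 2 * L by lra.
  have : (1 + dl / 2) * (n%:R ^+ 2 * L) <= 2 * (n%:R ^+ 2 * L).
    by rewrite ler_wpM2r//; have := dl1; lra.
  have : (n%:R ^+ 2 * L) * 4 <= (n%:R ^+ 2 * L) * pi ^+ 2 by rewrite ler_wpM2l.
  lra.
rewrite -[b.+1%:R]natr1; have := b_le; lra.
Qed.

Let T_large : b.+1%:R * (16 * n%:R / m%:R ^+ 2 + 4 * n%:R ^+ 2 / m%:R ^+ 4)
  <= T * tau ^+ 2.
Proof.
have m2p : 0 < m%:R ^+ 2 :> R by rewrite exprn_gt0.
have k24' : k ^+ 2 <= k ^+ 4 by exact: k24.
have mi : (m%:R ^+ 2)^-1 <= 4 * k ^+ 2 / n%:R ^+ 2.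
  rewrite ler_pdivlMr ?exprn_gt0// mulrC ler_pdivrMr//; exact: m_sq.
have n1 : 1 <= n%:R :> R by rewrite ler1n.
have i1 : 16 * n%:R / m%:R ^+ 2 <= 64 * k ^+ 4 / n%:R.
  apply: le_trans (_ : 16 * n%:R * (4 * k ^+ 2 / n%:R ^+ 2) <= _).
    by rewrite ler_wpM2l// mulr_ge0// ltW.
  have -> : 16 * n%:R * (4 * k ^+ 2 / n%:R ^+ 2) = 64 * k ^+ 2 / n%:R.
    by field; exact: lt0r_neq0.
  by rewrite ler_wpM2r ?invr_ge0 ?(ltW np)// ler_wpM2l.
have i2 : 4 * n%:R ^+ 2 / m%:R ^+ 4 <= 64 * k ^+ 4 / n%:R.
  apply: le_trans (_ : 4 * n%:R ^+ 2 * (4 * k ^+ 2 / n%:R ^+ 2) ^+ 2 <= _).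
    apply: ler_wpM2l; first by rewrite mulr_ge0// exprn_ge0// ltW.
    have -> : m%:R ^- 4 = (m%:R ^+ 2)^-1 ^+ 2 :> R by rewrite exprVn -exprM.
    by rewrite lerXn2r ?nnegrE// ?invr_ge0 ?(ltW m2p)// divr_ge0 ?mulr_ge0 ?exprn_ge0// ltW.
  have -> : 4 * n%:R ^+ 2 * (4 * k ^+ 2 / n%:R ^+ 2) ^+ 2 = 64 * k ^+ 4 / n%:R * n%:R^-1.
    by field; exact: lt0r_neq0.
  have q0 : 0 <= 64 * k ^+ 4 / n%:R by apply: divr_ge0; [apply: mulr_ge0|]; exact: ltW.
  have ni : n%:R^-1 <= 1 :> R by rewrite invf_le1.
  exact: ler_piMr.
have s0 : 0 <= 16 * n%:R / m%:R ^+ 2 + 4 * n%:R ^+ 2 / m%:R ^+ 4 :> R.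
  by rewrite addr_ge0// divr_ge0 ?mulr_ge0 ?exprn_ge0// ltW.
apply: le_trans (_ : n%:R ^+ 2 * L * (128 * k ^+ 4 / n%:R) <= _).
  apply: ler_pM => //.
  by have := lerD i1 i2; set A := (X in X <= _); set B := 64 * _; lra.
have T0 : 0 <= T.
  by rewrite divr_ge0 ?(ltW np)// !mulr_ge0 ?exprn_ge0 ?(ltW kp) ?(ltW L0).
apply: le_trans (ler_wpM2l T0 tau_sq).
rewrite /T le_eqVlt; apply/orP; left; apply/eqP.
by field; rewrite (lt0r_neq0 kp) (lt0r_neq0 np).
Qed.

Let L2E : L * (L * E) * (dl ^+ 3 * L) <= 27 * 2 ^+ 12.
Proof.
have y0 : 0 <= dl / 48 * L by rewrite mulr_ge0 ?(ltW L0)// divr_ge0// ltW.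
have cube : (dl / 48 * L) ^+ 3 * E <= 1.
  have -> : E = expR (- (dl / 48 * L)) ^+ 3.
    by rewrite /E -expRM_natl; congr expR; field.
  rewrite -exprMn; apply: exprn_ile1; first by apply: mulr_ge0 => //; exact: expR_ge0.
  rewrite expRN ler_pdivrMr ?expR_gt0// mul1r.
  by apply: le_trans (expR_ge1Dx _); rewrite lerDr.
have -> : L * (L * E) * (dl ^+ 3 * L) = (27 * 2 ^+ 12) * ((dl / 48 * L) ^+ 3 * E) by field.
by rewrite ler_piMr// mulr_ge0// exprn_ge0.
Qed.

Lemma large_deck_mixed (eps : R) : 0 < eps ->
  2 ^+ 52 * k ^+ 12 / (dl ^+ 3 * eps) <= L ->
  cat_max_dist R n ((a + (b + a)) * n.-1) <= eps.
Proof.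
move=> eps0 Leps.
have n1 : (1 < n)%N by rewrite -(ltr_nat R); have := nL; have := L4; lra.
have a0 : (0 < a)%N.
  rewrite -(ltr0n R); apply: lt_le_trans a_ge.
  by rewrite !mulr_gt0 ?exprn_gt0// ltr0n; apply: leq_trans N4.
rewrite cat_max_dist_rounds//; last by rewrite addn_gt0 a0.
have ph := three_phases R N4 blk_len a b.
have nu := @block_law_near_uniform R n m K N n1 m2 m0 mK K0 N4 blk_len al T b d0
  al0 al_cos al_pi cos_al rate_small d00 d0_small T_large s.
have me := match_error_small; have be := block_error_small; have cs := contraction_small.
have L1 : 1 <= L by apply: le_trans L4; rewrite ler1n.
have EL : E <= L * E by rewrite ler_peMl// ltW.
have LE0 : 0 <= L * E by rewrite mulr_ge0// ltW.
have EL2 : L * E <= L * (L * E) by rewrite ler_peMl.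
have k2L : 1 <= k ^+ 2 * L by rewrite mulr_ege1// exprn_ege1.
have s5 : s%:R <= 5 * (k ^+ 2 * L) by have := s_le; lra.
have s0 : 0 <= s%:R :> R by rewrite ler0n.
pose W := k ^+ 12 * (L * (L * E)).
have W0 : 0 <= W.
  by apply: mulr_ge0; [rewrite exprn_ge0// ltW|apply: mulr_ge0 => //; exact: ltW].
have r1 : s%:R * match_error n m K al T b d0 <= 5 * 2 ^+ 30 * W.
  apply: le_trans (ler_wpM2l s0 me) _.
  apply: le_trans (_ : 5 * (k ^+ 2 * L) * (2 ^+ 30 * k ^+ 10 * (L * E)) <= _).
    by apply: ler_wpM2r s5; apply: mulr_ge0 => //; apply: mulr_ge0; rewrite exprn_ge0// ltW.
  by rewrite /W le_eqVlt; apply/orP; left; apply/eqP; ring.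
have k12 : 1 <= k ^+ 12 by rewrite exprn_ege1.
have hW : h ^+ 2 <= W.
  apply: le_trans hE_le _; apply: le_trans EL _; apply: le_trans EL2 _.
  by apply: ler_peMl => //; apply: mulr_ge0 => //; exact: ltW.
have Weps : 2 ^+ 34 * W <= eps.
  have d3 : 0 < dl ^+ 3 * eps by rewrite mulr_gt0// exprn_gt0.
  have d3' : 0 < dl ^+ 3 by rewrite exprn_gt0.
  move: Leps; rewrite ler_pdivrMr// => Leps.
  have k12p : 0 < k ^+ 12 by rewrite exprn_gt0.
  have c17 : 2 ^+ 34 * (27 * 2 ^+ 12) <= 2 ^+ 52 :> R.
    have -> : 2 ^+ 34 * (27 * 2 ^+ 12) = 2 ^+ 46 * 27 :> R by ring.
    have -> : 2 ^+ 52 = 2 ^+ 46 * 64 :> R by ring.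
    by apply: ler_wpM2l; [rewrite exprn_ge0|rewrite ler_nat].
  have q1 : 2 ^+ 34 * W * (dl ^+ 3 * L) <= 2 ^+ 52 * k ^+ 12.
    have -> : 2 ^+ 34 * W * (dl ^+ 3 * L)
      = 2 ^+ 34 * k ^+ 12 * (L * (L * E) * (dl ^+ 3 * L)) by rewrite /W; ring.
    have c0 : 0 <= 2 ^+ 34 * k ^+ 12 by rewrite mulr_ge0 ?exprn_ge0// ltW.
    apply: le_trans (ler_wpM2l c0 L2E) _.
    have -> : 2 ^+ 34 * k ^+ 12 * (27 * 2 ^+ 12) = 2 ^+ 34 * (27 * 2 ^+ 12) * k ^+ 12 by ring.
    by rewrite ler_pM2r.
  have q2 := le_trans q1 Leps.
  have dL : 0 < dl ^+ 3 * L by rewrite mulr_gt0.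
  rewrite -(ler_pM2r dL); apply: le_trans q2 _.
  by rewrite le_eqVlt; apply/orP; left; apply/eqP; ring.
have tot : \sum_x `|iter (a + (b + a)) (round predT n.-1) (point_mass R (n := n)) x
    - #|{perm 'I_n}|%:R^-1| <= (5 * 2 ^+ 30 + 20) * W by lra.
have c34 : 5 * 2 ^+ 30 + 20 <= 2 ^+ 34 :> R.
  have c5 : 1 <= 2 ^+ 30 :> R by rewrite exprn_ege1// ler1n.
  have -> : 2 ^+ 34 = 2 ^+ 30 * 16 :> R by ring.
  lra.
have := ler_wpM2r W0 c34.
set S := \sum_x _ in tot *; lra.
Qed.

(** The local phases take a proportion of order k^-2 of the leading term. *)
Lemma large_deck_time :
  ((a + (b + a)) * n.-1)%:R <= (1 + dl) * (n%:R ^+ 3 / (2 * pi ^+ 2)) * L.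
Proof.
have n1 : 1 <= n%:R :> R by rewrite ler1n.
have nk : N%:R <= 2 * n%:R / k.
  by rewrite /N natrM ler_pdivlMr// -mulrA ler_wpM2l.
have ik : k^-1 <= dl / 2 ^+ 13.
  rewrite -[leRHS]invrK lef_pV2 ?posrE ?invr_gt0 ?divr_gt0 ?exprn_gt0//.
  by rewrite invf_div; apply: K_large.
have ik1 : k^-1 <= 1 by rewrite invf_le1.
have ik0 : 0 <= k^-1 by rewrite invr_ge0 ltW.
have nL0 : 0 <= n%:R ^+ 2 * L by rewrite mulr_ge0 ?exprn_ge0// ltW.
have N2 : N%:R ^+ 2 <= 4 * n%:R ^+ 2 * (dl / 2 ^+ 13).
  apply: le_trans (_ : (2 * n%:R / k) ^+ 2 <= _).
    by rewrite lerXn2r ?nnegrE ?divr_ge0 ?mulr_ge0 ?(ltW np) ?(ltW kp).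
  have -> : (2 * n%:R / k) ^+ 2 = 4 * n%:R ^+ 2 * (k^-1 * k^-1).
    by field; exact: lt0r_neq0.
  apply: ler_wpM2l; first by rewrite mulr_ge0// exprn_ge0// ltW.
  by apply: le_trans ik; rewrite ler_piMr.
have p2 : 0 < 2 * pi ^+ 2 :> R by rewrite mulr_gt0// exprn_gt0// pi_gt0.
have p16 : pi ^+ 2 <= 16 :> R.
  have -> : 16 = 4 ^+ 2 :> R by ring.
  by rewrite lerXn2r ?nnegrE ?pi_ge0 ?pi_le4.
have ip : 32^-1 <= (2 * pi ^+ 2)^-1 :> R.
  by rewrite lef_pV2 ?posrE//; lra.
have dn2 : 2 ^+ 10 <= dl * (n%:R ^+ 2 * L).
  have d2 : 2 ^+ 10 <= dl * L by rewrite mulrC -ler_pdivrMr.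
  apply: le_trans d2 _; rewrite mulrCA ler_peMl ?exprn_ege1//.
  by rewrite mulr_ge0// ltW.
pose Q := n%:R ^+ 2 * L.
have tb : (a + (b + a))%:R <= (1 + dl) * (Q / (2 * pi ^+ 2)).
  have aa : a%:R <= 24 * (dl / 2 ^+ 13) * Q + 1.
    apply: le_trans a_le _; rewrite lerD2r.
    have := ler_wpM2r (ltW L0) N2.
    have -> : 24 * (dl / 2 ^+ 13) * Q = 6 * (4 * n%:R ^+ 2 * (dl / 2 ^+ 13) * L).
      by rewrite /Q; ring.
    by move=> q; rewrite -[leLHS]mulrA; apply: ler_wpM2l.
  have bb : b%:R <= (1 + dl / 2) * (Q / (2 * pi ^+ 2)) + 1.
    by apply: le_trans b_le _; rewrite lerD2r /Q le_eqVlt; apply/orP; left; apply/eqP; ring.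
  have gap : dl * Q / 64 <= dl / 2 * (Q / (2 * pi ^+ 2)).
    have : dl * Q * 32^-1 <= dl * Q * (2 * pi ^+ 2)^-1.
      by rewrite ler_wpM2l// mulr_ge0// ltW.
    by have -> : dl / 2 * (Q / (2 * pi ^+ 2)) = (dl * Q * (2 * pi ^+ 2)^-1) / 2; [ring|lra].
  rewrite !natrD.
  have : dl * Q / 64 = 48 * (dl / 2 ^+ 13) * Q + dl * Q * (64^-1 - 48 / 2 ^+ 13) by field.
  have : 3 <= dl * Q * (64^-1 - 48 / 2 ^+ 13).
    apply: le_trans (_ : 2 ^+ 10 * (64^-1 - 48 / 2 ^+ 13) <= _); first by lra.
    by apply: ler_wpM2r dn2; lra.
  lra.
rewrite natrM; apply: le_trans (_ : (1 + dl) * (Q / (2 * pi ^+ 2)) * n%:R <= _).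
  by apply: ler_pM => //; rewrite ler_nat leq_pred.
by rewrite /Q le_eqVlt; apply/orP; left; apply/eqP; ring.
Qed.

End LargeDeck.

(** * Upper bound on the mixing time *)

Lemma eventually_mixed (R : realType) (dl eps : R) : 0 < dl <= 1 -> 0 < eps ->
  exists n0 : nat, forall n, (n0 <= n)%N -> exists2 t : nat,
    cat_max_dist R n t <= eps &
    t%:R <= (1 + dl) * (n%:R ^+ 3 / (2 * pi ^+ 2)) * ln (n%:R : R).
Proof.
move=> dl01 eps0; have /andP[dl0 dl1] := dl01.
have split_sum (L x1 x2 x3 x4 : R) : 0 <= x1 -> 0 <= x3 -> 0 <= x4 ->
    4 + x1 + `|x2| + x3 + x4 <= L ->
    [/\ 4 <= L, x1 <= L, x2 <= L, x3 <= L & x4 <= L].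
  move=> *; have := ler_norm x2; have := normr_ge0 x2.
  by split; lra.
have c0 j : 0 <= 2 ^+ j :> R by rewrite exprn_ge0.
have q0 : 0 <= 2 ^+ 13 / dl by rewrite divr_ge0// ltW.
have [K Kge _] := nat_above q0.
pose c1 : R := 2 ^+ 22 * K%:R ^+ 4.
pose c2 : R := 4 / cos ((1 - dl / 16) * pi / 2).
pose c3 : R := 2 ^+ 10 / dl.
pose c4 : R := 2 ^+ 52 * K%:R ^+ 12 / (dl ^+ 3 * eps).
have c1p : 0 <= c1 by rewrite mulr_ge0// exprn_ge0.
have c3p : 0 <= c3 by rewrite divr_ge0// ltW.
have c4p : 0 <= c4.
  apply: divr_ge0; first by rewrite mulr_ge0// exprn_ge0.
  by rewrite mulr_ge0 ?exprn_ge0// ltW.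
have e0 : 0 <= 4 + c1 + `|c2| + c3 + c4 by rewrite !addr_ge0.
have [n0 n0ge _] := nat_above (expR_ge0 (4 + c1 + `|c2| + c3 + c4)).
exists n0 => n nn0.
have Lge : 4 + c1 + `|c2| + c3 + c4 <= ln n%:R.
  have h : expR (4 + c1 + `|c2| + c3 + c4) <= n%:R.
    by apply: le_trans n0ge _; rewrite ler_nat.
  rewrite -[leLHS]expRK ler_ln ?posrE ?expR_gt0//.
  exact: lt_le_trans (expR_gt0 _) h.
have [L4 L1 L2 L3 L5] := split_sum _ _ _ _ _ c1p c3p c4p Lge.
have Lp : 0 <= ln n%:R :> R by apply: le_trans L4.
have n2 : 0 <= n%:R ^+ 2 / (2 * pi ^+ 2) :> R.
  by rewrite divr_ge0 ?mulr_ge0 ?exprn_ge0 ?pi_ge0.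
have xa : 0 <= 6 * (2 * (n %/ K))%:R ^+ 2 * ln n%:R :> R.
  by apply: mulr_ge0 => //; rewrite mulr_ge0 ?exprn_ge0.
have xb : 0 <= (1 + dl / 2) * (n%:R ^+ 2 / (2 * pi ^+ 2)) * ln n%:R.
  have p0 : 0 <= 1 + dl / 2 by lra.
  exact: (mulr_ge0 (mulr_ge0 p0 n2) Lp).
have xs : 0 <= 4 * K%:R ^+ 2 * ln n%:R :> R.
  by apply: mulr_ge0 => //; rewrite mulr_ge0 ?exprn_ge0.
have [a a1 a2] := nat_above xa; have [b b1 b2] := nat_above xb.
have [s s1 s2] := nat_above xs.
have x0 : 0 <= n%:R / (2 ^+ 21 * K%:R ^+ 4) :> R by rewrite divr_ge0 ?mulr_ge0 ?exprn_ge0.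
have /andP[d1 /ltW] := truncn_itv x0; set d := Num.truncn _ in d1 *.
rewrite -(natr1 d) => d2.
exists ((a + (b + a)) * n.-1)%N.
  exact: (large_deck_mixed dl01 Kge L4 L1 L2 L3 a1 b1 b2 s1 s2 d1 d2 eps0 L5).
exact: (large_deck_time dl01 Kge L4 L1 L3 a2 b2).
Qed.

(** With a single block, shuffling inside the blocks is the whole shuffle. *)
Lemma mixed_finite (R : realType) (eps : R) n : (1 < n)%N -> 0 < eps ->
  exists t, cat_max_dist R n t <= eps.
Proof.
move=> n1 eps0; pose N := (4 + n)%N.
have N4 : (4 <= N)%N by rewrite leq_addr.
have b0 p : blk n 1 p = 0%N by rewrite /blk /= minn0.
have len p : (p < n)%N -> (p - blk n 1 p * n < N)%N.
  by move=> pn; rewrite b0 mul0n subn0 (leq_trans pn)// leq_addl.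
set q := wave_rate (N%:R^-1 : R).
have q0 : 0 <= q := wave_rate_ge0 (cos_al_ge0 R N4).
have q1 : q < 1.
  apply: le_lt_trans (wave_rate_block R N4) _.
  have : 0 < (N%:R^-1 : R) ^+ 2 by rewrite exprn_gt0 ?invr_gt0 ?ltr0n.
  lra.
have [r hr] := geometric_small (4 * n%:R * N%:R * q) q0 q1 eps0.
exists (r.+1 * n.-1)%N; rewrite cat_max_dist_rounds//.
have allT : inner_edge n 1 = predT.
  by apply/funext => e; rewrite /inner_edge !b0 eqxx.
have bT : block_perms n n 1 = [set: 'S_n]%SET.
  by apply/setP => h; rewrite !inE; apply/forallP => p; rewrite !b0.
have := @block_mixing R n n 1 N N4 len r.+1 (point_mass R (n := n)).
have -> : \sum_x `|point_mass R (n := n) x| = 1.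
  rewrite -(sum_point_mass R n); apply: eq_bigr => x _.
  by rewrite ger0_norm// /point_mass ler0n.
rewrite allT mulr1 => H.
have avg x : block_avg n 1 (@point_mass R n) x = #|{perm 'I_n}|%:R^-1.
  rewrite /block_avg bT cardsT.
  rewrite (_ : \sum_(h in _) _ = 1) ?mul1r//.
  rewrite -(sum_point_mass R n) [RHS](reindex_inj (mulIg x)).
  by apply: eq_bigl => h; rewrite !inE.
have e : block_error R n N r.+1 < eps.
  by apply: le_lt_trans hr; rewrite /block_error -/q exprS mulrA.
have H' : \sum_x `|iter r.+1 (round predT n.-1) (@point_mass R n) x
    - #|{perm 'I_n}|%:R^-1| <= block_error R n N r.+1.
  by apply: le_trans H; apply: ler_sum => x _; rewrite avg.
set S := \sum_x _ in H' *.
have S0 : 0 <= S by apply: sumr_ge0.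
lra.
Qed.

Lemma tmix_le (R : realType) n (eps : R) t : cat_max_dist R n t <= eps ->
  (cat_tmix n eps <= (t%:R)%:E)%E.
Proof. by move=> h; apply: ereal_inf_lbound; exists t. Qed.

Lemma tmix_ge0 (R : realType) n (eps : R) : (0 <= cat_tmix n eps)%E.
Proof. by apply: le_ereal_inf_tmp => _ [t _ <-]; rewrite lee_fin. Qed.

(** For large decks the relative excess of the mixing time over its leading
    term is below any given positive number; the finitely many other decks
    only need a finite mixing time. *)
Lemma tmix_upper (R : realType) (eps : R) : 0 < eps ->
  exists2 delta : nat -> R, (delta @ \oo --> 0)%classic &
    forall n : nat, (2 <= n)%N ->
      (cat_tmix n eps
       <= ((1 + delta n) * (n%:R ^+ 3 / (2 * pi ^+ 2)) * ln n%:R)%:E)%E.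
Proof.
move=> eps0; pose lead (n : nat) : R := n%:R ^+ 3 / (2 * pi ^+ 2) * ln n%:R.
have lead0 n : (1 < n)%N -> 0 < lead n.
  move=> n1; apply: mulr_gt0; last by apply: ln_gt0; rewrite ltr1n.
  by rewrite divr_gt0 ?mulr_gt0 ?exprn_gt0 ?pi_gt0// ltr0n ltnW.
have fin n : (1 < n)%N -> cat_tmix n eps \is a fin_num.
  move=> n1; rewrite ge0_fin_numE ?tmix_ge0//.
  have [t ht] := mixed_finite n1 eps0.
  by apply: le_lt_trans (tmix_le ht) _; rewrite ltry.
exists (fun n => Num.max 0 (fine (cat_tmix n eps) / lead n - 1)); last first.
  move=> n n1; rewrite -[leLHS]fineK ?fin// lee_fin -mulrA -/(lead n).
  rewrite -ler_pdivrMr ?lead0// -lerBlDl.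
  by rewrite le_max lexx orbT.
apply/cvgrPdist_le => /= e e0.
pose dl := Num.min e 1.
have dl01 : 0 < dl <= 1 by rewrite lt_min e0 ltr01 /= ge_min lexx orbT.
have [n0 H] := eventually_mixed dl01 eps0.
exists (maxn n0 2) => // n /= nbig.
have nn0 : (n0 <= n)%N := leq_trans (leq_maxl _ _) nbig.
have n1 : (1 < n)%N := leq_trans (leq_maxr _ _) nbig.
have [t ht tle] := H n nn0.
rewrite sub0r normrN ger0_norm; last by rewrite le_max lexx.
rewrite ge_max ltW//= lerBlDr ler_pdivrMr ?lead0//.
apply: (@le_trans _ _ ((1 + dl) * lead n)); last first.
  by rewrite ler_pM2r ?lead0// addrC lerD2r /dl ge_min lexx.
apply: le_trans (_ : t%:R <= _); last by rewrite /lead mulrA.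
by rewrite -lee_fin fineK ?fin// tmix_le.
Qed.

Theorem theorem1 (R : realType) :
  (exists2 c : R, 0 < c &
     forall (eps : R) (n : nat), 0 < eps -> (2 <= n)%N ->
       ((n%:R ^+ 3 / (2 * pi ^+ 2) * ln n%:R
         - n%:R ^+ 3 / (2 * pi ^+ 2) * ln (c * ln n%:R / eps))%:E
        <= cat_tmix n (1 - eps))%E)
  /\
  (forall eps : R, 0 < eps ->
     exists2 delta : nat -> R, (delta @ \oo --> 0)%classic &
       forall n : nat, (2 <= n)%N ->
         (cat_tmix n eps
          <= ((1 + delta n) * (n%:R ^+ 3 / (2 * pi ^+ 2)) * ln n%:R)%:E)%E).
Proof. by split; [exact: tmix_lower|exact: tmix_upper]. Qed.
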